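(* Let $k,m\in\mathbb{N}$ and $\delta>0$. Let $Z$ be a finite $m$-torsion abelian group with primary decomposition $Z=\bigoplus_{p\in\mathcal{P}}Z_p$, where $\mathcal{P}$ is the set of primes dividing $|Z|$, and let $f:Z\to\mathbb{C}$ be 1-bounded. Suppose that there is an $m$-torsion nilspace polynomial $F\circ\phi$ of degree $k$ and complexity $M$ on $Z$ such that $|\mathbb{E}_{z\in Z}f(z)F\circ\phi(z)|\ge\delta$. Then for some $\varepsilon=\varepsilon(\delta,M)>0$, for each $p\in\mathcal{P}$ there exists a $p$-nilspace polynomial $F_p\circ\phi_p:Z_p\to\mathbb{C}$ of degree $k$ and complexity at most $M'(M)$ (depending only on $M$), with underlying morphism $\phi_p:\mathcal{D}_1(Z_p)\to X_p$, such that $$\Big|\mathbb{E}_{z\in Z}f(z)\prod_{p\in\mathcal{P}}F_p\circ\phi_p(z_p)\Big|\ge\varepsilon,$$ where $z=(z_p)_{p\in\mathcal{P}}$ with $z_p\in Z_p$. Moreover, for any $b>0$ there exists $b'=b'(M,b)>0$ such that if $\phi$ is $b'$-balanced, then for every $p\in\mathcal{P}$ the morphism $\phi_p:\mathcal{D}_1(Z_p)\to X_p$ is $b$-balanced.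
   Context: An abelian group $Z$ is $m$-torsion if $mx=0$ for all $x\in Z$. $Z_p$ is the subgroup of elements of $p$-power order. A function is 1-bounded if its modulus is at most 1. $\mathbb{E}$ denotes the average. Nilspaces. A morphism $\{0,1\}^m\to\{0,1\}^n$ of discrete cubes is the restriction of an affine homomorphism $\mathbb{Z}^m\to\mathbb{Z}^n$. A nilspace is a non-empty set $X$ with sets $C^n(X)\subset X^{\{0,1\}^n}$ ($n\ge 0$) of $n$-cubes such that: (composition) $c\circ\theta\in C^m(X)$ for $c\in C^n(X)$ and $\theta:\{0,1\}^m\to\{0,1\}^n$ a morphism; (ergodicity) $C^0(X)=X$, $C^1(X)=X^{\{0,1\}}$; (corner completion) if $c':\{0,1\}^n\setminus\{1^n\}\to X$ restricts to an $(n-1)$-cube on each $(n-1)$-face containing $0^n$, then $c'$ extends to some $c\in C^n(X)$. $X$ is $k$-step if this extension is always unique for $n=k+1$. A morphism of nilspaces is a map taking cubes to cubes. For an abelian group $A$ and $\ell\ge1$, $\mathcal{D}_\ell(A)$ is the nilspace on $A$ where $c:\{0,1\}^n\to A$ is a cube iff $\sum_{v\in\{0,1\}^{\ell+1}}(-1)^{|v|}c(\theta(v))=0$ for every morphism $\theta:\{0,1\}^{\ell+1}\to\{0,1\}^n$, with $|v|=\sum_iv_i$. For a $k$-step nilspace $X$, write $x\sim_i y$ if there are $c,c'\in C^{i+1}(X)$ with $c(0^{i+1})=x$, $c'(0^{i+1})=y$ and $c(v)=c'(v)$ for $v\ne 0^{i+1}$; then $X_i:=X/\sim_i$, with the images of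 cubes, is an $i$-step nilspace ($X_0$ is a point, $X_k=X$). The $i$-th structure group $Z_i(X)$ ($1\le i\le k$) is the abelian group acting on $X_i$, simply transitively on each fibre of $X_i\to X_{i-1}$, such that if $c\in C^n(X_i)$ and $c':\{0,1\}^n\to X_i$ have the same projection to $X_{i-1}$, then $c'\in C^n(X_i)$ iff $c'-c:\{0,1\}^n\to Z_i(X)$ is a cube on $\mathcal{D}_i(Z_i(X))$. A $k$-step compact nilspace carries a compact, Hausdorff, second-countable topology with each $C^n(X)$ closed; it has finite rank if every structure group is a compact abelian Lie group. There are countably many isomorphism classes of $k$-step compact finite-rank nilspaces; one fixes a numbering of them by the positive integers (complexity notion), and the complexity of $X$ is its number. A $k$-step nilspace is a $p$-nilspace (resp. $m$-torsion nilspace) if every structure group is a $p$-group (resp. an $m$-torsion group). An $m$-torsion compact finite-rank nilspace is finite. A nilspace polynomial of degree $k$ on a finite abelian group $Z$ is a function $F\circ\phi:Z\to\mathbb{C}$ where $\phi:\mathcal{D}_1(Z)\to X$ is a morphism into a $k$-step compact finite-rank nilspace $X$ and $F:X\to\mathbb{C}$ is 1-bounded. Its complexity is (at most) that of $X$, and it is a $p$-nilspace (resp. $m$-torsion nilspace) polynomial if $X$ is a $p$-nilspace (resp. $m$-torsion nilspace). Balance. For each finite nilspace $X$ and each $n$ fix a metric $d_n$ on the space of probability measures on $C^n(X)$, inducing the usual topology. A morphism $\phi:\mathcal{D}_1(Z)\to X$ ($Z$ a finite abelian group) is $b$-balanced ($b>0$) if for every $n\le 1/b$ the image, under $c\mapsto\phi\circ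 c$, of the uniform probability measure on $C^n(\mathcal{D}_1(Z))$ is at $d_n$-distance at most $b$ from the uniform probability measure on $C^n(X)$.
   Formalization: The metrics d_n are assumed to be fixed up to isomorphism: any two isomorphic finite nilspaces are related by some isomorphism that is an isometry for all d_n; with unrelated metrics on isomorphic copies, no b' depending only on M and b need exist. *)

(* Defs.v *)
From HB Require Import structures.
From mathcomp Require Import all_boot all_order all_algebra.
From mathcomp Require Import generic_quotient finmap.
From mathcomp Require Import all_classical all_reals all_analysis.
From mathcomp Require Import complex.

Set Implicit Arguments.
Unset Strict Implicit.
Unset Printing Implicit Defensive.

Import Order.TTheory GRing.Theory Num.Theory.
Import numFieldNormedType.Exports.

Local Open Scope classical_set_scope.
Local Open Scope ring_scope.

Definition dcube (n : nat) := {ffun 'I_n -> bool}.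

Definition cube0 (n : nat) : dcube n := [ffun=> false].
Definition cube1 (n : nat) : dcube n := [ffun=> true].

Definition weight (n : nat) (v : dcube n) : nat := (\sum_(i < n) v i)%N.

Definition cube_to_int (n : nat) (v : dcube n) : 'cV[int]_n :=
  \col_i (v i : nat)%:Z.

Definition cube_morphism (m n : nat) (theta : dcube m -> dcube n) : Prop :=
  exists (A : 'M[int]_(n, m)) (b : 'cV[int]_n),
    forall v, cube_to_int (theta v) = A *m cube_to_int v + b.

(* The parametrization by {0,1}^n of the n-face {v | v i = 0} of {0,1}^(n+1).
   These are the n-faces containing 0^(n+1). *)
Definition lower_face (n : nat) (i : 'I_n.+1) (v : dcube n) : dcube n.+1 :=
  [ffun j => if unlift i j is Some j' then v j' else false].

Definition cube_family (T : Type) := forall n : nat, set (dcube n -> T).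

Definition morphism (T U : Type) (C : cube_family T) (D : cube_family U)
    (f : T -> U) : Prop :=
  forall n (c : dcube n -> T), C n c -> D n (f \o c).

(* A corner on {0,1}^(n+1) \ {1^(n+1)} is represented by a total function,
   whose value at 1^(n+1) is irrelevant: no lower face contains this vertex,
   and completions are only required to agree with it elsewhere. *)
Definition is_corner (T : Type) (C : cube_family T) (n : nat)
    (c' : dcube n.+1 -> T) : Prop :=
  forall i : 'I_n.+1, C n (c' \o lower_face i).

Definition completes (T : Type) (C : cube_family T) (n : nat)
    (c' c : dcube n.+1 -> T) : Prop :=
  C n.+1 c /\ (forall v, v != cube1 n.+1 -> c v = c' v).

(* Corner completion in dimension 0 (where the corner is the empty function)
   says that X is non-empty, hence only positive dimensions appear in
   nilspace_completion. *)
Record is_nilspace (T : Type) (C : cube_family T) : Prop := IsNilspace {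
  nilspace_nonempty : [set: T] !=set0;
  nilspace_composition : forall m n (theta : dcube m -> dcube n) c,
    cube_morphism theta -> C n c -> C m (c \o theta);
  nilspace_ergodic0 : C 0%N = setT;
  nilspace_ergodic1 : C 1%N = setT;
  nilspace_completion : forall n (c' : dcube n.+1 -> T),
    is_corner C c' -> exists c, completes C c' c }.

Definition step (T : Type) (k : nat) (C : cube_family T) : Prop :=
  forall (c' c1 c2 : dcube k.+1 -> T),
    is_corner C c' -> completes C c' c1 -> completes C c' c2 -> c1 = c2.

(* Classically every type is a choiceType, so this is no restriction on X. *)
Record nilspace := Nilspace {
  ns_sort :> choiceType;
  ns_cubes : cube_family ns_sort;
  ns_axioms : is_nilspace ns_cubes }.

Arguments ns_cubes : clear implicits.

Definition Dcubes (l : nat) (A : zmodType) : cube_family A :=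
  fun n => [set c | forall theta : dcube l.+1 -> dcube n,
    cube_morphism theta -> \sum_(v : dcube l.+1) c (theta v) *~ (-1) ^+ weight v = 0].

Arguments Dcubes : clear implicits.

Definition sim (T : Type) (C : cube_family T) (i : nat) (x y : T) : Prop :=
  exists c c' : dcube i.+1 -> T,
    [/\ C i.+1 c, C i.+1 c', c (cube0 i.+1) = x, c' (cube0 i.+1) = y &
        forall v, v != cube0 i.+1 -> c v = c' v].

Section Factor.
Context (T : Type) (C : cube_family T) (i : nat).

(* Elements of X_i are the classes {y | x ~_i y}; the relation ~_i is an
   equivalence relation on any nilspace. *)
Definition factor : Type := {A : set T | exists x, A = sim C i x}.

Definition factor_pi (x : T) : factor :=
  exist _ (sim C i x) (ex_intro _ x erefl).

Definition factor_repr (u : factor) : T := projT1 (cid (proj2_sig u)).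

Lemma factor_reprK : cancel factor_repr factor_pi.
Proof.
case=> A hA; rewrite /factor_repr /=; case: cid => x /= Ax.
exact/eq_exist.
Qed.

HB.instance Definition _ := isQuotient.Build T factor factor_reprK.

Definition factor_cubes : cube_family factor :=
  fun n => [set c | exists2 c0, @C n c0 & c = factor_pi \o c0].

End Factor.

(* The projection X_i -> X_(i-1), computed on representatives: ~_i refines
   ~_(i-1), so the choice of factor_repr u is immaterial. *)
Definition factor_proj (T : Type) (C : cube_family T) (i : nat)
    (u : factor C i) : factor C i.-1 :=
  factor_pi C i.-1 (factor_repr u).

Record is_structure_group (T : Type) (C : cube_family T) (i : nat)
    (A : zmodType) (act : A -> factor C i -> factor C i) : Prop :=
  IsStructureGroup {
  structure_act0 : forall u, act 0 u = u;
  structure_actD : forall a b u, act (a + b) u = act a (act b u);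
  structure_act_fibre : forall a u, factor_proj (act a u) = factor_proj u;
  structure_act_simply_transitive : forall u v,
    factor_proj u = factor_proj v -> exists! a, act a u = v;
  (* d is the difference c' - c : {0,1}^n -> Z_i(X) *)
  structure_act_cubes : forall n (c c' : dcube n -> factor C i),
    factor_cubes c -> (forall v, factor_proj (c' v) = factor_proj (c v)) ->
    (factor_cubes c' <->
     exists2 d : dcube n -> A, Dcubes i A n d & forall v, c' v = act (d v) (c v)) }.

Definition is_torsion (m : nat) (A : zmodType) : Prop :=
  forall a : A, a *+ m = 0.

Definition is_pgroup (p : nat) (A : zmodType) : Prop :=
  forall a : A, exists j : nat, a *+ (p ^ j) = 0.

Definition torsion_nilspace (T : Type) (k m : nat) (C : cube_family T) : Prop :=
  forall i, (1 <= i <= k)%N ->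
    exists (A : zmodType) (act : A -> factor C i -> factor C i),
      is_structure_group act /\ is_torsion m A.

Definition p_nilspace (T : Type) (k p : nat) (C : cube_family T) : Prop :=
  forall i, (1 <= i <= k)%N ->
    exists (A : zmodType) (act : A -> factor C i -> factor C i),
      is_structure_group act /\ is_pgroup p A.

(* f is C^r on the open set U: existence and differentiability of all iterated
   directional derivatives up to order r - 1, and continuity of those of
   order r. On finite-dimensional spaces this is the usual notion. *)
Fixpoint C_r (R : realType) (V W : normedModType R) (r : nat) (U : set V)
    (f : V -> W) : Prop :=
  match r with
  | 0%N => forall x, U x -> {for x, continuous f}
  | r'.+1 => (forall x, U x -> differentiable f x) /\
             (forall v : V, C_r r' U ('D_v f))
  end.

Definition smooth_on (R : realType) (V W : normedModType R) (U : set V)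
    (f : V -> W) : Prop :=
  forall r, C_r r U f.

Record chart (R : realType) (n : nat) (A : Type) := Chart {
  chart_dom : set A;
  chart_map : A -> 'rV[R]_n;
  chart_inv : 'rV[R]_n -> A }.

Definition chart_cod (R : realType) (n : nat) (A : Type) (h : chart R n A) :
    set 'rV[R]_n :=
  chart_map h @` chart_dom h.

Record is_chart (R : realType) (n : nat) (A : topologicalType)
    (h : chart R n A) : Prop := IsChart {
  chart_dom_open : open (chart_dom h);
  chart_cod_open : open (chart_cod h);
  chart_mapK : forall a, chart_dom h a -> chart_inv h (chart_map h a) = a;
  chart_map_continuous : forall a, chart_dom h a ->
    {for a, continuous (chart_map h)};
  chart_inv_continuous : forall x, chart_cod h x ->
    {for x, continuous (chart_inv h)} }.

Record lie_atlas (R : realType) (n : nat) (A : topologicalZmodType)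
    (atlas : set (chart R n A)) : Prop := LieAtlas {
  atlas_chart : forall h, atlas h -> is_chart h;
  atlas_cover : forall a, exists2 h, atlas h & chart_dom h a;
  atlas_transition : forall h1 h2, atlas h1 -> atlas h2 ->
    smooth_on [set x | chart_cod h1 x /\ chart_dom h2 (chart_inv h1 x)]
      (chart_map h2 \o chart_inv h1);
  atlas_add : forall h1 h2 h3, atlas h1 -> atlas h2 -> atlas h3 ->
    smooth_on
      [set x : 'rV[R]_n * 'rV[R]_n | [/\ chart_cod h1 x.1, chart_cod h2 x.2 &
         chart_dom h3 (chart_inv h1 x.1 + chart_inv h2 x.2)]]
      (fun x => chart_map h3 (chart_inv h1 x.1 + chart_inv h2 x.2));
  atlas_opp : forall h1 h2, atlas h1 -> atlas h2 ->
    smooth_on [set x | chart_cod h1 x /\ chart_dom h2 (- chart_inv h1 x)]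
      (fun x => chart_map h2 (- chart_inv h1 x)) }.

Definition compact_abelian_lie (R : realType) (A : topologicalZmodType) : Prop :=
  [/\ compact [set: A], hausdorff_space A &
      exists n (atlas : set (chart R n A)), lie_atlas atlas].

Record compact_nilspace := CompactNilspace {
  cn_sort :> topologicalType;
  cn_cubes : cube_family cn_sort;
  cn_axioms : is_nilspace cn_cubes;
  cn_compact : compact [set: cn_sort];
  cn_hausdorff : hausdorff_space cn_sort;
  cn_second_countable : @second_countable cn_sort;
  cn_closed : forall n,
    closed (@cn_cubes n : set {ptws dcube n -> cn_sort}) }.

Arguments cn_cubes : clear implicits.

Definition forget_topology (X : compact_nilspace) : nilspace :=
  Nilspace (cn_axioms X).

(* X_i carries the quotient topology; the topology of the structure group is
   the one making it a compact Hausdorff group acting continuously on X_i. *)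
Definition finite_rank (R : realType) (k : nat) (X : compact_nilspace) : Prop :=
  forall i, (1 <= i <= k)%N ->
    let Xi := quotient_topology (factor (cn_cubes X) i) in
    exists (A : topologicalZmodType) (act : A -> Xi -> Xi),
      [/\ is_structure_group (act : A -> factor (cn_cubes X) i -> _),
          continuous (fun z : A * Xi => act z.1 z.2) &
          compact_abelian_lie R A].

Definition cfr_nilspace (R : realType) (k : nat) (X : compact_nilspace) : Prop :=
  step k (cn_cubes X) /\ finite_rank R k X.

Definition cn_isomorphic (X Y : compact_nilspace) : Prop :=
  exists (f : X -> Y) (g : Y -> X),
    [/\ cancel f g, cancel g f,
        morphism (cn_cubes X) (cn_cubes Y) f,
        morphism (cn_cubes Y) (cn_cubes X) g &
        continuous f /\ continuous g].

Record complexity_notion (R : realType) (k : nat)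
    (num : compact_nilspace -> nat) : Prop := ComplexityNotion {
  complexity_pos : forall X, cfr_nilspace R k X -> (0 < num X)%N;
  complexity_iso : forall X Y, cfr_nilspace R k X -> cfr_nilspace R k Y ->
    (num X = num Y <-> cn_isomorphic X Y);
  complexity_surj : forall N, (0 < N)%N ->
    exists2 X, cfr_nilspace R k X & num X = N }.

(* Probability measures on a finite set S are given by their mass functions,
   extended by 0 outside S. *)
Definition is_prob (R : realType) (T : choiceType) (S : set T) (mu : T -> R) :
    Prop :=
  [/\ forall x, 0 <= mu x, forall x, ~ S x -> mu x = 0 &
      \sum_(x \in S) mu x = 1].

Definition uniform_on (R : realType) (T : choiceType) (S : set T) : T -> R :=
  fun x => if x \in S then ((#|` fset_set S|)%:R)^-1 else 0.

Definition image_prob (R : realType) (T U : choiceType) (g : T -> U)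
    (mu : T -> R) : U -> R :=
  fun y => \sum_(x \in g @^-1` [set y]) mu x.

Definition cube_metrics (R : realType) :=
  forall (X : nilspace) (n : nat), ((dcube n -> X) -> R) ->
    ((dcube n -> X) -> R) -> R.

(* The last two fields say that rho induces the usual topology on the simplex of
   probability measures on S, i.e. that of pointwise convergence. *)
Record is_prob_metric (R : realType) (T : choiceType) (S : set T)
    (rho : (T -> R) -> (T -> R) -> R) : Prop := IsProbMetric {
  prob_metric_ge0 : forall mu nu, is_prob S mu -> is_prob S nu ->
    0 <= rho mu nu;
  prob_metric_eq0 : forall mu nu, is_prob S mu -> is_prob S nu ->
    (rho mu nu = 0 <-> mu = nu);
  prob_metric_sym : forall mu nu, is_prob S mu -> is_prob S nu ->
    rho mu nu = rho nu mu;
  prob_metric_triangle : forall mu nu xi,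
    is_prob S mu -> is_prob S nu -> is_prob S xi ->
    rho mu xi <= rho mu nu + rho nu xi;
  prob_metric_weaker : forall mu, is_prob S mu -> forall e, 0 < e ->
    exists2 e', 0 < e' & forall nu, is_prob S nu ->
      (forall x, `|mu x - nu x| < e') -> rho mu nu < e;
  prob_metric_finer : forall mu, is_prob S mu -> forall e, 0 < e ->
    exists2 e', 0 < e' & forall nu, is_prob S nu ->
      rho mu nu < e' -> forall x, `|mu x - nu x| < e }.

Definition ns_isomorphism (X Y : nilspace) (f : X -> Y) : Prop :=
  morphism (ns_cubes X) (ns_cubes Y) f /\
  exists g : Y -> X,
    [/\ cancel f g, cancel g f & morphism (ns_cubes Y) (ns_cubes X) g].

(* The metrics are fixed for each finite nilspace up to isomorphism: without
   balance_transport, rescaling d on the infinitely many copies of one nilspace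
   would leave no bound on balance that depends only on the complexity. *)
Record balance_metrics (R : realType) (d : cube_metrics R) : Prop :=
  BalanceMetrics {
  balance_metric : forall (X : nilspace) n, finite_set [set: X] ->
    is_prob_metric (ns_cubes X n) (d X n);
  balance_transport : forall X Y : nilspace,
    finite_set [set: X] -> finite_set [set: Y] ->
    (exists f : X -> Y, ns_isomorphism f) ->
    exists2 f : X -> Y, ns_isomorphism f &
      forall n mu nu, is_prob (ns_cubes X n) mu -> is_prob (ns_cubes X n) nu ->
        d Y n (image_prob (fun c => f \o c) mu) (image_prob (fun c => f \o c) nu)
        = d X n mu nu }.

(* Balance is only meaningful for finite X, where d X n is a metric. *)
Definition balanced (R : realType) (d : cube_metrics R) (b : R)
    (Z : finZmodType) (X : nilspace) (phi : Z -> X) : Prop :=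
  finite_set [set: X] /\
  forall n : nat, n%:R <= b^-1 ->
    d X n (image_prob (fun c => phi \o c) (uniform_on R (Dcubes 1 Z n)))
          (uniform_on R (ns_cubes X n)) <= b.

(* M is an upper bound for the complexity num X *)
Definition nilspace_polynomial (R : realType) (k : nat)
    (num : compact_nilspace -> nat) (M : nat) (Z : finZmodType)
    (X : compact_nilspace) (phi : Z -> X) (F : X -> R[i]) : Prop :=
  [/\ cfr_nilspace R k X, (num X <= M)%N,
      morphism (Dcubes 1 Z) (cn_cubes X) phi &
      forall x, `|F x| <= 1].

Definition average (R : realType) (Z : finZmodType) (g : Z -> R[i]) : R[i] :=
  (#|Z|%:R)^-1 * \sum_(z : Z) g z.

Definition p_power_torsion (Z : zmodType) (p : nat) : {pred Z} :=
  fun z => `[< exists j : nat, z *+ (p ^ j) = 0 >].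

Lemma p_power_torsion_zmod_closed (Z : zmodType) (p : nat) :
  zmod_closed (@p_power_torsion Z p).
Proof.
split; first by apply/asboolP; exists 0%N; rewrite mul0rn.
move=> x y /asboolP[i xi] /asboolP[j yj]; apply/asboolP; exists (i + j)%N.
by rewrite mulrnBl expnD {1}mulrnA xi mul0rn mulnC mulrnA yj mul0rn subrr.
Qed.

HB.instance Definition _ (Z : zmodType) (p : nat) :=
  GRing.isZmodClosed.Build Z (@p_power_torsion Z p)
    (p_power_torsion_zmod_closed Z p).

Record primary (Z : finZmodType) (p : nat) := Primary {
  primary_val : Z;
  _ : primary_val \in p_power_torsion p }.

HB.instance Definition _ (Z : finZmodType) (p : nat) :=
  [isSub for @primary_val Z p].
HB.instance Definition _ (Z : finZmodType) (p : nat) :=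
  [Finite of primary Z p by <:].
HB.instance Definition _ (Z : finZmodType) (p : nat) :=
  [SubChoice_isSubZmodule of primary Z p by <:].

(* Since Z is the direct sum of the Z_p, this determines comp p z for all p
   dividing #|Z|: comp p z is the component z_p of z. *)
Definition primary_decomposition (Z : finZmodType)
    (comp : forall p : nat, Z -> primary Z p) : Prop :=
  forall z, z = \sum_(p <- primes #|Z|) primary_val (comp p z).

(* Main.v *)
(* A finite nilspace X with m-torsion structure groups maps injectively
   to a product of p-nilspaces X_p, p | m, by nilspace morphisms. The map X -> X_p
   is obtained by killing the p'-parts of all the structure groups. The p'-part of
   the top group can be divided out directly. For the lower ones, two successive extensions
   E -> Y -> Z, by a p-group A of degree k and then by a p'-group B of degree j,
   can be exchanged: the action of B lifts from Y to E. Indeed, since #|B| is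
   invertible on A, averaging the cocycle of E -> Y over B yields a section whose
   cocycle is B-invariant, so that B acts on E by automorphisms; that this action
   has degree j follows by induction on j, because the obstructions are
   homomorphisms from B to A.
   A morphism from Z to a p-nilspace depends only on z_p, because a polynomial map
   from a p'-group to a p-group is constant. So phi is determined by its images
   phi_p : Z_p -> X_p; the indicator function of a point of X is a product of
   functions of the phi_p, and by pigeonhole one point of X gives a correlation at
   least delta / #|X|. The maps X -> X_p and Z -> Z_p send uniform measures on
   cubes to uniform measures, hence balance passes from phi to phi_p.
   X is finite because a torsion compact abelian Lie group has dimension 0, and
   the bounds depend only on M because there are finitely many isomorphism classes
   of complexity at most M. *)
From Pilot Require Import Defs.
From HB Require Import structures.
From mathcomp Require Import all_boot all_order all_algebra zify lra.
From mathcomp Require Import finmap fingroup cyclic pgroup zmodp.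
From mathcomp Require Import all_classical all_reals all_analysis.
From mathcomp Require Import complex.

Import Order.TTheory GRing.Theory Num.Theory.
Import numFieldNormedType.Exports.

Local Open Scope classical_set_scope.
Local Open Scope ring_scope.
Set Implicit Arguments.
Unset Strict Implicit.
Unset Printing Implicit Defensive.

(** * Discrete cubes and the nilspaces D_l(A) *)

(** The quotients met while exchanging extensions are no longer factors of X, so the argument runs
    on abstract extensions and towers of them; these are translated from and to the quotients by ~_i
    only at the two ends. Invariance of the averaged cocycle only shows that constants in B, once
    lifted, preserve cubes. For functions of degree j with values in B there remains an obstruction
    in A, which is annihilated by #|B| and therefore vanishes. Injectivity of X into the product of
    the X_p cannot be read off maps obtained separately for each p, so relations containing their
    kernels are fixed beforehand. As m is not bounded in terms of M, the data of an isomorphism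
    class come from one representative with an exponent m0 of its own. The primes dividing m0 and
    #|Z| may differ: a prime dividing only #|Z| receives a one-point nilspace, and a prime dividing
    only m0 gives a constant coordinate that the product does not test, which is why the point found
    by pigeonhole has to be a value of the morphism. *)

Definition upd (n : nat) (i : 'I_n) (t : bool) (v : dcube n) : dcube n :=
  [ffun j => if j == i then t else v j].

Definition flip (n : nat) (i : 'I_n) (v : dcube n) : dcube n := upd i (~~ v i) v.

Definition face (n : nat) (i : 'I_n.+1) (t : bool) (v : dcube n) : dcube n.+1 :=
  [ffun j => if unlift i j is Some j' then v j' else t].

Definition drop_coord (n : nat) (i : 'I_n.+1) (v : dcube n.+1) : dcube n :=
  [ffun j => v (lift i j)].

Definition alt (n : nat) (A : zmodType) (f : dcube n -> A) : A :=
  \sum_(v : dcube n) f v *~ (-1) ^+ weight v.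

Lemma lower_faceE n (i : 'I_n.+1) : lower_face i = face i false.
Proof. by []. Qed.

Lemma face_id n (i : 'I_n.+1) t v : face i t v i = t.
Proof. by rewrite ffunE unlift_none. Qed.

Lemma face_lift n (i : 'I_n.+1) t v j : face i t v (lift i j) = v j.
Proof. by rewrite ffunE liftK. Qed.

Lemma drop_face n (i : 'I_n.+1) t v : drop_coord i (face i t v) = v.
Proof. by apply/ffunP => j; rewrite ffunE face_lift. Qed.

Lemma face_drop n (i : 'I_n.+1) t v : face i t (drop_coord i v) = upd i t v.
Proof.
apply/ffunP => j; rewrite !ffunE; case: (unliftP i j) => [j' ->|->].
  by rewrite ffunE eq_sym (negPf (neq_lift _ _)).
by rewrite eqxx.
Qed.

Lemma upd_face n (i : 'I_n.+1) t t' v : upd i t (face i t' v) = face i t v.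
Proof. by rewrite -face_drop drop_face. Qed.

Lemma upd_id n (i : 'I_n) t v : upd i t v i = t.
Proof. by rewrite ffunE eqxx. Qed.

Lemma upd_neq n (i j : 'I_n) t v : j != i -> upd i t v j = v j.
Proof. by rewrite ffunE => /negPf ->. Qed.

Lemma upd_same n (i : 'I_n) (v : dcube n) : upd i (v i) v = v.
Proof. by apply/ffunP => j; rewrite ffunE; case: eqP => // ->. Qed.

Lemma upd_upd n (i : 'I_n) t t' v : upd i t (upd i t' v) = upd i t v.
Proof. by apply/ffunP => j; rewrite !ffunE; case: eqP. Qed.

Lemma updC n (i j : 'I_n) t t' v :
  i != j -> upd i t (upd j t' v) = upd j t' (upd i t v).
Proof.
move=> ij; apply/ffunP => l; rewrite !ffunE; case: eqP => // ->.
by rewrite (negPf ij).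
Qed.

Lemma upd_lift_face n (i : 'I_n.+1) (j : 'I_n) t t' v :
  upd (lift i j) t (face i t' v) = face i t' (upd j t v).
Proof.
apply/ffunP => l; rewrite !ffunE; case: (unliftP i l) => [l' ->|->].
  by rewrite (inj_eq lift_inj) ffunE.
by rewrite (negPf (neq_lift _ _)).
Qed.

Lemma sign_face n (i : 'I_n.+1) t (v : dcube n) :
  (-1) ^+ weight (face i t v) = (-1) ^+ t * (-1) ^+ weight v :> int.
Proof.
rewrite /weight (bigD1_ord i) //= face_id exprD; congr (_ * _ ^+ _).
by apply: eq_bigr => j _; rewrite face_lift.
Qed.

Lemma alt_face n (A : zmodType) (i : 'I_n.+1) (f : dcube n.+1 -> A) :
  alt f = alt (f \o face i false) - alt (f \o face i true).
Proof.
rewrite /alt (bigID (fun v : dcube n.+1 => v i)) /= addrC; congr (_ + _).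
  rewrite (reindex (face i false)); last first.
    exists (drop_coord i) => v; rewrite inE => vi; first exact: drop_face.
    by rewrite face_drop -(negPf vi) upd_same.
  apply: eq_big => v; first by rewrite face_id.
  by rewrite sign_face expr0 mul1r.
rewrite (reindex (face i true)); last first.
  exists (drop_coord i) => v; rewrite inE => vi; first exact: drop_face.
  by rewrite face_drop -vi upd_same.
rewrite (eq_bigl xpredT); last by move=> v; rewrite face_id.
by rewrite -sumrN; apply: eq_bigr => v _; rewrite sign_face expr1 mulN1r mulrNz.
Qed.

Lemma alt0dim (A : zmodType) (f : dcube 0 -> A) : alt f = f (cube0 0).
Proof.
rewrite /alt (big_pred1 (cube0 0)).
  by rewrite /weight big_ord0 expr0.
by move=> v; apply/esym/eqP/ffunP => -[].
Qed.

Lemma eq_alt n (A : zmodType) (f g : dcube n -> A) : f =1 g -> alt f = alt g.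
Proof. by move=> fg; apply: eq_bigr => v _; rewrite fg. Qed.

Lemma altD n (A : zmodType) (f g : dcube n -> A) :
  alt (fun v => f v + g v) = alt f + alt g.
Proof. by rewrite /alt -big_split /=; apply: eq_bigr => v _; rewrite mulrzDl. Qed.

Lemma altN n (A : zmodType) (f : dcube n -> A) : alt (fun v => - f v) = - alt f.
Proof. by rewrite /alt -sumrN; apply: eq_bigr => v _; rewrite mulNrz. Qed.

Lemma altB n (A : zmodType) (f g : dcube n -> A) :
  alt (fun v => f v - g v) = alt f - alt g.
Proof. by rewrite -altN -altD. Qed.

Lemma alt_sum n (A : zmodType) (I : Type) (s : seq I) (P : pred I)
    (F : I -> dcube n -> A) :
  alt (fun v => \sum_(i <- s | P i) F i v) = \sum_(i <- s | P i) alt (F i).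
Proof.
rewrite /alt exchange_big /=; apply: eq_bigr => v _.
by rewrite -mulrz_suml.
Qed.

Lemma altMn n (A : zmodType) (f : dcube n -> A) N :
  alt (fun v => f v *+ N) = alt f *+ N.
Proof. by rewrite /alt -sumrMnl; apply: eq_bigr => v _; rewrite !pmulrn -!mulrzA mulrC. Qed.

Lemma altMz n (A : zmodType) (f : dcube n -> A) (z : int) :
  alt (fun v => f v *~ z) = alt f *~ z.
Proof. by rewrite /alt mulrz_suml; apply: eq_bigr => v _; rewrite -!mulrzA mulrC. Qed.

Lemma exchange_alt n m (A : zmodType) (f : dcube n -> dcube m -> A) :
  alt (fun v => alt (f v)) = alt (fun u => alt (fun v => f v u)).
Proof.
rewrite [RHS]/alt; under [RHS]eq_bigr => u _ do rewrite -altMz.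
by rewrite -alt_sum.
Qed.

Lemma alt_indep n (A : zmodType) (i : 'I_n) (f : dcube n -> A) :
  (forall t v, f (upd i t v) = f v) -> alt f = 0.
Proof.
case: n i f => [[]//|n] i f fi.
rewrite (alt_face i) -altB /alt big1 // => v _ /=.
by rewrite -(fi true (face i false v)) upd_face subrr mul0rz.
Qed.

Lemma alt_delta n (A : zmodType) (w : dcube n) (a : A) :
  alt (fun v => if v == w then a else 0) = a *~ (-1) ^+ weight w.
Proof.
rewrite /alt (bigD1 w) //= eqxx big1 ?addr0 // => v /negPf ->.
by rewrite mul0rz.
Qed.

Lemma mulrz_sign_eq0 n (A : zmodType) (w : dcube n) (a : A) :
  (a *~ (-1) ^+ weight w == 0) = (a == 0).
Proof.
by rewrite -signr_odd; case: odd; rewrite ?expr0 // expr1 mulrN1z oppr_eq0.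
Qed.

Lemma alt_surj n (A : zmodType) (w : dcube n) (b : A) :
  exists a, alt (fun v => if v == w then a else 0) = b.
Proof.
exists (b *~ (-1) ^+ weight w); rewrite alt_delta -mulrzA -expr2 sqrr_sign.
by rewrite mulr1z.
Qed.

(** [o i] is the variable, if any, on which coordinate i depends, and [b i] says whether it is
    negated; b + (-1)^b v is the affine form of the exclusive or. *)
Lemma cube_morphismI m n (theta : dcube m -> dcube n)
    (o : 'I_n -> option 'I_m) (b : 'I_n -> bool) :
  (forall (v : dcube m) i, theta v i = (if o i is Some j then v j else false) (+) b i) ->
  cube_morphism theta.
Proof.
move=> th.
exists (\matrix_(i, j) (if o i == Some j then (-1) ^+ b i else 0)),
       (\col_i (b i)%:Z) => v.
apply/matrixP => i j; rewrite !mxE th.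
case oi: (o i) => [l|]; last first.
  by rewrite big1 ?add0r // => j' _; rewrite !mxE oi /= mul0r.
rewrite (bigD1 l) //= !mxE oi eqxx big1 ?addr0; last first.
  move=> j' /negPf jl; rewrite !mxE oi.
  by rewrite (inj_eq Some_inj) eq_sym jl mul0r.
by case: (v l); case: (b i).
Qed.

Lemma cube_morphism_comp l m n (t : dcube l -> dcube m) (u : dcube m -> dcube n) :
  cube_morphism t -> cube_morphism u -> cube_morphism (u \o t).
Proof.
move=> [A [a tE]] [B [b uE]]; exists (B *m A), (B *m a + b) => v.
by rewrite /= uE tE mulmxDr mulmxA addrA.
Qed.

Lemma cube_morphism_id n : cube_morphism (@id (dcube n)).
Proof.
by apply: (cube_morphismI (o := Some) (b := fun=> false)) => v i; rewrite addbF.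
Qed.

Lemma cube_morphism_upd n (i : 'I_n) t : cube_morphism (upd i t).
Proof.
apply: (cube_morphismI (o := fun j => if j == i then None else Some j)
  (b := fun j => (j == i) && t)) => v j.
by rewrite ffunE; case: eqP => //=; rewrite addbF.
Qed.

Lemma cube_morphism_flip n (i : 'I_n) : cube_morphism (flip i).
Proof.
apply: (cube_morphismI (o := Some) (b := fun j => j == i)) => v j.
by rewrite ffunE; case: eqP => [->|_]; rewrite ?addbT ?addbF.
Qed.

Lemma cube_morphism_cst m n (w : dcube n) :
  cube_morphism (fun _ : dcube m => w).
Proof.
by apply: (cube_morphismI (o := fun=> None) (b := w)) => v i.
Qed.

Lemma cube_morphism_face n (i : 'I_n.+1) t : cube_morphism (face i t).
Proof.
apply: (cube_morphismI (o := fun j => unlift i j)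
  (b := fun j => (unlift i j == None) && t)) => v j.
by rewrite ffunE; case: unlift => [l|] /=; rewrite ?addbF.
Qed.

Lemma cube_morphism_drop n (i : 'I_n.+1) : cube_morphism (drop_coord i).
Proof.
apply: (cube_morphismI (o := fun j => Some (lift i j)) (b := fun=> false)) => v j.
by rewrite ffunE addbF.
Qed.

Definition cubes_compose (T : Type) (C : cube_family T) := forall m n
  (theta : dcube m -> dcube n) c, cube_morphism theta -> C n c -> C m (c \o theta).

Section Dcubes.
Context (A : zmodType).
Implicit Types (l n : nat).

Lemma Dcubes_compose l : cubes_compose (Dcubes l A).
Proof.
by move=> m n theta c th Cc eta et; apply: (Cc (theta \o eta)); apply: cube_morphism_comp.
Qed.

Lemma DcubesD l n (c d : dcube n -> A) :
  Dcubes l A n c -> Dcubes l A n d -> Dcubes l A n (fun v => c v + d v).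
Proof.
by move=> cc dd t tt; have := altD (c \o t) (d \o t); rewrite [alt (c \o t)]cc // [alt (d \o t)]dd // addr0.
Qed.

Lemma DcubesN l n (c : dcube n -> A) :
  Dcubes l A n c -> Dcubes l A n (fun v => - c v).
Proof.
by move=> cc t tt; have := altN (c \o t); rewrite [alt (c \o t)]cc // oppr0.
Qed.

Lemma DcubesB l n (c d : dcube n -> A) :
  Dcubes l A n c -> Dcubes l A n d -> Dcubes l A n (fun v => c v - d v).
Proof. by move=> cc dd; apply: DcubesD => //; apply: DcubesN. Qed.

Lemma DcubesMn l n (c : dcube n -> A) N :
  Dcubes l A n c -> Dcubes l A n (fun v => c v *+ N).
Proof.
by move=> cc t tt; have := altMn (c \o t) N; rewrite [alt (c \o t)]cc // mul0rn.
Qed.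

Lemma Dcubes0 l n : Dcubes l A n (fun=> 0).
Proof. by move=> t tt; rewrite big1 // => v _; rewrite mul0rz. Qed.

Lemma Dcubes_cst l n (a : A) : Dcubes l A n (fun=> a).
Proof. by move=> t tt; apply: (@alt_indep _ _ ord0 (fun=> a)). Qed.

Lemma Dcubes_sum l n (I : Type) (s : seq I) (P : pred I) (F : I -> dcube n -> A) :
  (forall i, P i -> Dcubes l A n (F i)) ->
  Dcubes l A n (fun v => \sum_(i <- s | P i) F i v).
Proof.
move=> FD t tt; have := alt_sum s P (fun i => F i \o t); rewrite big1 //.
by move=> i Pi; apply: FD.
Qed.

(* A coordinate of a cube morphism depends on at most one variable: an integer
   affine function that depends on two variables takes at least three values. *)
Lemma cube_morphism_indep l n (S : {set 'I_n}) (theta : dcube l.+1 -> dcube n) :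
  cube_morphism theta -> (#|S| <= l)%N ->
  exists j, forall i, i \in S -> forall t v, theta (upd j t v) i = theta v i.
Proof.
move=> [B [b thE]] Sl.
have thi v i : (theta v i : nat)%:Z = \sum_j B i j * (v j : nat)%:Z + b i ord0.
  have := congr1 (fun M : 'cV[int]_n => M i ord0) (thE v); rewrite !mxE => ->.
  by congr (_ + _); apply: eq_bigr => j _; rewrite mxE.
have B1 i j j' : B i j != 0 -> B i j' != 0 -> j = j'.
  move=> Bj Bj'; apply/eqP; apply/negPn/negP => jj'.
  pose e (J : pred 'I_l.+1) : dcube l.+1 := [ffun x => J x].
  have S0 : \sum_x B i x * (e pred0 x : nat)%:Z = 0.
    by rewrite big1 // => x _; rewrite ffunE mulr0.
  have S1 y : \sum_x B i x * (e (pred1 y) x : nat)%:Z = B i y.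
    rewrite (bigD1 y) //= ffunE /= eqxx mulr1 big1 ?addr0 // => x /negPf xy.
    by rewrite ffunE /= xy mulr0.
  have S2 : \sum_x B i x * (e (pred2 j j') x : nat)%:Z = B i j + B i j'.
    rewrite (bigD1 j) //= ffunE /= eqxx mulr1 (bigD1 j') 1?eq_sym //=.
    rewrite ffunE /= eqxx orbT mulr1 big1 ?addr0 // => x /andP[/negPf xj /negPf xj'].
    by rewrite ffunE /= xj xj' mulr0.
  have := thi (e pred0) i; have := thi (e (pred1 j)) i.
  have := thi (e (pred1 j')) i; have := thi (e (pred2 j j')) i.
  rewrite S0 !S1 S2; move: Bj Bj'; generalize (B i j) (B i j') (b i ord0) => x y z.
  move=> /eqP x0 /eqP y0.
  by case: (theta _ i); case: (theta _ i); case: (theta _ i); case: (theta _ i) => /=; lia.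
case: (boolP [forall j, [exists i in S, B i j != 0]]) => [/forallP al|].
  have /all_sig [g gP] : forall j, {i | (i \in S) && (B i j != 0)}.
    by move=> j; apply/sigW; case/existsP: (al j) => i /andP[iS Bi]; exists i; rewrite iS.
  have : (#|'I_l.+1| <= #|S|)%N.
    have g_inj : injective g.
      move=> j j' gj; case/andP: (gP j) => _; rewrite gj => Bj.
      by case/andP: (gP j') => _ Bj'; apply: B1 Bj Bj'.
    rewrite -(fintype.card_image g_inj); apply: subset_leq_card.
    by apply/fintype.subsetP => _ /mapP[j _ ->]; case/andP: (gP j).
  by rewrite card_ord leqNgt ltnS Sl.
rewrite negb_forall => /existsP[j]; rewrite negb_exists => /forallP jP.
exists j => i iS t v.
have Bij : B i j = 0 by apply/eqP; have := jP i; rewrite iS negbK.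
have : (theta (upd j t v) i : nat)%:Z = (theta v i : nat)%:Z.
  rewrite !thi; congr (_ + _); apply: eq_bigr => x _; rewrite ffunE.
  by case: eqP => // ->; rewrite Bij !mul0r.
by case: (theta _ i); case: (theta v i).
Qed.

(** [theta] has l+1 variables and each coordinate in S uses at most one of them, so some variable is
    invisible to [c \o theta] and the signed terms cancel in pairs. *)
Lemma Dcubes_support l n (S : {set 'I_n}) (c : dcube n -> A) :
  (#|S| <= l)%N -> (forall v w : dcube n, (forall i, i \in S -> v i = w i) -> c v = c w) ->
  Dcubes l A n c.
Proof.
move=> Sl cS theta /cube_morphism_indep - /(_ S Sl) [j jP].
apply: (@alt_indep _ _ j (c \o theta)) => t v /=; apply: cS => i iS; exact: jP.
Qed.

Lemma Dcubes_le_dim l n (c : dcube n -> A) : (n <= l)%N -> Dcubes l A n c.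
Proof.
move=> nl; apply: (@Dcubes_support _ _ [set: 'I_n]%SET); first by rewrite cardsT card_ord.
by move=> v w vw; congr c; apply/ffunP => i; apply: vw; rewrite inE.
Qed.

Lemma DcubesS l n (c : dcube n -> A) : Dcubes l A n c -> Dcubes l.+1 A n c.
Proof.
move=> cc t tt; change (alt (c \o t) = 0); rewrite (alt_face ord0).
rewrite [X in X - _](_ : _ = 0) ?[X in _ - X](_ : _ = 0) ?subr0 //.
  exact: cc (cube_morphism_comp (cube_morphism_face _ _) tt).
exact: cc (cube_morphism_comp (cube_morphism_face _ _) tt).
Qed.

Lemma Dcubes_monotone l l' n (c : dcube n -> A) :
  (l <= l')%N -> Dcubes l A n c -> Dcubes l' A n c.
Proof.
move=> /subnK <-; elim: (l' - l)%N => [//|j IH] cc; rewrite addSn.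
exact/DcubesS/IH.
Qed.

(** [eta] adds to [theta] one variable that controls coordinate s alone; summing over that variable
    first produces the difference, up to sign. *)
Lemma Dcubes_derive l n (s : 'I_n) (c : dcube n -> A) :
  Dcubes l.+1 A n c ->
  Dcubes l A n (fun v => c (upd s true v) - c (upd s false v)).
Proof.
move=> cc theta [B [b thE]].
pose eta (v : dcube l.+2) : dcube n := upd s (v ord0) (theta (drop_coord ord0 v)).
have et : cube_morphism eta.
  exists (\matrix_(i, j) if i == s then (j == ord0)%:Z else
            (if unlift ord0 j is Some j' then B i j' else 0)),
         (\col_i if i == s then 0 else b i ord0) => v.
  apply/matrixP => i z; rewrite !mxE ffunE.
  case: (altP (i =P s)) => [is_|is_].
    rewrite (bigD1 ord0) //= !mxE is_ eqxx mul1r big1 ?addr0 // => j /negPf j0.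
    by rewrite !mxE eqxx j0 mul0r.
  have := congr1 (fun M : 'cV[int]_n => M i ord0) (thE (drop_coord ord0 v)); rewrite !mxE => ->.
  congr (_ + _); rewrite [RHS](bigD1_ord ord0) //= !mxE (negPf is_) unlift_none mul0r add0r.
  by apply: eq_bigr => j _; rewrite !mxE (negPf is_) liftK ffunE.
have := cc eta et; rewrite -/(alt (c \o eta)) (alt_face ord0) -altB => E.
apply/eqP; rewrite -oppr_eq0 -/(alt _) -altN -[X in _ == X]E; apply/eqP.
by apply: eq_alt => v /=; rewrite opprB /eta !face_id !drop_face.
Qed.

(* With p_i the projection setting coordinate i to 0, the completion of c is
   c - \prod_i (1 - p_i) c, whose second term vanishes off the vertex 1. *)
Lemma Dcubes_completion l n (c : dcube n -> A) :
  (forall i, Dcubes l A n (c \o upd i false)) ->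
  exists2 c', Dcubes l A n c' & forall v, v != cube1 n -> c' v = c v.
Proof.
move=> cc.
suff /(_ (enum 'I_n)) [F [FD F0]] : forall s : seq 'I_n, exists F : dcube n -> A,
    Dcubes l A n (fun v => c v - F v) /\ (forall i, i \in s -> forall v : dcube n, v i = false -> F v = 0).
  exists (fun v => c v - F v) => // v vn; have [i vi] : exists i, v i = false.
    suff /existsP[i /negPf vi] : [exists i, ~~ v i] by exists i.
    apply: contraNT vn; rewrite negb_exists => /forallP vt.
    by apply/eqP/ffunP => i; rewrite ffunE; apply/negPn/vt.
  by rewrite (F0 i) ?subr0 // mem_enum.
elim=> [|i s [F [FD F0]]].
  exists c; split=> //; rewrite (_ : (fun v => _) = fun=> 0); first exact: Dcubes0.
  by apply/funext => v; rewrite subrr.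
(* This is (1 - p_i) F, and c - (1 - p_i) F = (c - F) + p_i c - p_i (c - F). *)
exists (fun v => F v - F (upd i false v)); split.
  rewrite (_ : (fun v => _) = fun v => (c v - F v) + (c (upd i false v) - (c (upd i false v) - F (upd i false v)))).
    apply: DcubesD => //; apply: DcubesB; first exact: cc.
    exact: Dcubes_compose (cube_morphism_upd i false) FD.
  by apply/funext => v; rewrite subKr opprB -addrA [- F v + _]addrC.
move=> j; rewrite inE => /orP[/eqP-> v vi|js v vj] /=.
  have -> : upd i false v = v by rewrite -[in LHS]vi upd_same.
  by rewrite subrr.
rewrite (F0 j) // (F0 j) ?subr0 //.
by rewrite ffunE; case: eqP.
Qed.

(** In dimension n+1 the identity is the only test that matters: the lower faces of c have a
    completion c', which differs from c at most at the vertex 1, and there the difference is, up to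
    sign, the alternating sum of c. *)
Lemma Dcubes_alt n (c : dcube n.+1 -> A) : Dcubes n A n.+1 c <-> alt c = 0.
Proof.
split=> [cc|c0]; first exact: (cc id (@cube_morphism_id _)).
have [|c' c'D cc'] := @Dcubes_completion n _ c.
  move=> i; apply: (@Dcubes_support _ _ (~: [set i])%SET).
    by rewrite cardsC1 card_ord.
  move=> v w vw /=; congr c; apply/ffunP => j; rewrite !ffunE.
  by case: eqP => // /eqP ji; apply: vw; rewrite !inE.
have : alt (fun v => if v == cube1 n.+1 then c (cube1 n.+1) - c' (cube1 n.+1) else 0) = 0.
  transitivity (alt c - alt c').
    rewrite -altB; apply: eq_alt => v; case: eqP => [->//|/eqP vn].
    by rewrite cc' // subrr.
  by rewrite c0 [alt c'](c'D id (@cube_morphism_id _)) subr0.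
rewrite alt_delta => /eqP; rewrite mulrz_sign_eq0 subr_eq0 => /eqP c1.
suff -> : c = c' by [].
by apply/funext => v; have [->//|vn] := eqVneq v (cube1 n.+1); rewrite cc'.
Qed.

End Dcubes.

(** * Gluing in nilspaces *)

Lemma eq_cube (T : Type) (C : cube_family T) n (c c' : dcube n -> T) :
  C n c -> c =1 c' -> C n c'.
Proof. by move=> cc /funext <-. Qed.

Section NilspaceGluing.
Context (T : Type) (C : cube_family T) (nC : is_nilspace C).
Arguments C : clear implicits.

Let comp : cubes_compose C.
Proof. by move=> m n t c tt; apply: nilspace_composition. Qed.

Lemma cst_cube n (x : T) : C n (fun=> x).
Proof.
have C0 : C 0%N (fun=> x) by rewrite nilspace_ergodic0.
exact: comp (cube_morphism_cst (n := 0) n (cube0 0)) C0.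
Qed.

Lemma lower_cube n (i : 'I_n.+1) (Q : dcube n.+1 -> T) :
  C n.+1 (Q \o upd i false) <-> C n (Q \o face i false).
Proof.
split=> CQ.
  have := comp (cube_morphism_face i false) CQ.
  by move/eq_cube; apply=> v /=; rewrite upd_face.
have := comp (cube_morphism_drop i) CQ.
by move/eq_cube; apply=> v /=; rewrite face_drop.
Qed.

(* If i is not in S, completing Q on the face v_i = 0, of smaller dimension,
   enlarges S by i; the process stops at a corner. *)
Lemma partial_completion n (Q : dcube n.+1 -> T) (S : {set 'I_n.+1}) :
  S != finset.set0 -> (forall i, i \in S -> C n.+1 (Q \o upd i false)) ->
  exists2 Q', C n.+1 Q' &
    forall i, i \in S -> forall v, Q' (upd i false v) = Q (upd i false v).
Proof.
elim: n Q S => [|n IHn] Q S.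
  case/finset.set0Pn => i iS CQ; have [Q' [CQ' Q'Q]] : exists c, completes C Q c.
    apply: nilspace_completion => // j; rewrite lower_faceE -lower_cube; apply: CQ.
    by rewrite (ord1 j) -(ord1 i).
  exists Q' => // j _ v; apply: Q'Q; apply/eqP => /ffunP/(_ j).
  by rewrite upd_id ffunE.
have [m] := ubnP #|~: S|%SET; elim: m Q S => // m IHm Q S Sm S0 CQ.
have [Sfull|] := eqVneq S finset.setT.
  have [Q' [CQ' Q'Q]] : exists c, completes C Q c.
    by apply: nilspace_completion => // j; rewrite lower_faceE -lower_cube; apply: CQ; rewrite Sfull inE.
  exists Q' => // j _ v; apply: Q'Q; apply/eqP => /ffunP/(_ j).
  by rewrite upd_id ffunE.
rewrite -finset.subTset => /subsetPn [i _ iS].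
have /finset.set0Pn[i0 i0S] := S0.
have liftS l : l \in S -> exists2 j, l = lift i j & j \in [set j | lift i j \in S]%SET.
  move=> lS; case: (unliftP i l) => [j lj|li]; last by rewrite -li lS in iS.
  by exists j; rewrite // inE -lj.
have [j0 i0j0 j0S] := liftS _ i0S.
have [||f' Cf' f'Q] := IHn (Q \o face i false) [set j | lift i j \in S]%SET.
- by apply/finset.set0Pn; exists j0.
- move=> j; rewrite inE => /CQ => CQj.
  have := comp (cube_morphism_face i false) CQj.
  by move/eq_cube; apply=> v /=; rewrite upd_lift_face.
pose Q2 (v : dcube n.+2) := if v i then Q v else f' (drop_coord i v).
have Q2S l : l \in S -> forall v, Q2 (upd l false v) = Q (upd l false v).
  move=> lS v; rewrite /Q2; case: ifPn => // vi.
  have [j lj jS] := liftS _ lS; rewrite lj.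
  have vE : v = face i false (drop_coord i v).
    rewrite face_drop; move: vi; rewrite lj upd_neq ?neq_lift // => /negPf vi.
    by rewrite -[RHS]/(upd i false v) -[in RHS]vi upd_same.
  by rewrite {}vE upd_lift_face drop_face f'Q.
have [|||Q' CQ' Q'Q] := IHm Q2 (i |: S)%SET.
- rewrite -ltnS; apply: leq_trans Sm; rewrite ltnS; apply: proper_card.
  rewrite finset.setCU; apply/properP; split; first exact: finset.subsetIr.
  by exists i; rewrite !inE ?eqxx.
- by apply/finset.set0Pn; exists i; rewrite !inE eqxx.
- move=> l; rewrite !inE => /orP[/eqP->|lS].
    rewrite lower_cube (_ : _ \o _ = f') //; apply/funext => v.
    by rewrite /Q2 /= face_id drop_face.
  rewrite (_ : Q2 \o _ = Q \o upd l false); first exact: CQ.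
  by apply/funext => v; rewrite /= Q2S.
by exists Q' => // l lS v; rewrite Q'Q ?Q2S // !inE lS orbT.
Qed.

(** Concatenation along a common lower face. [Q] puts c on the face v_0 = 0 of the (n+1)-cube and c'
    on the face where the copy of coordinate s is 0; [kappa] runs along the antidiagonal of these
    two coordinates and so joins the two upper faces. *)
Lemma glue_lower n (s : 'I_n) (c c' : dcube n -> T) : C n c -> C n c' ->
  (forall v, c (upd s false v) = c' (upd s false v)) ->
  C n (fun v => if v s then c' v else c (upd s true v)).
Proof.
move=> Cc Cc' cc'.
pose Q (v : dcube n.+1) := if v ord0 && ~~ v (lift ord0 s)
  then c' (upd s true (drop_coord ord0 v)) else c (drop_coord ord0 v).
have Q0 v : Q (upd ord0 false v) = c (drop_coord ord0 v).
  rewrite /Q upd_id /=; congr c; apply/ffunP => j; rewrite !ffunE.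
  by rewrite eq_sym (negPf (neq_lift _ _)).
have Qs v : Q (upd (lift ord0 s) false v) = c' (upd s (v ord0) (drop_coord ord0 v)).
  rewrite /Q upd_id andbT upd_neq ?neq_lift //.
  have -> : drop_coord ord0 (upd (lift ord0 s) false v) = upd s false (drop_coord ord0 v).
    by apply/ffunP => j; rewrite !ffunE (inj_eq lift_inj).
  by case: ifPn => v0; rewrite ?upd_upd // cc'.
have [||Q' CQ' Q'Q] := @partial_completion n Q [set ord0; lift ord0 s]%SET.
- by apply/finset.set0Pn; exists ord0; rewrite !inE eqxx.
- move=> i; rewrite !inE => /orP[] /eqP->.
    rewrite (_ : _ \o _ = c \o drop_coord ord0); last exact/funext.
    exact: comp (cube_morphism_drop _) Cc.
  rewrite (_ : _ \o _ = c' \o (fun v : dcube n.+1 => upd s (v ord0) (drop_coord ord0 v))); last exact/funext.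
  apply: comp Cc'; apply: (cube_morphismI
    (o := fun j => if j == s then Some ord0 else Some (lift ord0 j)) (b := fun=> false)) => v j.
  by rewrite addbF !ffunE; case: eqP.
pose kappa (v : dcube n) := face ord0 (v s) (flip s v).
have kk : cube_morphism kappa.
  apply: (cube_morphismI (o := fun j => if unlift ord0 j is Some j' then Some j' else Some s)
    (b := fun j => unlift ord0 j == Some s)) => v j.
  rewrite ffunE; case: unlift => [j'|]; last by rewrite addbF.
  by rewrite ffunE (inj_eq Some_inj); case: eqP => [->|_]; rewrite ?addbT ?addbF.
have := comp kk CQ'; move/eq_cube; apply=> v /=.
case vs: (v s).
  have kE : kappa v = upd (lift ord0 s) false (kappa v).
    apply/ffunP => j; rewrite [RHS]ffunE; case: eqP => // ->.
    by rewrite /kappa face_lift /flip upd_id vs.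
  rewrite kE Q'Q ?inE ?eqxx ?orbT // Qs /kappa drop_face face_id vs.
  by rewrite /flip upd_upd -vs upd_same.
have kE : kappa v = upd ord0 false (kappa v) by rewrite /kappa vs upd_face.
by rewrite kE Q'Q ?inE ?eqxx // Q0 /kappa drop_face /flip vs.
Qed.

Lemma glue_upper n (s : 'I_n) (c c' : dcube n -> T) : C n c -> C n c' ->
  (forall v, c (upd s true v) = c' (upd s true v)) ->
  C n (fun v => if v s then c' (upd s false v) else c v).
Proof.
move=> Cc Cc' cc'; have fl := cube_morphism_flip s.
have E t v : flip s (upd s t v) = upd s (~~ t) v by rewrite /flip upd_id upd_upd.
have := glue_lower (s := s) (comp fl Cc) (comp fl Cc').
move=> /= H; have {}H := H (fun v => etrans (congr1 c (E false v))
  (etrans (cc' v) (esym (congr1 c' (E false v))))).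
move: H => /eq_cube; apply=> v /=; rewrite E /flip.
by case vs: (v s) => //=; rewrite -[in LHS]vs upd_same.
Qed.

Definition neg n (v : dcube n) : dcube n := [ffun i => ~~ v i].

Lemma negK n : involutive (@neg n).
Proof. by move=> v; apply/ffunP => i; rewrite !ffunE negbK. Qed.

Lemma neg0 n : neg (cube0 n) = cube1 n.
Proof. by apply/ffunP => i; rewrite !ffunE. Qed.

Lemma cube_morphism_neg n : cube_morphism (@neg n).
Proof.
by apply: (cube_morphismI (o := Some) (b := fun=> true)) => v i; rewrite ffunE addbT.
Qed.

Definition spike n (x y : T) (v : dcube n) : T := if v == cube1 n then y else x.

(* Gluing the two cubes that witness x ~_i y along the coordinates one after the
   other; a is constant in the coordinates of J and P is the only vertex at which
   a and b differ. *)
Lemma spike_cube i x y : sim C i x y -> C i.+1 (spike x y).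
Proof.
case=> c [c' [Cc Cc' cx c'y cc']].
suff /(_ (enum 'I_i.+1) (enum_uniq _)) [a [b [Ca Cb abP aP [bP a0 aJ]]]] : forall J : seq 'I_i.+1, uniq J ->
  exists a b : dcube i.+1 -> T, let P : dcube i.+1 := [ffun j => j \in J] in
    [/\ C i.+1 a, C i.+1 b, forall v, v != P -> a v = b v, a P = x &
     [/\ b P = y, a (cube0 _) = x & forall j, j \in J -> forall t v, a (upd j t v) = a v]].
  have P1 : [ffun j => j \in enum 'I_i.+1] = cube1 i.+1 :> dcube _.
    by apply/ffunP => j; rewrite !ffunE mem_enum.
  have aE v : a v = x.
    rewrite -a0; suff /(_ (enum 'I_i.+1)) E : forall s : seq 'I_i.+1, a v = a [ffun j => if j \in s then false else v j].
      by rewrite E; congr a; apply/ffunP => j; rewrite !ffunE mem_enum.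
    elim=> [|j s ->]; first by congr a; apply/ffunP => j; rewrite ffunE.
    rewrite -(aJ j _ false) ?mem_enum //; congr a; apply/ffunP => l; rewrite !ffunE inE.
    by case: eqP.
  rewrite P1 in abP bP.
  rewrite (_ : spike x y = b) //; apply/funext => v; rewrite /spike.
  by case: eqVneq => [->|v1] //; rewrite -abP.
elim=> [_|s J IHJ /= /andP[sJ uJ]].
  have P0 : [ffun j => j \in [::]] = cube0 i.+1 :> dcube _ by apply/ffunP => j; rewrite !ffunE.
  by exists c, c'; rewrite /= P0; split.
have [a [b /= [Ca Cb abP aP [bP a0 aJ]]]] := IHJ uJ.
set P := [ffun j => j \in J] in abP aP bP.
have Ps : upd s false [ffun j => j \in s :: J] = P.
  by apply/ffunP => j; rewrite !ffunE inE; case: eqP => // ->; rewrite (negPf sJ).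
exists (a \o upd s false), (fun v : dcube i.+1 => if v s then b (upd s false v) else a v); split.
- exact: comp (cube_morphism_upd _ _) Ca.
- apply: glue_upper => // v; apply: abP; apply/eqP => /ffunP/(_ s).
  by rewrite upd_id ffunE (negPf sJ).
- move=> v vP /=; case vs: (v s); last by rewrite -[in LHS]vs upd_same.
  apply: abP; apply: contra vP => /eqP/ffunP vP; apply/eqP/ffunP => j.
  have := vP j; rewrite !ffunE inE; case: eqP => // -> _; exact: vs.
- by rewrite /= Ps.
split.
- by rewrite ffunE inE eqxx /= Ps.
- by rewrite /=; have -> : upd s false (cube0 i.+1) = cube0 i.+1
    by apply/ffunP => j; rewrite !ffunE; case: eqP.
move=> j; rewrite inE => /orP[/eqP->|jJ] t v /=; first by rewrite upd_upd.
have [->|js] := eqVneq j s; first by rewrite upd_upd.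
by rewrite updC 1?eq_sym // aJ.
Qed.

Lemma sim_refl i x : sim C i x x.
Proof. by exists (fun=> x), (fun=> x); split=> //; apply: cst_cube. Qed.

Lemma sim_sym i x y : sim C i x y -> sim C i y x.
Proof. by case=> c [c' [? ? ? ? cc']]; exists c', c; split=> // v v0; rewrite cc'. Qed.

(** The witnesses of the two relations need not share their common part; replaced by spikes over y,
    they do. *)
Lemma sim_trans i x y z : sim C i x y -> sim C i y z -> sim C i x z.
Proof.
move=> /sim_sym/spike_cube yx /spike_cube yz.
exists (spike y x \o @neg _), (spike y z \o @neg _); split.
- exact: comp (@cube_morphism_neg _) yx.
- exact: comp (@cube_morphism_neg _) yz.
- by rewrite /spike /= neg0 eqxx.
- by rewrite /spike /= neg0 eqxx.
move=> v v0; rewrite /spike /= -neg0 (can_eq (@negK _)) (negPf v0) //.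
Qed.

Lemma sim_pred i x y : sim C i.+1 x y -> sim C i x y.
Proof.
case=> c [c' [Cc Cc' cx c'y cc']].
have f0 : face ord0 false (cube0 i.+1) = cube0 i.+2.
  by apply/ffunP => j; rewrite !ffunE; case: unlift => // l; rewrite ffunE.
exists (c \o face ord0 false), (c' \o face ord0 false); split.
- exact: comp (cube_morphism_face _ _) Cc.
- exact: comp (cube_morphism_face _ _) Cc'.
- by rewrite /= f0.
- by rewrite /= f0.
move=> v v0; apply: cc'; apply: contra v0 => /eqP E.
by rewrite -(drop_face ord0 false v) E; apply/eqP/ffunP => j; rewrite !ffunE.
Qed.

Lemma simP i x y : sim C i x = sim C i y <-> sim C i x y.
Proof.
split=> [->|xy]; first exact: sim_refl.
apply/seteqP; split=> z; first exact: sim_trans (sim_sym xy).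
exact: sim_trans xy.
Qed.

Lemma factor_piP i x y : factor_pi C i x = factor_pi C i y <-> sim C i x y.
Proof.
rewrite -simP; split=> [/(congr1 (@proj1_sig _ _))//|E].
exact/eq_exist.
Qed.

Lemma factor_proj_pi i x : factor_proj (factor_pi C i.+1 x) = factor_pi C i x.
Proof.
rewrite /factor_proj; apply/factor_piP/sim_pred/factor_piP.
exact: factor_reprK.
Qed.

End NilspaceGluing.

(** * Extensions and structure groups *)

(* The defining property of the projection X_l -> X_(l-1) and of the structure
   group Z_l(X), for an arbitrary map pi in place of the quotient by ~_(l-1). *)
Record is_ext (l : nat) (A : zmodType) (E Y : Type) (C : cube_family E)
    (D : cube_family Y) (pi : E -> Y) (act : A -> E -> E) : Prop := IsExt {
  ext_compose : cubes_compose C;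
  ext_act0 : forall x, act 0 x = x;
  ext_actD : forall a b x, act (a + b) x = act a (act b x);
  ext_proj : forall a x, pi (act a x) = pi x;
  ext_trans : forall x y, pi x = pi y -> exists a, act a x = y;
  ext_free : forall a x, act a x = x -> a = 0;
  ext_surj : forall y, exists x, pi x = y;
  ext_cube : forall n c, C n c -> D n (pi \o c);
  ext_lift : forall n d, D n d -> exists2 c, C n c & forall v, pi (c v) = d v;
  ext_act : forall n c (f : dcube n -> A), C n c ->
    (C n (fun v => act (f v) (c v)) <-> Dcubes l A n f) }.

Section Ext.
Context (l : nat) (A : zmodType) (E Y : Type) (C : cube_family E)
    (D : cube_family Y) (pi : E -> Y) (act : A -> E -> E).
Arguments C : clear implicits.
Arguments D : clear implicits.
Hypothesis extE : is_ext l C D pi act.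

Lemma ext_inj a b x : act a x = act b x -> a = b.
Proof.
move=> ab; apply/eqP; rewrite -subr_eq0; apply/eqP; apply: (ext_free extE (x := act b x)).
by rewrite -(ext_actD extE) subrK.
Qed.

Lemma ext_diff (I : Type) (c c' : I -> E) : (forall v, pi (c v) = pi (c' v)) ->
  exists f, forall v, c' v = act (f v) (c v).
Proof.
move=> cc'; have {}cc' v : exists a, act a (c v) = c' v by apply: ext_trans extE _ _ _.
exists (fun v => projT1 (cid (cc' v))) => v.
by case: cid.
Qed.

(** In dimension at most l every A-valued function is a cube of D_l(A), so all lifts of a cube of Y
    are cubes. *)
Lemma ext_small n (c : dcube n -> E) : (n <= l)%N -> D n (pi \o c) -> C n c.
Proof.
move=> nl Dc; have [q Cq qc] := ext_lift extE Dc.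
have [f fE] := ext_diff qc.
rewrite (_ : c = fun v => act (f v) (q v)); last exact/funext.
by apply/(ext_act extE _ Cq)/Dcubes_le_dim.
Qed.

(** A corner is completed first in Y; its difference from a lift of that completion is a corner in
    D_l(A). The condition 0 < l gives ergodicity in dimension 1. *)
Lemma ext_nilspace : (0 < l)%N -> is_nilspace D -> is_nilspace C.
Proof.
move=> l0 nD; split.
- by have [y _] := nilspace_nonempty nD; have [x _] := ext_surj extE y; exists x.
- exact: ext_compose extE.
- by apply/seteqP; split=> // c _; apply: ext_small => //; rewrite nilspace_ergodic0.
- by apply/seteqP; split=> // c _; apply: ext_small => //; rewrite nilspace_ergodic1.
move=> n c' cor.
have [q [Dq qc]] : exists q, completes D (pi \o c') q.
  by apply: nilspace_completion => // i; apply: (ext_cube extE) (cor i).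
have [e Ce eq_] := ext_lift extE Dq.
have [f fE] : exists f, forall v, v != cube1 n.+1 -> c' v = act (f v) (e v).
  (* The corner has no meaningful value at the vertex 1, so e is compared with itself there. *)
  have [v|f fE] := @ext_diff _ e (fun v => if v == cube1 n.+1 then e v else c' v).
    by case: eqVneq => // v1; rewrite eq_ qc.
  by exists f => v v1; rewrite -fE (negPf v1).
have [|g Dg gf] := @Dcubes_completion A l n.+1 f.
  move=> i; apply/(ext_act extE _ (ext_compose extE (cube_morphism_upd i false) Ce)) => /=.
  have := ext_compose extE (cube_morphism_drop i) (cor i).
  move/eq_cube; apply=> v; rewrite /= lower_faceE face_drop fE //.
  by apply/eqP => /ffunP/(_ i); rewrite upd_id ffunE.
exists (fun v => act (g v) (e v)); split; first by apply/(ext_act extE).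
by move=> v v1; rewrite gf // fE.
Qed.

End Ext.

(** * Uniqueness of completions and towers of extensions *)

Definition completion_unique (T : Type) (k : nat) (C : cube_family T) : Prop :=
  forall c c' : dcube k.+1 -> T, C k.+1 c -> C k.+1 c' ->
  (forall v, v != cube1 k.+1 -> c v = c' v) -> c = c'.

Lemma completion_uniqueS (T : Type) (k : nat) (C : cube_family T) :
  cubes_compose C -> completion_unique k C -> completion_unique k.+1 C.
Proof.
move=> comp un c c' Cc Cc' cc'; apply/funext => v.
have [->|/cc'//] := eqVneq v (cube1 k.+2).
have f1 : face ord0 true (cube1 k.+1) = cube1 k.+2.
  by apply/ffunP => j; rewrite !ffunE; case: unlift => // l; rewrite ffunE.
have F := cube_morphism_face (@ord0 k.+1) true.
have E : c \o face ord0 true = c' \o face ord0 true.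
  apply: un; [exact: comp _ _ _ _ F Cc|exact: comp _ _ _ _ F Cc'|].
  move=> w w1; apply: cc'; apply: contra w1 => /eqP E.
  by rewrite -(drop_face ord0 true w) E; apply/eqP/ffunP => j; rewrite !ffunE.
by have := congr1 (fun f => f (cube1 k.+1)) E; rewrite /= f1.
Qed.

Lemma completion_unique_step (T : Type) (k : nat) (C : cube_family T) :
  completion_unique k C -> step k C.
Proof.
move=> un c' c1 c2 _ [C1 cc1] [C2 cc2]; apply: un => // v v1.
by rewrite cc1 // cc2.
Qed.

(** The spaces below the top are arbitrary quotients rather than the factors by ~_i, so that a tower
    can be rebuilt after its extensions have been exchanged. *)
Inductive tower (P : zmodType -> Prop) :
    nat -> forall T : choiceType, cube_family T -> Prop :=
| Tower0 (T : choiceType) (C : cube_family T) :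
    [set: T] !=set0 -> (forall x y : T, x = y) -> (forall n c, C n c) -> tower P 0 C
| TowerS (k : nat) (E Y : choiceType) (C : cube_family E) (D : cube_family Y)
    (A : zmodType) (pi : E -> Y) (act : A -> E -> E) :
    tower P k D -> P A -> is_ext k.+1 C D pi act -> tower P k.+1 C.

Lemma tower_nilspace P k (T : choiceType) (C : cube_family T) :
  tower P k C -> is_nilspace C.
Proof.
elim=> {k T C} [T C T0 Teq Cfull|k E Y C D A pi act _ nD _ eE]; last exact: ext_nilspace eE _ nD.
split=> //.
- by apply/seteqP; split=> // c _; apply: Cfull.
- by apply/seteqP; split=> // c _; apply: Cfull.
by move=> n c' _; exists c'; split.
Qed.

(** Two completions have the same projection by induction, so their difference is a cube of
    D_(k+1)(A) supported at the vertex 1; its value there is, up to sign, its alternating sum, which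
    is 0. *)
Lemma tower_unique P k (T : choiceType) (C : cube_family T) :
  tower P k C -> completion_unique k C.
Proof.
elim=> {k T C} [T C T0 Teq Cfull|k E Y C D A pi act tD un _ eE].
  by move=> c c' _ _ _; apply/funext.
have nD := tower_nilspace tD.
move=> c c' Cc Cc' cc'.
have unS := completion_uniqueS (@nilspace_composition _ _ nD) un.
have pcc' : pi \o c = pi \o c'.
  by apply: unS; [exact: ext_cube eE _ _ Cc|exact: ext_cube eE _ _ Cc'|move=> v v1; rewrite /= cc'].
have [f fE] := ext_diff eE (c := c) (c' := c') (fun v => congr1 (fun g => g v) pcc').
have f0 v : v != cube1 k.+2 -> f v = 0.
  by move=> v1; apply: (ext_free eE (x := c v)); rewrite -fE cc'.
have : Dcubes k.+1 A k.+2 f.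
  by apply/(ext_act eE _ Cc); move: Cc' => /eq_cube; apply.
move/Dcubes_alt; rewrite (_ : alt f = f (cube1 _) *~ (-1) ^+ weight (cube1 k.+2)).
  move/eqP; rewrite mulrz_sign_eq0 => /eqP f1; apply/funext => v.
  rewrite fE; have [->|/f0->] := eqVneq v (cube1 k.+2); by rewrite ?f1 (ext_act0 eE).
by rewrite -alt_delta; apply: eq_alt => v; case: eqVneq => [->//|/f0].
Qed.

(* A composition of extensions of degree greater than i, so that the target is
   X_i when it is an i-step nilspace. *)
Inductive above (i : nat) : forall (E Y : Type), cube_family E ->
    cube_family Y -> (E -> Y) -> Prop :=
| above_id E (C : cube_family E) : above i C C id
| above_step l (A : zmodType) (E Y W : Type) (C : cube_family E)
    (D : cube_family Y) (F : cube_family W) pi (act : A -> E -> E) pr :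
    (i < l)%N -> is_ext l C D pi act -> above i D F pr -> above i C F (pr \o pi).

Lemma above_ext i (E Y W : Type) (C : cube_family E) (D : cube_family Y)
    (F : cube_family W) pr (A : zmodType) pi (act : A -> Y -> Y) :
  above i.+1 C D pr -> is_ext i.+1 D F pi act -> above i C F (pi \o pr).
Proof.
move=> ab; elim: ab W F pi act => {E Y C D pr} [E C|l B E Y W0 C D F0 pi0 act0 pr il e0 _ IH] W F pi act e.
  by apply: (above_step _ e (above_id _ F)).
exact: (above_step (ltnW il) e0 (IH _ _ _ _ e)).
Qed.

Lemma above_cube i (E Y : Type) (C : cube_family E) (D : cube_family Y) pr :
  above i C D pr -> morphism C D pr.
Proof.
elim=> {E Y C D pr} [E C n c //|l B E Y W C D F pi act pr il e _ IH n c Cc].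
exact: IH (ext_cube e Cc).
Qed.

Lemma above_lift i (E Y : Type) (C : cube_family E) (D : cube_family Y) pr :
  above i C D pr -> forall n d, D n d -> exists2 c, C n c & forall v, pr (c v) = d v.
Proof.
elim=> {E Y C D pr} [E C n d Cd|l B E Y W C D F pi act pr il e _ IH n d Dd].
  by exists d.
have [c Dc cd] := IH _ _ Dd; have [c' Cc' cc'] := ext_lift e Dc.
by exists c' => // v; rewrite /= cc' cd.
Qed.

Lemma above_surj i (E Y : Type) (C : cube_family E) (D : cube_family Y) pr :
  above i C D pr -> forall y, exists x, pr x = y.
Proof.
elim=> {E Y C D pr} [E C y|l B E Y W C D F pi act pr il e _ IH y]; first by exists y.
by have [z <-] := IH y; have [x <-] := ext_surj e z; exists x.
Qed.

(** A witness of ~_i has dimension i+1 <= l, and in such dimensions the value at a vertex can be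
    moved freely within its fibre. *)
Lemma above_sim i (E Y : Type) (C : cube_family E) (D : cube_family Y) pr :
  is_nilspace D -> above i C D pr ->
  is_nilspace C /\ forall x y, pr x = pr y -> sim C i x y.
Proof.
move=> nD ab; elim: ab nD => {E Y C D pr} [E C|l B E Y W C D F pi act pr il e _ IH] nC.
  by split=> // x y ->; apply: sim_refl.
have [nD sD] := IH nC; have nE := ext_nilspace e (leq_ltn_trans (leq0n i) il) nD.
split=> // x y /sD [q [q' [Dq Dq' qx q'y qq']]].
have [c Cc cq] := ext_lift e Dq.
pose c1 v := if v == cube0 i.+1 then x else c v.
pose c2 v := if v == cube0 i.+1 then y else c v.
exists c1, c2; split.
- apply: (ext_small e) => //; move: Dq => /eq_cube; apply=> v.
  by rewrite /= /c1; case: eqP => // ->.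
- apply: (ext_small e) => //; move: Dq' => /eq_cube; apply=> v.
  by rewrite /= /c2; case: eqVneq => [->//|v0]; rewrite cq qq'.
- by rewrite /c1 eqxx.
- by rewrite /c2 eqxx.
by move=> v /negPf v0; rewrite /c1 /c2 v0.
Qed.

Lemma above_simP i (E Y : Type) (C : cube_family E) (D : cube_family Y) pr :
  is_nilspace D -> completion_unique i D -> above i C D pr ->
  forall x y, sim C i x y <-> pr x = pr y.
Proof.
move=> nD un ab x y; split; last exact: (above_sim nD ab).2.
case=> c [c' [Cc Cc' cx c'y cc']].
have M := cube_morphism_comp (@cube_morphism_neg _).
have N q : C i.+1 q -> D i.+1 (pr \o q \o @neg _).
  by move=> Cq; apply: nilspace_composition nD _ _ _ _ _ _; [exact: cube_morphism_neg|exact: above_cube ab _ _ Cq].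
have E0 : pr \o c \o @neg _ = pr \o c' \o @neg _.
  apply: un; [exact: N|exact: N|move=> v v1 /=].
  rewrite cc' //; apply: contra v1 => /eqP E0.
  by rewrite -(negK v) E0 neg0.
by have := congr1 (fun f => f (cube1 _)) E0; rewrite /= -neg0 negK cx c'y.
Qed.

Lemma tower_level P k (T : choiceType) (C : cube_family T) : tower P k C ->
  forall i, (i < k)%N -> exists (Y W : choiceType) (D : cube_family Y)
    (F : cube_family W) (A : zmodType) pr pi (act : A -> Y -> Y),
  [/\ above i.+1 C D pr, is_ext i.+1 D F pi act, tower P i.+1 D, tower P i F & P A].
Proof.
elim=> {k T C} [//|k E Y C D A pi act tD IH PA e] i.
rewrite ltnS leq_eqVlt => /orP[/eqP->|ik].
  exists E, Y, C, D, A, id, pi, act; split=> //; first exact: above_id.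
  exact: TowerS e.
have [Y0 [W [D0 [F [B [pr [pi0 [act0 [ab e0 t1 t0 PB]]]]]]]]] := IH _ ik.
exists Y0, W, D0, F, B, (pr \o pi), pi0, act0; split=> //.
exact: above_step e ab.
Qed.

Lemma tower_structure P k (T : choiceType) (C : cube_family T) : tower P k C ->
  forall i, (1 <= i <= k)%N -> exists (A : zmodType)
    (act : A -> Defs.factor C i -> Defs.factor C i), is_structure_group act /\ P A.
Proof.
move=> tC [//|i] /= ik.
have [Y [W [D [F [A [pr [pi [act [ab e tD tF PA]]]]]]]]] := tower_level tC ik.
have [nD nF nC] : [/\ is_nilspace D, is_nilspace F & is_nilspace C].
  by split; apply: tower_nilspace; eassumption.
have simD := above_simP nD (tower_unique tD) ab.
have simF := above_simP nF (tower_unique tF) (above_ext ab e).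
(* [Fu] and [G] are mutually inverse bijections between X_(i+1) and the level Y of the tower; the
   action is transported along them. *)
pose Fu (u : Defs.factor C i.+1) := pr (factor_repr u).
have Fpi x : Fu (factor_pi C i.+1 x) = pr x.
  by apply/simD/(factor_piP nC)/factor_reprK.
pose G y : Defs.factor C i.+1 := factor_pi C i.+1 (projT1 (cid (above_surj ab y))).
have FG y : Fu (G y) = y by rewrite Fpi; case: cid.
have GF u : G (Fu u) = u.
  rewrite /G; case: cid => x /= xu; rewrite -[RHS]factor_reprK.
  exact/(factor_piP nC)/simD.
have Fproj u v : factor_proj u = factor_proj v <-> pi (Fu u) = pi (Fu v).
  by rewrite /factor_proj factor_piP //; apply: simF.
have Fcube n (c : dcube n -> Defs.factor C i.+1) : factor_cubes c <-> D n (Fu \o c).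
  split=> [[c0 Cc0 ->]|].
    by move: (above_cube ab Cc0) => /eq_cube; apply=> v; rewrite /= Fpi.
  move=> /(above_lift ab)[c0 Cc0 c0E]; exists c0 => //; apply/funext => v /=.
  by rewrite -[LHS]GF -[RHS]GF Fpi c0E.
exists A, (fun a u => G (act a (Fu u))); split=> //; split.
- by move=> u; rewrite (ext_act0 e) GF.
- by move=> a b u; rewrite FG (ext_actD e).
- by move=> a u; apply/Fproj; rewrite FG (ext_proj e).
- move=> u v /Fproj uv; have [a au] := ext_trans e uv.
  exists a; split; first by rewrite au GF.
  by move=> b /(congr1 Fu); rewrite FG -au => /esym/(ext_inj e).
move=> n c c' /Fcube Dc cc'; rewrite Fcube; split.
  move=> Dc'.
  have [f fE] := ext_diff e (c := Fu \o c) (c' := Fu \o c') (fun v => esym ((Fproj _ _).1 (cc' v))).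
  exists f; last by move=> v; rewrite -[LHS]GF -fE.
  by apply/(ext_act e _ Dc); move: Dc' => /eq_cube; apply.
case=> f Df c'E; move: ((ext_act e f Dc).2 Df) => /eq_cube; apply=> v.
by rewrite /= c'E FG.
Qed.

HB.instance Definition _ (T : Type) (C : cube_family T) (i : nat) :=
  gen_eqMixin (Defs.factor C i).
HB.instance Definition _ (T : Type) (C : cube_family T) (i : nat) :=
  gen_choiceMixin (Defs.factor C i).

Section StructureGroups.
Context (T : Type) (C : cube_family T) (nC : is_nilspace C).

Lemma factor_cubes_compose i : cubes_compose (@factor_cubes T C i).
Proof.
move=> m n t _ tt [c0 Cc0 ->]; exists (c0 \o t) => //.
exact: nilspace_composition nC _ _ _ _ _ _.
Qed.

Lemma structure_ext i (A : zmodType) (act : A -> Defs.factor C i.+1 -> Defs.factor C i.+1) :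
  is_structure_group act ->
  is_ext i.+1 (@factor_cubes T C i.+1) (@factor_cubes T C i) (@factor_proj T C i.+1) act.
Proof.
move=> sg; have proj := factor_proj_pi nC; split.
- exact: factor_cubes_compose.
- exact: structure_act0 sg.
- exact: structure_actD sg.
- exact: structure_act_fibre sg.
- by move=> x y /(structure_act_simply_transitive sg)[a [ax _]]; exists a.
- move=> a x ax; have [b [_ bu]] := structure_act_simply_transitive sg (erefl (factor_proj x)).
  by rewrite -(bu a) // -(bu 0) // (structure_act0 sg).
- move=> y; exists (factor_pi C i.+1 (factor_repr y)); rewrite proj.
  exact: factor_reprK.
- move=> n c [c0 Cc0 ->]; exists c0 => //; apply/funext => v; exact: proj.
- move=> n d [c0 Cc0 ->]; exists (factor_pi C i.+1 \o c0); first by exists c0.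
  by move=> v; apply: proj.
move=> n c f Cc.
have := structure_act_cubes sg Cc (c' := fun v => act (f v) (c v)).
case=> [v|H1 H2]; first exact: structure_act_fibre sg _ _.
split=> [/H1[g Dg gE]|Df]; last by apply: H2; exists f.
rewrite (_ : f = g) //; apply/funext => v.
have [b [_ bu]] := structure_act_simply_transitive sg (esym (structure_act_fibre sg (f v) (c v))).
by rewrite -(bu (f v)) // -(bu (g v)) // gE.
Qed.

Lemma factor0_eq (u v : Defs.factor C 0) : u = v.
Proof.
rewrite -(factor_reprK u) -(factor_reprK v); apply/(factor_piP nC).
exists (fun w => if w == cube0 1 then factor_repr u else factor_repr v), (fun=> factor_repr v).
by rewrite (nilspace_ergodic1 nC) eqxx; split=> // w /negPf ->.
Qed.

Lemma factor_tower (P : zmodType -> Prop) k :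
  (forall i, (1 <= i <= k)%N -> exists (A : zmodType)
     (act : A -> Defs.factor C i -> Defs.factor C i), is_structure_group act /\ P A) ->
  forall i, (i <= k)%N -> tower P i (@factor_cubes T C i).
Proof.
move=> sg; elim=> [_|i IH ik].
  have [x _] := nilspace_nonempty nC.
  apply: Tower0 => //; [by exists (factor_pi C 0 x)|exact: factor0_eq|].
  move=> n c; exists (fun=> x); first exact: cst_cube.
  by apply/funext => v; apply: factor0_eq.
have [A [act [sgA PA]]] := sg i.+1 ik.
by apply: TowerS (IH (ltnW ik)) PA (structure_ext sgA).
Qed.

(** The constant cube and the spike complete the same corner. *)
Lemma step_sim k : step k C -> forall x y, sim C k x y -> x = y.
Proof.
move=> st x y xy; have Cs := spike_cube nC xy.
have Cx := cst_cube nC k.+1 x.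
have /(congr1 (fun f => f (cube1 _))) : (fun=> x) = spike x y :> (dcube k.+1 -> T).
  apply: (st (fun=> x)); last by split=> // v v1; rewrite /spike (negPf v1).
    by move=> i; apply: cst_cube.
  by split.
by rewrite /spike eqxx.
Qed.

(** For a k-step X the projection to X_k is a bijection. Written as an extension by the trivial
    group, it can be prefixed to a reduction. *)
Lemma factor_pi_ext k : step k C ->
  is_ext 1 C (@factor_cubes T C k) (factor_pi C k) (fun (_ : 'I_1) x => x).
Proof.
move=> st; have inj x y : factor_pi C k x = factor_pi C k y -> x = y.
  by move=> /(factor_piP nC)/step_sim; apply.
split=> //.
- by move=> m n t c; apply: nilspace_composition.
- by move=> x y /inj->; exists 0.
- by move=> a x _; rewrite (ord1 a).
- by move=> u; exists (factor_repr u); apply: factor_reprK.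
- by move=> n c Cc; exists c.
- by move=> n _ [c Cc ->]; exists c.
move=> n c f Cc; split=> // _.
by rewrite (_ : f = fun=> 0); [exact: Dcubes0|apply/funext => v; rewrite (ord1 (f v))].
Qed.

End StructureGroups.

(** * Lifting an action along an extension *)

Section Difference.
Context (l : nat) (A : zmodType) (E Y : Type) (C : cube_family E)
    (D : cube_family Y) (pi : E -> Y) (act : A -> E -> E).
Arguments C : clear implicits.
Arguments D : clear implicits.
Hypothesis extE : is_ext l C D pi act.

(* y - x, which is meaningful only if pi x = pi y; otherwise the value is 0. *)
Definition dif (x y : E) : A :=
  if pselect (exists a, act a x = y) is left h then projT1 (cid h) else 0.

Lemma difK x y : pi x = pi y -> act (dif x y) x = y.
Proof.
move=> /(ext_trans extE) xy; rewrite /dif; case: pselect => // h.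
by case: cid.
Qed.

Lemma dif_act a x : dif x (act a x) = a.
Proof. by apply: (ext_inj extE (x := x)); rewrite difK // (ext_proj extE). Qed.

Lemma dif_trans x y z : pi x = pi y -> pi y = pi z -> dif x z = dif x y + dif y z.
Proof.
move=> xy yz; apply: (ext_inj extE (x := x)).
by rewrite difK ?xy // addrC (ext_actD extE) !difK.
Qed.

Lemma dif_sym x y : pi x = pi y -> dif y x = - dif x y.
Proof.
move=> xy; apply/eqP; rewrite -addr_eq0 -dif_trans //.
by rewrite -{2}(ext_act0 extE y) dif_act.
Qed.

Lemma cube_dif n (q h : dcube n -> E) : C n q -> (forall v, pi (q v) = pi (h v)) ->
  C n h <-> Dcubes l A n (fun v => dif (q v) (h v)).
Proof.
move=> Cq qh; rewrite -(ext_act extE _ Cq).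
by rewrite (_ : (fun v => _) = h) //; apply/funext => v; rewrite difK.
Qed.

Lemma cube_alt (q h : dcube l.+1 -> E) : C l.+1 q ->
  (forall v, pi (q v) = pi (h v)) ->
  C l.+1 h <-> alt (fun v => dif (q v) (h v)) = 0.
Proof. by move=> Cq qh; apply: iff_trans (cube_dif Cq qh) (Dcubes_alt _). Qed.

(** The cubes of D_l(A) are tested on (l+1)-dimensional cubes, hence so are the cubes of E among the
    maps that lie over cubes of Y. *)
Lemma cube_test n (h : dcube n -> E) : D n (pi \o h) ->
  (forall theta : dcube l.+1 -> dcube n, cube_morphism theta -> C l.+1 (h \o theta)) ->
  C n h.
Proof.
move=> Dh hC; have [q Cq qh] := ext_lift extE Dh.
apply/(cube_dif Cq qh) => theta tt.
apply/(cube_alt (ext_compose extE tt Cq)); first by move=> v; apply: qh.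
exact: hC.
Qed.

End Difference.

Lemma Dcubes0_cst (A : zmodType) n (f : dcube n -> A) v w :
  Dcubes 0 A n f -> f v = f w.
Proof.
move=> Df; pose theta (t : dcube 1) : dcube n := [ffun i => if t ord0 then w i else v i].
have tt : cube_morphism theta.
  apply: (cube_morphismI (o := fun i => if v i == w i then None else Some ord0) (b := v)).
  move=> t i; rewrite ffunE; case: eqP => [->|]; first by case: ifP.
  by case: (v i); case: (w i); case: (t ord0).
have := Df theta tt; rewrite -/(alt (f \o theta)) (alt_face ord0) !alt0dim => /eqP.
rewrite subr_eq0 => /eqP /= E.
have -> : v = theta (face ord0 false (cube0 0)).
  by apply/ffunP => i; rewrite ffunE face_id.
have -> // : w = theta (face ord0 true (cube0 0)).
by apply/ffunP => i; rewrite ffunE face_id.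
Qed.

Lemma mulrn_card (B : finZmodType) (b : B) : b *+ #|B| = 0.
Proof.
have : \sum_(x : B) (x + b) = \sum_(x : B) x.
  by rewrite [RHS](reindex_inj (addIr b)).
by rewrite big_split /= sumr_const => /eqP; rewrite -subr_eq0 addrAC subrr add0r => /eqP.
Qed.

Section Averaging.
Context (A : zmodType) (B : finZmodType) (e : nat).
(** Multiplication by e serves as division by #|B| in A. *)
Hypothesis e_inv : forall a : A, a *+ (#|B| * e) = a.

Lemma mulrn_expI r (a : A) : a *+ (#|B| ^ r * e ^ r) = a.
Proof.
elim: r => [|r IH]; first by rewrite !expn0 mulr1n.
by rewrite !expnS mulnACA mulrnA e_inv.
Qed.

Lemma mulrn_card_eq0 (a : A) : a *+ #|B| = 0 -> a = 0.
Proof. by move=> a0; rewrite -(e_inv a) mulrnA a0 mul0rn. Qed.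

(* A nontrivial 0-1 combination of uniform elements of B is uniform. *)
Lemma avg_combination r (u : dcube r) (i0 : 'I_r) (F : B -> A) : u i0 ->
  (\sum_(b : {ffun 'I_r -> B}) F (\sum_i b i *+ u i)) *+ e ^ r = (\sum_x F x) *+ e.
Proof.
move=> ui0; set S := \sum_b _.
suff E : S *+ #|B| = (\sum_x F x) *+ #|B| ^ r.
  rewrite -{1}[S]e_inv -mulrnA -mulnA mulrnA E -mulrnA.
  rewrite -[in RHS](mulrn_expI r (\sum_x F x)) -mulrnA; congr (_ *+ _).
  by rewrite mulnA mulnAC.
(* Translating b_(i0) by x permutes the tuples b and, as u_(i0) = 1, adds x to the combination;
   summed over x, each tuple then contributes the full sum of F. *)
transitivity (\sum_(x : B) \sum_(b : {ffun 'I_r -> B}) F (\sum_i b i *+ u i + x)).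
  rewrite -sumr_const; apply: eq_bigr => x _.
  pose tr (b : {ffun 'I_r -> B}) : {ffun 'I_r -> B} :=
    [ffun i => if i == i0 then b i + x else b i].
  rewrite [LHS](reindex_inj (h := tr)) /=; last first.
    move=> b b' /ffunP bb; apply/ffunP => i; have := bb i; rewrite !ffunE.
    by case: eqP => // _ /addIr.
  apply: eq_bigr => b _; congr F; rewrite (bigD1 i0) //= [in RHS](bigD1 i0) //=.
  rewrite ffunE eqxx ui0 /= !mulr1n -!addrA; congr (_ + _).
  rewrite [RHS]addrC; congr (_ + _); apply: eq_bigr => i /negPf ii0.
  by rewrite ffunE ii0.
rewrite exchange_big /=.
rewrite (eq_bigr (fun=> \sum_x F x)) => [|b _].
  by rewrite sumr_const card_ffun card_ord.
by rewrite [RHS](reindex_inj (addrI (\sum_i b i *+ u i))).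
Qed.

End Averaging.

Section LiftAction.
Context (k j : nat) (A : zmodType) (B : finZmodType) (E Y Z : Type)
  (C : cube_family E) (D : cube_family Y) (D' : cube_family Z)
  (pi : E -> Y) (act : A -> E -> E) (q : Y -> Z) (actB : B -> Y -> Y).
Arguments C : clear implicits.
Arguments D : clear implicits.
Arguments D' : clear implicits.
Hypotheses (j0 : (0 < j)%N) (eE : is_ext k C D pi act) (eY : is_ext j D D' q actB).
Hypothesis nE : is_nilspace C.
Context (e : nat).
Hypothesis e_inv : forall a : A, a *+ (#|B| * e) = a.

Local Notation n := k.+1.
Local Notation dif := (dif act).

(* R is the cocycle of the extension E -> Y for the section s, t its average over
   the cubes u |-> y + u.b, and M its average over the translates of a cube. The
   section s' = s - t has the B-invariant cocycle M. *)
Let s (y : Y) : E := projT1 (cid (ext_surj eE y)).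

Let sK y : pi (s y) = y.
Proof. by rewrite /s; case: cid. Qed.

Let lift (h : dcube n -> Y) : dcube n -> E :=
  if pselect (D n h) is left hD then projT1 (cid2 (ext_lift eE hD)) else s \o h.

Let R (h : dcube n -> Y) : A := alt (fun v => dif (lift h v) (s (h v))).

(** Two cubes lifting h differ by a cube of D_k(A), whose alternating sum in dimension k+1
    vanishes. *)
Let RE (h : dcube n -> Y) (c : dcube n -> E) : D n h -> C n c ->
  (forall v, pi (c v) = h v) -> R h = alt (fun v => dif (c v) (s (h v))).
Proof.
move=> Dh Cc ch; rewrite /R /lift; case: pselect => // Dh'; case: cid2 => x /= Cx xh.
have xc v : pi (x v) = pi (c v) by rewrite xh ch.
have := (cube_alt eE Cx xc).1 Cc => E0.
rewrite -[RHS]add0r -E0 -altD; apply: eq_alt => v.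
by rewrite (dif_trans eE (y := c v)) // sK.
Qed.

Let t (y : Y) : A := (\sum_(b : {ffun 'I_n -> B})
  R (fun u => actB (\sum_i b i *+ u i) y)) *+ e ^ n.

Let M (w : dcube n -> Y) : A := (\sum_(x : B) R (fun v => actB x (w v))) *+ e.

Let combination_cube (b : {ffun 'I_n -> B}) :
  Dcubes j B n (fun u : dcube n => \sum_i b i *+ u i).
Proof.
apply: (@Dcubes_sum B j n _ (index_enum _) xpredT (fun i (u : dcube n) => b i *+ u i)) => i _.
apply: (@Dcubes_support _ _ _ [set i]%SET); first by rewrite cards1.
by move=> v w vw; rewrite vw // inE.
Qed.

(* Exchanging the two alternating sums over the 2n-dimensional cube
   (v, u) |-> w v + u.b. *)
Let alt_t (w : dcube n -> Y) : D n w -> alt (fun v => t (w v)) = R w - M w.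
Proof.
move=> Dw.
pose W (b : {ffun 'I_n -> B}) (u v : dcube n) := actB (\sum_i b i *+ u i) (w v).
have exch b : alt (fun v => R (fun u => W b u v)) = alt (fun u => R (W b u)).
  pose p1 (z : dcube (n + n)) : dcube n := [ffun i => z (lshift n i)].
  pose p2 (z : dcube (n + n)) : dcube n := [ffun i => z (rshift n i)].
  pose J (v u : dcube n) : dcube (n + n) :=
    [ffun i => match fintype.split i with inl i => v i | inr i => u i end].
  have p1J v u : p1 (J v u) = v.
    by apply/ffunP => i; rewrite !ffunE (unsplitK (inl i)).
  have p2J v u : p2 (J v u) = u.
    by apply/ffunP => i; rewrite !ffunE (unsplitK (inr i)).
  have p1m : cube_morphism p1.
    by apply: (cube_morphismI (o := fun i => Some (lshift n i)) (b := fun=> false)) => z i; rewrite ffunE addbF.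
  have p2m : cube_morphism p2.
    by apply: (cube_morphismI (o := fun i => Some (rshift n i)) (b := fun=> false)) => z i; rewrite ffunE addbF.
  have J1 v : cube_morphism (J v).
    apply: (cube_morphismI (o := fun i => if fintype.split i is inr i then Some i else None)
      (b := fun i => if fintype.split i is inl i then v i else false)) => u i.
    by rewrite ffunE; case: fintype.split => x; rewrite ?addbF.
  have J2 u : cube_morphism (J^~ u).
    apply: (cube_morphismI (o := fun i => if fintype.split i is inl i then Some i else None)
      (b := fun i => if fintype.split i is inr i then u i else false)) => v i.
    by rewrite ffunE; case: fintype.split => x; rewrite ?addbF.
  have DH : D (n + n) (fun z => W b (p2 z) (p1 z)).
    apply/(ext_act eY _ (ext_compose eY p1m Dw)).
    exact: (Dcubes_compose p2m (combination_cube b)).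
  have [Q CQ QH] := ext_lift eE DH.
  have Q1 v : R (fun u => W b u v) = alt (fun u => dif (Q (J v u)) (s (W b u v))).
    apply: RE; last by move=> u; rewrite QH p1J p2J.
      by move: (ext_compose eY (J1 v) DH) => /eq_cube; apply=> u /=; rewrite p1J p2J.
    exact: ext_compose eE _ _ _ _ (J1 v) CQ.
  have Q2 u : R (W b u) = alt (fun v => dif (Q (J v u)) (s (W b u v))).
    apply: RE; last by move=> v; rewrite QH p1J p2J.
      by move: (ext_compose eY (J2 u) DH) => /eq_cube; apply=> v /=; rewrite p1J p2J.
    exact: ext_compose eE _ _ _ _ (J2 u) CQ.
  by rewrite (eq_alt Q1) (eq_alt Q2) exchange_alt.
rewrite /t altMn alt_sum (eq_bigr _ (fun b _ => exch b)) -alt_sum -altMn.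
(* At u = 0 every term is R w; at u <> 0 the element u.b is uniform and the average is M w. The
   alternating sum kills the constant M w and leaves the vertex 0. *)
transitivity (alt (fun u : dcube n => (if u == cube0 n then R w - M w else 0) + M w)); last first.
  rewrite altD (@alt_indep _ _ ord0 (fun=> M w)) // addr0 alt_delta.
  by rewrite (_ : weight (cube0 n) = 0%N) // /weight big1 // => i _; rewrite ffunE.
apply: eq_alt => u; case: eqVneq => [->|u0].
  rewrite subrK (eq_bigr (fun=> R w)) => [|b _].
    by rewrite sumr_const card_ffun card_ord -mulrnA mulrn_expI.
  congr R; apply/funext => v; rewrite /W big1 ?(ext_act0 eY) // => i _.
  by rewrite ffunE.
have [i0 ui0] : exists i, u i.
  apply/existsP; apply: contraNT u0; rewrite negb_exists => /forallP u0.
  by apply/eqP/ffunP => i; rewrite ffunE; apply/negbTE; exact: u0.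
by rewrite add0r (avg_combination e_inv (fun x => R (fun v => actB x (w v))) ui0).
Qed.

Let s' (y : Y) : E := act (- t y) (s y).

Let s'K y : pi (s' y) = y.
Proof. by rewrite (ext_proj eE) sK. Qed.

Let R'E (c : dcube n -> E) : C n c ->
  alt (fun v => dif (c v) (s' (pi (c v)))) = M (pi \o c).
Proof.
move=> Cc; have Dc := ext_cube eE Cc.
rewrite (eq_alt (g := fun v => dif (c v) (s (pi (c v))) - t (pi (c v)))) => [|v].
  by rewrite altB alt_t // -(RE Dc Cc) // subKr.
rewrite (dif_trans eE (y := s (pi (c v)))) ?sK ?s'K //.
by rewrite (dif_act eE).
Qed.

Let M_shift w b : M (fun v => actB b (w v)) = M w.
Proof.
congr (_ *+ _); rewrite [RHS](reindex_inj (addIr b)); apply: eq_bigr => x _.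
by congr R; apply/funext => v; rewrite (ext_actD eY).
Qed.

(** In the coordinates (pi x, x - s' (pi x)) on E, B moves the base and fixes the fibre coordinate.
    It therefore commutes with A; the invariance of M enters when cubes have to be preserved. *)
Definition lift_act (b : B) (x : E) : E :=
  act (dif (s' (pi x)) x) (s' (actB b (pi x))).

Lemma lift_act_proj b x : pi (lift_act b x) = actB b (pi x).
Proof. by rewrite (ext_proj eE) s'K. Qed.

Lemma lift_act0 x : lift_act 0 x = x.
Proof. by rewrite /lift_act (ext_act0 eY) (difK eE) // s'K. Qed.

Lemma lift_actD b b' x : lift_act (b + b') x = lift_act b (lift_act b' x).
Proof.
rewrite [RHS]/lift_act lift_act_proj {2}/lift_act (dif_act eE) -(ext_actD eY).
by [].
Qed.

Lemma lift_actC a b x : lift_act b (act a x) = act a (lift_act b x).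
Proof.
rewrite /lift_act (ext_proj eE) -(ext_actD eE); congr act.
by rewrite (dif_trans eE (y := x)) ?(ext_proj eE a) ?s'K // (dif_act eE) addrC.
Qed.

(** The defects of s' over a cube of Y and over its translate by b are M of these two cubes, which
    agree. *)
Let cube_lift_cst m (c : dcube m -> E) b : C m c -> C m (fun v => lift_act b (c v)).
Proof.
move=> Cc; apply: (cube_test eE) => [|theta tt].
  have := ext_act eY (fun=> b) (ext_cube eE Cc).
  move=> [_ /(_ (@Dcubes_cst _ _ _ b))] /eq_cube; apply=> v.
  by rewrite /= lift_act_proj.
have Cct : C n (c \o theta) by apply: ext_compose eE _ _ _ _ tt Cc.
have [Q CQ Qc] : exists2 Q, C n Q & forall v, pi (Q v) = actB b (pi (c (theta v))).
  apply: (ext_lift eE).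
  by apply/(ext_act eY (fun=> b) (ext_cube eE Cct)); apply: Dcubes_cst.
apply/(cube_alt eE CQ); first by move=> v; rewrite /= lift_act_proj.
rewrite (eq_alt (g := fun v => dif (Q v) (s' (pi (Q v)))
   - dif (c (theta v)) (s' (pi (c (theta v)))))) => [|v].
  rewrite altB R'E // -/((c \o theta) _) (R'E Cct) (_ : pi \o Q = fun v => actB b ((pi \o (c \o theta)) v)).
    by rewrite M_shift subrr.
  exact/funext.
rewrite (dif_trans eE (y := s' (pi (Q v)))) ?s'K //=; last first.
  by rewrite Qc lift_act_proj.
rewrite -(dif_sym eE) ?s'K //; congr (_ + _).
by rewrite /lift_act Qc (dif_act eE).
Qed.

(** One value of A at the vertex 1 suffices to correct the alternating sum of any (k+1)-dimensional
    lift of a cube of Y. *)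
Let adj (x : 'I_n) (f : dcube n -> B) (a : A) (c : dcube n -> E) (v : dcube n) : E :=
  act (if v == cube1 n then a else 0) (lift_act (if v x then f v else 0) (c v)).

(* The obstruction a to adding v_x f to c does not depend on the lower face of c,
   by gluing; for c independent of v_x it is additive in f, so it is killed both
   by the order of B and by that of A. *)
Let cube_lift_edge i (x : 'I_n) (f : dcube n -> B) (c : dcube n -> E) :
  (forall m (c : dcube m -> E) d, C m c -> Dcubes i B m d ->
     C m (fun v => lift_act (d v) (c v))) ->
  Dcubes i B n f -> (forall r v, f (upd x r v) = f v) ->
  Dcubes j B n (fun v => if v x then f v else 0) ->
  C n c -> C n (fun v => lift_act (if v x then f v else 0) (c v)).
Proof.
move=> IH Df fx Dxf Cc.
have [a Ca] : exists a, C n (adj x f a c).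
  have [Q CQ Qc] : exists2 Q, C n Q &
      forall v, pi (Q v) = actB (if v x then f v else 0) (pi (c v)).
    by apply: (ext_lift eE); apply/(ext_act eY _ (ext_cube eE Cc)).
  have [a aE] := alt_surj (cube1 n)
    (- alt (fun v => dif (Q v) (lift_act (if v x then f v else 0) (c v)))).
  exists a; apply/(cube_alt eE CQ).
    by move=> v; rewrite (ext_proj eE) lift_act_proj.
  rewrite -[RHS](addNr (alt (fun v => dif (Q v) (lift_act (if v x then f v else 0) (c v))))).
  rewrite -aE -altD; apply: eq_alt => v.
  rewrite (dif_trans eE (y := lift_act (if v x then f v else 0) (c v))) ?lift_act_proj //.
    by rewrite (dif_act eE) addrC.
  by rewrite (ext_proj eE) lift_act_proj.
pose c1 := c \o upd x true.
have Cc1 : C n c1 by apply: ext_compose eE _ _ _ _ (cube_morphism_upd x true) Cc.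
have up1 (v : dcube n) : v x = true -> upd x true v = v by move=> vx; rewrite -[in LHS]vx upd_same.
have low1 (v : dcube n) : v x = false -> (v == cube1 n) = false.
  by move=> vx; apply/eqP => /ffunP/(_ x); rewrite vx ffunE.
have Ca1 : C n (adj x f a c1).
  have low v : c (upd x false v) = adj x f a c (upd x false v).
    by rewrite /adj upd_id lift_act0 low1 ?upd_id // (ext_act0 eE).
  move: (glue_lower nE Cc Ca low) => /eq_cube; apply=> v; rewrite /adj /c1 /=.
  case vx: (v x); first by rewrite up1.
  by rewrite low1 // lift_act0 (ext_act0 eE).
have Cat N : C n (adj x (fun v => f v *+ N) (a *+ N) c1).
  elim: N => [|N IHN].
    move: Cc1 => /eq_cube; apply=> v.
    by rewrite /adj !mulr0n !if_same lift_act0 (ext_act0 eE).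
  (* [c2] leads from N copies of f to N+1. Its correction is supported on the edge through the
     vertex 1 in direction x, so it ignores v_x and lies in D_k(A); gluing [c2] to the N-fold step
     removes the face in the middle. *)
  pose c2 v := act (if upd x true v == cube1 n then a *+ N else 0)
      (lift_act (f v *+ N) (adj x f a c1 v)).
  have C2 : C n c2.
    apply/(ext_act eE); first by apply: IH => //; apply: DcubesMn.
    apply: (@Dcubes_support _ _ _ (~: [set x])%SET); first by rewrite cardsC1 card_ord.
    move=> v w vw; congr (if _ == _ then _ else _); apply/ffunP => y; rewrite !ffunE.
    by case: eqP => // /eqP yx; apply: vw; rewrite !inE.
  set c3 := adj x _ _ c1 in IHN.
  have low v : (c3 \o flip x) (upd x false v) = c2 (upd x false v).
    rewrite /c3 /c2 /adj /c1 /= /flip !(upd_id, upd_upd, fx).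
    by rewrite lift_act0 (low1 (upd x false v)) ?upd_id // (ext_act0 eE).
  move: (glue_lower nE (ext_compose eE (cube_morphism_flip x) IHN) C2 low).
  rewrite /c3 /c2 => /eq_cube; apply=> v; rewrite /= /flip upd_id upd_upd /=.
  case vx: (v x); last first.
    rewrite /adj upd_id vx !lift_act0 !low1 ?upd_id // !(ext_act0 eE).
    by rewrite /c1 /= upd_upd.
  rewrite up1 // /adj vx lift_actC -lift_actD -(ext_actD eE) -mulrSr.
  by congr (act _ _); case: ifP => _; rewrite ?addr0 // mulrSr.
have : a *+ #|B| = 0.
  have := Cat #|B|; rewrite (_ : adj x _ _ c1 = fun v => act (if v == cube1 n then a *+ #|B| else 0) (c1 v)).
    move/(ext_act eE _ Cc1)/Dcubes_alt; rewrite alt_delta => /eqP.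
    by rewrite mulrz_sign_eq0 => /eqP.
  by apply/funext => v; rewrite /adj mulrn_card if_same lift_act0.
move/(mulrn_card_eq0 e_inv) => a0.
move: Ca; rewrite a0 => /eq_cube; apply=> v.
by rewrite /adj if_same (ext_act0 eE).
Qed.

(* Induction on the degree, from constant d: a function of degree i+1 is peeled
   one coordinate at a time into pieces v_x f with f of degree i. *)
Lemma cube_lift_act i m (c : dcube m -> E) (d : dcube m -> B) : (i <= j)%N ->
  C m c -> Dcubes i B m d -> C m (fun v => lift_act (d v) (c v)).
Proof.
elim: i m c d => [|i IH] m c d ij Cc Dd.
  move: (cube_lift_cst (d (cube0 m)) Cc) => /eq_cube; apply=> v.
  by rewrite (Dcubes0_cst v (cube0 m) Dd).
apply: (cube_test eE) => [|theta tt].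
  move: ((ext_act eY d (ext_cube eE Cc)).2 (Dcubes_monotone ij Dd)) => /eq_cube.
  by apply=> v; rewrite /= lift_act_proj.
have {Cc} : C n (c \o theta) by apply: ext_compose eE _ _ _ _ tt Cc.
have {Dd} : Dcubes i.+1 B n (d \o theta) by apply: Dcubes_compose.
change (Dcubes i.+1 B n (d \o theta) -> C n (c \o theta) ->
  C n (fun v => lift_act ((d \o theta) v) ((c \o theta) v))).
move: (c \o theta) (d \o theta) => {}c {}d Dd Cc.
suff /(_ (enum 'I_n) d) : forall (l : seq 'I_n) (d : dcube n -> B), Dcubes i.+1 B n d ->
    (forall x, x \notin l -> forall r v, d (upd x r v) = d v) ->
    C n (fun v => lift_act (d v) (c v)).
  by apply=> // x; rewrite mem_enum.
elim=> {d Dd} [d _ dl|x l IHl d Dd dl].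
  have dE v : d v = d (cube0 n).
    suff /(_ (enum 'I_n)) dvE : forall l : seq 'I_n, d v = d [ffun y => if y \in l then false else v y].
      by rewrite dvE; congr d; apply/ffunP => y; rewrite !ffunE mem_enum.
    elim=> [|y l ->]; first by congr d; apply/ffunP => y; rewrite ffunE.
    rewrite -(dl y isT false); congr d; apply/ffunP => z; rewrite !ffunE inE.
    by case: eqP.
  move: (cube_lift_cst (d (cube0 n)) Cc) => /eq_cube; apply=> v.
  by rewrite dE.
pose d0 := d \o upd x false.
have Dd0 : Dcubes i.+1 B n d0 by apply: Dcubes_compose Dd; apply: cube_morphism_upd.
pose f v := d (upd x true v) - d (upd x false v).
have fE (v : dcube n) : (if v x then f v else 0) = d v - d0 v.
  by rewrite /f /d0 /=; have := upd_same x v; case: (v x) => ->; rewrite ?subrr.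
have Cd0 : C n (fun v => lift_act (d0 v) (c v)).
  apply: IHl => // y yl r v; rewrite /d0 /=.
  have [->|yx] := eqVneq y x; first by rewrite upd_upd.
  by rewrite updC 1?eq_sym // dl // inE negb_or yx.
suff : C n (fun v => lift_act (if v x then f v else 0) (lift_act (d0 v) (c v))).
  by move=> /eq_cube; apply=> v; rewrite -lift_actD fE subrK.
apply: (cube_lift_edge (i := i)) => //.
- by move=> m' c' d' Cc' Dd'; apply: IH => //; apply: ltnW.
- exact: Dcubes_derive.
- by move=> r v; rewrite /f !upd_upd.
- apply: (Dcubes_monotone ij); rewrite (_ : (fun v => _) = fun v => d v - d0 v); last exact/funext.
  exact: DcubesB.
Qed.

End LiftAction.

(** * Reduction to p-nilspaces *)

Lemma quotient_exists (T : Type) (r : T -> T -> Prop) :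
  (forall x, r x x) -> (forall x y, r x y -> r y x) ->
  (forall x y z, r x y -> r y z -> r x z) ->
  exists (Q : choiceType) (f : T -> Q),
    (forall u, exists x, f x = u) /\ forall x y, f x = f y <-> r x y.
Proof.
move=> rr rs rt; pose Q := {S : T -> Prop | exists x, S = r x}.
pose f x : {classic Q} := exist _ (r x) (ex_intro _ x erefl).
exists {classic Q}, f; split=> [[S Sx]|x y].
  by case: (Sx) => x xS; exists x; apply: eq_exist.
split=> [/(congr1 (@proj1_sig _ _)) /= ->//|xy].
apply: eq_exist; apply/funext => z; apply/propext; split; first exact: rt (rs _ _ xy).
exact: rt.
Qed.

Definition image_cubes (T U : Type) (C : cube_family T) (f : T -> U) : cube_family U :=
  fun n => [set c | exists2 c0, C n c0 & c = f \o c0].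

Lemma image_cubes_compose (T U : Type) (C : cube_family T) (f : T -> U) :
  cubes_compose C -> cubes_compose (image_cubes C f).
Proof.
by move=> comp m n t _ tt [c0 Cc0 ->]; exists (c0 \o t) => //; apply: comp Cc0.
Qed.

Lemma orbit_ext (j : nat) (B : zmodType) (E : Type) (C : cube_family E)
    (actE : B -> E -> E) :
  cubes_compose C -> (forall x, actE 0 x = x) ->
  (forall a b x, actE (a + b) x = actE a (actE b x)) ->
  (forall b x, actE b x = x -> b = 0) ->
  (forall n c (d : dcube n -> B), C n c ->
     C n (fun v => actE (d v) (c v)) <-> Dcubes j B n d) ->
  exists (Q : choiceType) (f : E -> Q), is_ext j C (image_cubes C f) f actE.
Proof.
move=> comp a0 aD afree acube.
have [||x y z [b bx] [b' by']|Q [f [fs fE]]] := @quotient_exists E (fun x y => exists b, actE b x = y).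
- by move=> x; exists 0.
- by move=> x y [b <-]; exists (- b); rewrite -aD addNr a0.
- by exists (b' + b); rewrite aD bx.
exists Q, f; split=> //.
- by move=> a x; apply/esym/fE; exists a.
- by move=> x y /fE.
- by move=> n c Cc; exists c.
- by move=> n _ [c Cc ->]; exists c.
Qed.

(** E' is the space of orbits of the lifted action of B; A acts on it because the two actions
    commute. *)
Lemma ext_swap k j (A : zmodType) (B : finZmodType) (E Y Z : Type)
    (C : cube_family E) (D : cube_family Y) (F : cube_family Z)
    (pi : E -> Y) (act : A -> E -> E) (q : Y -> Z) (actB : B -> Y -> Y) :
  (0 < j)%N -> is_ext k C D pi act -> is_ext j D F q actB -> is_nilspace C ->
  (exists e, forall a : A, a *+ (#|B| * e) = a) ->
  exists (E' : choiceType) (C' : cube_family E') (pi' : E' -> Z)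
    (act' : A -> E' -> E') (f : E -> E') (actE : B -> E -> E),
  [/\ is_ext j C C' f actE, is_ext k C' F pi' act',
      forall x, pi' (f x) = q (pi x) & forall a x, f (act a x) = act' a (f x)].
Proof.
move=> j0 eE eY nE [e e_inv].
pose actE : B -> E -> E := lift_act actB eE e.
have aproj b x : pi (actE b x) = actB b (pi x) by exact: (lift_act_proj actB eE e b x).
have a0 x : actE 0 x = x by exact: (lift_act0 eE eY e x).
have aD b b' x : actE (b + b') x = actE b (actE b' x) by exact: (lift_actD eE eY e b b' x).
have aC a b x : actE b (act a x) = act a (actE b x) by exact: (lift_actC actB eE e a b x).
have aE n c (d : dcube n -> B) : C n c ->
     C n (fun v => actE (d v) (c v)) <-> Dcubes j B n d.
  move=> Cc; split=> [/(ext_cube eE) Dc|Dd].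
    apply/(ext_act eY _ (ext_cube eE Cc)); move: Dc => /eq_cube; apply=> v.
    by rewrite /= aproj.
  exact: (cube_lift_act j0 eE eY nE e_inv (leqnn j)).
have [|||||Q [f ef]] := @orbit_ext j B E C actE.
- exact: ext_compose eE.
- exact: a0.
- exact: aD.
- by move=> b x /(congr1 pi); rewrite aproj => /(ext_free eY).
- exact: aE.
pose sec u := projT1 (cid (ext_surj ef u)).
have secK u : f (sec u) = u by rewrite /sec; case: cid.
pose pi' u := q (pi (sec u)).
pose act' a u := f (act a (sec u)).
have pi'f x : pi' (f x) = q (pi x).
  have [b bx] := ext_trans ef (secK (f x)).
  by rewrite /pi' -[in RHS]bx aproj (ext_proj eY).
have act'f a x : f (act a x) = act' a (f x).
  have [b bx] := ext_trans ef (secK (f x)).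
  by rewrite -[in LHS]bx -aC (ext_proj ef).
exists Q, (image_cubes C f), pi', act', f, actE; split=> //; split.
- exact: image_cubes_compose (ext_compose eE).
- by move=> u; rewrite -(secK u) -act'f (ext_act0 eE).
- by move=> a b u; rewrite -(secK u) -!act'f (ext_actD eE).
- by move=> a u; rewrite -(secK u) -act'f !pi'f (ext_proj eE).
- move=> u v; rewrite -(secK u) -(secK v) !pi'f => /(ext_trans eY)[b].
  rewrite -aproj => /(ext_trans eE)[a ay]; exists a.
  by rewrite -act'f -ay -aC (ext_proj ef).
- move=> a u; rewrite -(secK u) -act'f => /esym/(ext_trans ef)[b ba].
  have b0 : b = 0.
    by apply: (ext_free eY (x := pi (sec u))); rewrite -aproj ba (ext_proj eE).
  by apply: (ext_free eE (x := sec u)); rewrite -ba b0 a0.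
- move=> z; have [y <-] := ext_surj eY z; have [x <-] := ext_surj eE y.
  by exists (f x).
- move=> n _ [c Cc ->].
  move: (ext_cube eY (ext_cube eE Cc)) => /eq_cube; apply=> v.
  by rewrite /= pi'f.
- move=> n d Fd; have [d1 Dd1 d1E] := ext_lift eY Fd; have [c Cc cE] := ext_lift eE Dd1.
  exists (f \o c); first by exists c.
  by move=> v; rewrite /= pi'f cE d1E.
move=> n _ g [c Cc ->]; split; last first.
  move=> /(ext_act eE g Cc) Cg; exists (fun v => act (g v) (c v)) => //.
  by apply/funext => v; rewrite /= act'f.
(* The cube c2 is d.(g.c) for some d with values in B. Projecting to Y shows that d has degree j, so
   d.c is a cube in the same fibres as c2 = g.(d.c). *)
case=> c2 Cc2 c2E; have {}c2E v : f (act (g v) (c v)) = f (c2 v).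
  by have := congr1 (fun h => h v) c2E; rewrite /= act'f.
have [d dE] := ext_diff ef c2E.
have Dd : Dcubes j B n d.
  apply/(ext_act eY _ (ext_cube eE Cc)); move: (ext_cube eE Cc2) => /eq_cube; apply=> v.
  by rewrite /= dE aproj (ext_proj eE).
have Cc3 := (aE _ _ _ Cc).2 Dd.
apply/(ext_act eE _ Cc3); move: Cc2 => /eq_cube; apply=> v.
by rewrite dE aC.
Qed.

(* Killing, one after the other, structure groups of order prime to p. *)
Inductive reduction (p : nat) : forall E F : choiceType, cube_family E ->
    cube_family F -> (E -> F) -> Prop :=
| reduction_id (E : choiceType) (C : cube_family E) : reduction p C C id
| reduction_step j (B : finZmodType) (E Y Z : choiceType) (C : cube_family E)
    (D : cube_family Y) (F : cube_family Z) q (act : B -> E -> E) pr :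
    (0 < j)%N -> coprime #|B| p -> is_nilspace D -> is_ext j C D q act ->
    reduction p D F pr -> reduction p C F (pr \o q).

Lemma mulrn_inverse (A : zmodType) (p r N : nat) : (0 < N)%N -> coprime N p ->
  (forall a : A, a *+ p ^ r = 0) -> exists e, forall a : A, a *+ (N * e) = a.
Proof.
move=> N0 Np Ar; have Npr : coprime N (p ^ r) by rewrite coprimeXr.
case: (egcdnP (p ^ r) N0) => km kn E _; exists km => a.
rewrite mulnC E (eqP Npr) mulrnDr mulr1n mulnC mulrnA Ar mul0rn add0r //.
Qed.

(** The extension E -> Y is exchanged with the killed groups one at a time; A is killed by a power
    of p, so the order of each of these groups is invertible on A. *)
Lemma reduction_push p r (Y Z : choiceType) (D : cube_family Y) (F : cube_family Z) pr :
  reduction p D F pr -> is_nilspace D ->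
  forall k (A : zmodType) (E : choiceType) (C : cube_family E) (pi : E -> Y)
    (act : A -> E -> E), (0 < k)%N -> (forall a : A, a *+ p ^ r = 0) ->
  is_ext k C D pi act ->
  exists (E' : choiceType) (C' : cube_family E') (pi' : E' -> Z)
    (act' : A -> E' -> E') (f : E -> E'),
  [/\ reduction p C C' f, is_ext k C' F pi' act',
      forall x, pi' (f x) = pr (pi x) & forall a x, f (act a x) = act' a (f x)].
Proof.
elim=> {Y Z D F pr} [Y D nD k A E C pi act k0 Ar eE|j B Y Y1 Z D D1 F q actB pr j0 Bp nD1 eY _ IH nD k A E C pi act k0 Ar eE].
  by exists E, C, pi, act, id; split=> //; apply: reduction_id.
have [||E1 [C1 [pi1 [act1 [f1 [actE [e1 e2 pif actf]]]]]]] := ext_swap j0 eE eY.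
- exact: ext_nilspace eE k0 nD.
- by apply: mulrn_inverse Bp Ar; apply/card_gt0P; exists 0.
have [E' [C' [pi' [act' [f [rd e3 pif' actf']]]]]] := IH nD1 _ _ _ _ _ _ k0 Ar e2.
exists E', C', pi', act', (f \o f1); split=> //.
- exact: reduction_step j0 Bp (ext_nilspace e2 k0 nD1) e1 rd.
- by move=> x; rewrite /= pif' pif.
- by move=> a x; rewrite /= actf actf'.
Qed.

(** * Splitting a torsion tower into its p-parts *)

Definition torsion_pred (A : zmodType) (N : nat) : {pred A} := fun a => a *+ N == 0.

Lemma torsion_pred_zmod_closed (A : zmodType) (N : nat) :
  zmod_closed (@torsion_pred A N).
Proof.
split=> [|x y /eqP x0 /eqP y0]; first by apply/eqP; rewrite mul0rn.
by apply/eqP; rewrite mulrnBl x0 y0 subrr.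
Qed.

HB.instance Definition _ (A : zmodType) (N : nat) :=
  GRing.isZmodClosed.Build A (@torsion_pred A N) (torsion_pred_zmod_closed A N).

(** The subgroup A[N]. If N is the p'-part of m = N P and m kills A, then A is the direct sum of
    A[N] and A[P]. *)
Record torsion_part (A : finZmodType) (N : nat) := TorsionPart {
  torsion_val : A;
  _ : torsion_val \in torsion_pred N }.

HB.instance Definition _ (A : finZmodType) (N : nat) :=
  [isSub for @torsion_val A N].
HB.instance Definition _ (A : finZmodType) (N : nat) :=
  [Finite of torsion_part A N by <:].
HB.instance Definition _ (A : finZmodType) (N : nat) :=
  [SubChoice_isSubZmodule of torsion_part A N by <:].

Lemma torsion_valMn (A : finZmodType) (N : nat) (x : torsion_part A N) : val x *+ N = 0.
Proof. by apply/eqP; case: x. Qed.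

Lemma torsion_partMn (A : finZmodType) (N : nat) (x : torsion_part A N) : x *+ N = 0.
Proof. by apply: val_inj; rewrite raddfMn raddf0; apply: torsion_valMn. Qed.

Lemma coprime_card_torsion (B : finZmodType) (N p : nat) : prime p ->
  coprime N p -> (forall b : B, b *+ N = 0) -> coprime #|B| p.
Proof.
move=> pp Np BN; rewrite coprime_sym prime_coprime //; apply/negP => pB.
have [|x _ ox] := @Cauchy _ p [set: B]%G pp; first by rewrite cardsT.
have : (#[x]%g %| N)%N.
  by rewrite order_dvdn FinRing.zmodXgE BN.
rewrite ox => pN; move: Np; rewrite coprime_sym prime_coprime //.
by rewrite pN.
Qed.

(** Finiteness is an equality with a finite group, so that substitution equips the very same group
    with its finite structure. *)
Definition fin_torsion (m : nat) (A : zmodType) : Prop :=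
  (exists B : finZmodType, B = A :> zmodType) /\ forall a : A, a *+ m = 0.

Definition fin_pgroup (p : nat) (A : zmodType) : Prop :=
  (exists B : finZmodType, B = A :> zmodType) /\
  exists r, forall a : A, a *+ p ^ r = 0.

(** If the order g of a exceeded 1, a prime divisor p of g would divide m, so g would divide the
    p'-part of m, which is prime to p. *)
Lemma mulrn_prime_parts (A : zmodType) (m : nat) (a : A) : (0 < m)%N ->
  a *+ m = 0 -> (forall p, p \in primes m -> a *+ partn m (negn p) = 0) -> a = 0.
Proof.
move=> m0 am ap.
have ex : exists n, (0 < n)%N && (a *+ n == 0) by exists m; rewrite m0 am eqxx.
case: (ex_minnP ex) => g /andP[g0 /eqP ag] gmin.
have gdvd n : a *+ n = 0 -> (g %| n)%N.
  move=> an; apply/negPn/negP => gn.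
  have : a *+ (n %% g) = 0.
    by move: an; rewrite {1}(divn_eq n g) mulrnDr mulnC mulrnA ag mul0rn add0r.
  move=> anr; have := gmin (n %% g)%N; rewrite anr eqxx andbT lt0n => /(_ gn).
  by rewrite leqNgt ltn_mod g0.
have [g1|g1] := leqP g 1.
  by have {}g1 : g = 1%N; [apply/eqP; rewrite eqn_leq g1 g0|rewrite -ag g1 mulr1n].
have pp := pdiv_prime g1; have pg := pdiv_dvd g.
have pm : pdiv g \in primes m by rewrite mem_primes pp m0 (dvdn_trans pg) ?gdvd.
have /(pnatP _ (part_gt0 _ _)) H := part_pnat (negn (pdiv g)) m.
by have := H _ pp (dvdn_trans pg (gdvd _ (ap _ pm))); rewrite !inE eqxx.
Qed.

Lemma mulrn_coprime_eq0 (A : zmodType) (N P : nat) (a : A) : (0 < N)%N ->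
  coprime N P -> a *+ N = 0 -> a *+ P = 0 -> a = 0.
Proof.
move=> N0 NP aN aP; case: (egcdnP P N0) => km kn E _.
have := congr1 (fun n => a *+ n) E; rewrite /= (eqP NP) mulrnDr mulr1n.
by rewrite [(km * N)%N]mulnC [(kn * P)%N]mulnC !mulrnA aN aP !mul0rn add0r.
Qed.

(* R p contains the kernel of the reduction to the p-part; the relations R p are
   given before p so that their intersection can be controlled. *)
Lemma tower_split m k (T : choiceType) (C : cube_family T) : (0 < m)%N ->
  tower (fin_torsion m) k C ->
  exists R : nat -> T -> T -> Prop,
    (forall x y, (forall p, p \in primes m -> R p x y) -> x = y) /\
    forall p, prime p -> exists (E' : choiceType) (C' : cube_family E') q,
      [/\ tower (fin_pgroup p) k C', reduction p C C' q &
          forall x y, q x = q y -> R p x y].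
Proof.
move=> m0; elim=> {k T C} [T C T0 Teq Cfull|k E Y C D A pi act tD [RY [RYinj RYsplit]] [[B BA] Am] eE].
  exists (fun _ _ _ => True); split=> // p pp.
  by exists T, C, id; split=> //; [apply: Tower0|apply: reduction_id].
subst A; have nD := tower_nilspace tD.
(* The second condition puts the element joining x to y into the p'-part of B, which the quotient by
   B[N] identifies with 0; an element lying in the p'-parts for all p is 0. *)
exists (fun p x y => RY p (pi x) (pi y) /\ forall a, act a x = y -> a *+ partn m (negn p) = 0).
split=> [x y Rxy|p pp].
  have /(ext_trans eE)[a ay] : pi x = pi y by apply: RYinj => p /Rxy[].
  rewrite -ay (_ : a = 0) ?(ext_act0 eE) //.
  apply: (mulrn_prime_parts m0) => // p /Rxy[_]; exact.
have [Z [F [pr [tF rd prR]]]] := RYsplit p pp.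
pose N := partn m (negn p); pose P := (p ^ logn p m)%N.
have NPm : (N * P)%N = m by rewrite mulnC /N /P -p_part partnC.
have N0 : (0 < N)%N by apply: part_gt0.
have P0 : (0 < P)%N by rewrite expn_gt0 prime_gt0.
have Np : coprime N p.
  by rewrite coprime_sym prime_coprime // -p'natE // part_pnat.
have NP : coprime N P by rewrite coprimeXr.
(* By Bezout, multiplication by km * N is 0 on B[N] and the identity on B[P]. *)
have [km [kn E1]] : exists km kn, (km * N = kn * P + 1)%N.
  by case: (egcdnP P N0) => km kn E1 _; exists km, kn; rewrite E1 (eqP NP).
have split_a (a : B) : a *+ (km * N) = a *+ (kn * P) + a.
  by rewrite E1 mulrnDr mulr1n.
pose actN (a : torsion_part B N) := act (val a).
have [|||||E0 [q0 e0]] := @orbit_ext k.+1 (torsion_part B N) E C actN.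
- exact: ext_compose eE.
- exact: ext_act0 eE.
- by move=> a b x; rewrite /actN raddfD (ext_actD eE).
- by move=> b x /(ext_free eE) b0; apply: val_inj; rewrite b0.
- move=> n c d Cc; rewrite (ext_act eE (fun v => val (d v)) Cc).
  split=> dD t tt; last first.
    have := congr1 val (dD t tt); rewrite raddf_sum raddf0 => E2; rewrite -[RHS]E2.
    by apply: eq_bigr => v _; rewrite raddfMz.
  apply: val_inj; rewrite raddf_sum raddf0 -[RHS](dD t tt).
  by apply: eq_bigr => v _; rewrite raddfMz.
set C0 := image_cubes C q0 in e0.
pose sec u := projT1 (cid (ext_surj e0 u)).
have secK u : q0 (sec u) = u by rewrite /sec; case: cid.
pose pi0 u := pi (sec u).
pose act0 (a : torsion_part B P) u := q0 (act (val a) (sec u)).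
have q0E x y : q0 x = q0 y -> exists2 a : torsion_part B N, act (val a) x = y & pi x = pi y.
  by move=> /(ext_trans e0)[a <-]; exists a => //; rewrite (ext_proj eE).
have actC (a b : B) x : act a (act b x) = act b (act a x).
  by rewrite -!(ext_actD eE) addrC.
have pi0q x : pi0 (q0 x) = pi x by have [a _] := q0E _ _ (secK (q0 x)).
have act0q a x : q0 (act (val a) x) = act0 a (q0 x).
  have [b bx _] := q0E _ _ (secK (q0 x)).
  by rewrite -[in LHS]bx actC; apply: (ext_proj e0).
have decomp (a : B) : exists (a1 : torsion_part B N) (a2 : torsion_part B P), a = val a1 + val a2.
  have h1 : - a *+ (kn * P) \in torsion_pred N.
    by apply/eqP; rewrite -mulrnA -mulnA [(P * N)%N]mulnC NPm mulnC mulrnA mulNrn Am oppr0 mul0rn.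
  have h2 : a *+ (km * N) \in torsion_pred P.
    by apply/eqP; rewrite -mulrnA -mulnA NPm mulnC mulrnA Am mul0rn.
  exists (TorsionPart h1), (TorsionPart h2) => /=.
  by rewrite split_a mulNrn addKr.
have e1 : is_ext k.+1 C0 D pi0 act0.
  split.
  - exact: image_cubes_compose (ext_compose eE).
  - by move=> u; rewrite -(secK u) -act0q raddf0 (ext_act0 eE).
  - by move=> a b u; rewrite -(secK u) -!act0q raddfD (ext_actD eE).
  - by move=> a u; rewrite -(secK u) -act0q !pi0q (ext_proj eE).
  - move=> u v; rewrite -(secK u) -(secK v) !pi0q => /(ext_trans eE)[a <-].
    have [a1 [a2 ->]] := decomp a; exists a2.
    by rewrite -act0q (ext_actD eE) (ext_proj e0 a1).
  - move=> a u; rewrite -(secK u) -act0q => /q0E[b + _].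
    rewrite -(ext_actD eE) => /(ext_free eE)/eqP; rewrite addr_eq0 => /eqP ba.
    apply: val_inj; rewrite raddf0; apply: (mulrn_coprime_eq0 N0 NP).
      by apply/eqP; rewrite -oppr_eq0 -mulNrn -ba torsion_valMn.
    exact: torsion_valMn.
  - by move=> y; have [x <-] := ext_surj eE y; exists (q0 x).
  - move=> n _ [c Cc ->]; move: (ext_cube eE Cc) => /eq_cube; apply=> v.
    by rewrite /= pi0q.
  - move=> n d Dd; have [c Cc cd] := ext_lift eE Dd; exists (q0 \o c); first by exists c.
    by move=> v; rewrite /= pi0q.
  move=> n _ f [c Cc ->]; split; last first.
    move=> fD; exists (fun v => act (val (f v)) (c v)).
      apply/(ext_act eE _ Cc) => t tt.
      have := congr1 val (fD t tt); rewrite raddf_sum raddf0 => E2; rewrite -[RHS]E2.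
      by apply: eq_bigr => v _; rewrite raddfMz.
    by apply/funext => v; rewrite /= act0q.
  case=> c2 Cc2 c2E; have {}c2E v : q0 (act (val (f v)) (c v)) = q0 (c2 v).
    by have := congr1 (fun h => h v) c2E; rewrite /= act0q.
  have [g gE] := ext_diff e0 c2E.
  have : Dcubes k.+1 B n (fun v => val (g v) + val (f v)).
    apply/(ext_act eE _ Cc); move: Cc2 => /eq_cube; apply=> v.
    by rewrite gE (ext_actD eE).
  (* This multiplication removes g and leaves f. *)
  move=> /(DcubesMn (km * N)) fD t tt; apply: val_inj.
  rewrite raddf_sum raddf0 -[RHS](fD t tt); apply: eq_bigr => v _.
  rewrite raddfMz mulrnDl mulnC [val (g _) *+ _]mulrnA torsion_valMn mul0rn add0r mulnC.
  by rewrite split_a mulnC mulrnA torsion_valMn mul0rn add0r.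
have nC0 := ext_nilspace e1 (ltn0Sn k) nD.
have [E' [C' [pi' [act' [f [rd' e' pif actf]]]]]] :=
  reduction_push rd nD (r := logn p m) (ltn0Sn k) (@torsion_partMn B P) e1.
exists E', C', (f \o q0); split.
- apply: TowerS tF _ e'; split; first by exists (torsion_part B P).
  by exists (logn p m); apply: torsion_partMn.
- apply: (reduction_step (ltn0Sn k) _ nC0 e0 rd').
  exact: coprime_card_torsion pp Np (@torsion_partMn B N).
move=> x y /= fxy; split.
  by apply: prR; rewrite -(pi0q x) -(pi0q y) -!pif fxy.
move=> a ay; have [a1 [a2 aE]] := decomp a.
have : act' a2 (f (q0 x)) = f (q0 x).
  by rewrite -actf -act0q [RHS]fxy -ay aE (ext_actD eE) (ext_proj e0 a1).
by move=> /(ext_free e') a20; rewrite aE a20 raddf0 addr0 torsion_valMn.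
Qed.

(* By induction on the degree the differences of f are constant, and this
   constant is killed by N and by P. *)
Lemma poly_periodic_cst (A : zmodType) (l : nat) (N P : nat) (f : int -> A) :
  (0 < N)%N -> coprime N P -> (forall a : A, a *+ P = 0) ->
  morphism (Dcubes 1 int) (Dcubes l A) f ->
  (forall t b, f (t + b *+ N) = f t) -> forall t b, f (t + b) = f t.
Proof.
move=> N0 NP AP; elim: l f => [|l IH] f fD fN t b.
  pose c (v : dcube 1) := if v ord0 then t + b else t.
  have := Dcubes0_cst (cube1 1) (cube0 1) (fD _ c (Dcubes_le_dim _ (leqnn 1))).
  by rewrite /c /= !ffunE.
pose g t := f (t + b) - f t.
have gcst s : g s = g t.
  rewrite -(subrKC t s); apply: (IH g) => [n c Dc|u b']; last first.
    by rewrite /g addrAC !fN.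
  pose c' (v : dcube n.+1) := c (drop_coord ord0 v) + (if v ord0 then b else 0).
  have Dc' : Dcubes 1 int n.+1 c'.
    apply: DcubesD; first exact: Dcubes_compose (cube_morphism_drop _) Dc.
    apply: (@Dcubes_support _ _ _ [set ord0]%SET); first by rewrite cards1.
    by move=> v w vw; rewrite vw // inE.
  have := Dcubes_compose (cube_morphism_face ord0 false) (Dcubes_derive ord0 (fD _ _ Dc')).
  move=> /eq_cube; apply=> v.
  by rewrite /c' /= !upd_face !drop_face !face_id addr0.
have fM i : f (t + b *+ i) = f t + g t *+ i.
  elim: i => [|i IHi]; first by rewrite !mulr0n !addr0.
  by rewrite mulrSr addrA mulrSr addrA -IHi -(gcst (t + b *+ i)) /g subrKC.
have g0 : g t = 0.
  apply: (mulrn_coprime_eq0 N0 NP) => //.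
  by apply/eqP; rewrite -(inj_eq (addrI (f t))) -fM fN addr0.
by apply/eqP; rewrite -subr_eq0 -/(g t) g0.
Qed.

(** By induction [pi \o g] is invariant under w, so along the line x + t w with t an integer the map
    g stays in one fibre. Its A-coordinate there is polynomial in t with period N, hence
    constant. *)
Lemma tower_morphism_cst (Z : zmodType) (N p k : nat) (T : choiceType)
    (C : cube_family T) (g : Z -> T) :
  (0 < N)%N -> coprime N p -> tower (fin_pgroup p) k C ->
  morphism (Dcubes 1 Z) C g -> forall x w, w *+ N = 0 -> g (x + w) = g x.
Proof.
move=> N0 Np tC; elim: tC g => {k T C} [T C _ Teq _ g _ x w _|k E Y C D A pi act tD IH [_ [r Ar]] eE g gC x w wN].
  exact: Teq.
have pg y u : u *+ N = 0 -> pi (g (y + u)) = pi (g y).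
  by apply: (IH (pi \o g)) => n c Dc; apply: (ext_cube eE); apply: gC.
have wzN (t : int) : (w *~ t) *+ N = 0.
  case: t => t; first by rewrite -pmulrn mulrnAC wN mul0rn.
  by rewrite NegzE mulrNz mulNrn -pmulrn mulrnAC wN mul0rn oppr0.
pose f (t : int) := dif act (g x) (g (x + w *~ t)).
have fcst : f (0 + 1) = f 0.
  apply: (poly_periodic_cst N0 _ Ar (l := k.+1)); first by rewrite coprimeXr.
    move=> n c Dc; have Dwc : Dcubes 1 Z n (fun v => x + w *~ c v).
      apply: DcubesD; first exact: Dcubes_cst.
      move=> t tt; have E1 := Dc t tt.
      rewrite -[RHS](mulr0z w) -E1 mulrz_sumr; apply: eq_bigr => v _.
      by rewrite -mulrzA mulrzz.
    apply/(cube_dif eE (cst_cube (ext_nilspace eE (ltn0Sn k) (tower_nilspace tD)) n (g x))).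
      by move=> v /=; rewrite pg.
    exact: gC Dwc.
  move=> t b; rewrite /f; congr (dif _ _ (g (x + _))).
  by rewrite mulrzDr pmulrn mulrzz mulrzA -pmulrn wzN addr0.
move: fcst; rewrite /f add0r mulr1z mulr0z addr0 => fE.
rewrite -(difK eE (x := g x) (y := g (x + w))) ?fE ?pg //.
by rewrite (difK eE).
Qed.

(** * Uniform measures *)

Lemma finite_cube_fun (n : nat) (X : choiceType) :
  finite_set [set: X] -> finite_set [set: dcube n -> X].
Proof.
move=> Xfin; pose S := fset_set [set: X].
have inS x : x \in S by rewrite in_fset_set // in_setT.
pose h (g : {ffun dcube n -> S}) : dcube n -> X := fun v => fsval (g v).
apply: (@sub_finite_set _ _ (h @` [set: {ffun dcube n -> S}])).
  move=> g _; exists [ffun v => [` inS (g v)]%fset] => //.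
  by apply/funext => v; rewrite /h ffunE.
exact: finite_image finite_finset.
Qed.

Section Probability.
Context (R : realType).

Lemma fsum_finite (T : choiceType) (A : set T) (F : T -> R) : finite_set [set: T] ->
  \sum_(x \in A) F x = \sum_(x <- fset_set [set: T]) (if x \in A then F x else 0).
Proof. by move=> Tfin; rewrite fsbig_mkcond fsbig_finite. Qed.

Lemma sum_if_eq (T : choiceType) (y : T) (F : T -> R) : finite_set [set: T] ->
  \sum_(x <- fset_set [set: T]) (if x == y then F x else 0) = F y.
Proof.
move=> Tfin; rewrite (bigD1_seq y) ?fset_uniq ?in_fset_set ?in_setT //= eqxx.
by rewrite big1 ?addr0 // => x /negPf ->.
Qed.

Lemma image_prob_comp (T U V : choiceType) (f : T -> U) (g : U -> V) (mu : T -> R) :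
  finite_set [set: T] -> finite_set [set: U] ->
  image_prob (g \o f) mu = image_prob g (image_prob f mu).
Proof.
move=> Tfin Ufin; apply/funext => z; rewrite /image_prob !fsum_finite //.
under [RHS]eq_bigr => y _ do rewrite fsum_finite //.
transitivity (\sum_(y <- fset_set [set: U]) \sum_(x <- fset_set [set: T])
   (if y == f x then (if g y == z then mu x else 0) else 0)).
  rewrite exchange_big /=; apply: eq_bigr => x _; rewrite sum_if_eq //.
  by congr (if _ then _ else _); apply/idP/eqP; rewrite inE.
apply: eq_bigr => y _; case: (boolP (y \in _)) => [|yz].
  rewrite inE /= => <-; apply: eq_bigr => x _; rewrite eqxx.
  by congr (if _ then _ else _); apply/eqP/idP; rewrite inE /= => ->.
rewrite big1 // => x _; case: eqP => // _; case: eqP => // gz.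
by move: yz; rewrite notin_setE => /(_ gz).
Qed.

Lemma image_prob_is_prob (T U : choiceType) (S : set T) (S' : set U) (f : T -> U)
    (mu : T -> R) :
  finite_set [set: T] -> finite_set [set: U] -> (forall x, S x -> S' (f x)) ->
  is_prob S mu -> is_prob S' (image_prob f mu).
Proof.
move=> Tfin Ufin fS [mu0 muS mu1]; split.
- by move=> y; apply: fsumr_ge0.
- move=> y S'y; rewrite /image_prob fsum_finite // big1 // => x _.
  case: ifPn => //; rewrite inE /= => fx; apply: muS => Sx.
  by apply: S'y; rewrite -fx; apply: fS.
rewrite -mu1 fsum_finite // [RHS]fsum_finite //.
transitivity (\sum_(y <- fset_set [set: U]) \sum_(x <- fset_set [set: T])
   (if y == f x then (if x \in S then mu x else 0) else 0)).
  apply: eq_bigr => y _; rewrite /image_prob fsum_finite //.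
  case: ifPn => [yS|]; last first.
    rewrite notin_setE => S'y; rewrite big1 // => x _; case: eqP => // yf.
    by case: ifPn => //; rewrite inE => /fS; rewrite -yf.
  apply: eq_bigr => x _.
  have -> : (x \in f @^-1` [set y]) = (y == f x).
    by apply/idP/eqP; rewrite inE /= => ->.
  case: eqP => // _; case: ifPn => //; rewrite notin_setE; exact: muS.
rewrite exchange_big /=; apply: eq_bigr => x _; exact: sum_if_eq.
Qed.

Lemma uniform_on_prob (T : choiceType) (S : set T) : finite_set [set: T] ->
  S !=set0 -> is_prob S (uniform_on R S).
Proof.
move=> Tfin [x0 Sx0]; have Sfin : finite_set S by apply: sub_finite_set Tfin.
split.
- by move=> x; rewrite /uniform_on; case: ifP => // _; rewrite invr_ge0 ler0n.
- by move=> x Sx; rewrite /uniform_on ifN // notin_setE.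
rewrite fsbig_finite //= (eq_big_seq (fun=> (#|` fset_set S|)%:R^-1)); last first.
  by move=> x; rewrite in_fset_set // /uniform_on => ->.
rewrite big_const_seq count_predT iter_addr_0 -[_ *+ _]mulr_natl divff //.
rewrite pnatr_eq0 -lt0n cardfs_gt0; apply/fset0Pn; exists x0.
by rewrite in_fset_set // inE.
Qed.

Lemma prob_uniform (T : choiceType) (S : set T) (mu : T -> R) : finite_set [set: T] ->
  is_prob S mu -> (forall x y, S x -> S y -> mu x = mu y) -> mu = uniform_on R S.
Proof.
move=> Tfin [mu0 muS mu1] mucst; have Sfin : finite_set S by apply: sub_finite_set Tfin.
apply/funext => x; rewrite /uniform_on; case: ifPn => [|]; last first.
  by rewrite notin_setE => /muS.
rewrite inE => Sx; move: mu1; rewrite fsbig_finite //= (eq_big_seq (fun=> mu x)); last first.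
  by move=> y; rewrite in_fset_set // inE => Sy; apply: mucst.
rewrite big_const_seq count_predT iter_addr_0; set N := size _ => E.
have N0 : N%:R != 0 :> R.
  rewrite pnatr_eq0; apply/eqP => N0; move: E; rewrite N0 mulr0n => /eqP.
  by rewrite eq_sym oner_eq0.
by apply: (mulfI N0); rewrite mulr_natl E divff.
Qed.

(** All cubes of Y have equally many cubes above them: [t] sends a lift h of d' to the lift of d
    that differs from c as h differs from c', and h is a cube exactly when its image is. *)
Lemma image_uniform_ext l (A : zmodType) (E Y : choiceType) (C : cube_family E)
    (D : cube_family Y) pi (act : A -> E -> E) n :
  finite_set [set: E] -> finite_set [set: Y] -> is_ext l C D pi act -> D n !=set0 ->
  image_prob (fun c => pi \o c) (uniform_on R (C n)) = uniform_on R (D n).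
Proof.
move=> Efin Yfin eE [d0 Dd0].
have Tfin := finite_cube_fun n Efin; have Ufin := finite_cube_fun n Yfin.
apply: prob_uniform => //.
  apply: (image_prob_is_prob (S := C n)) => //; first exact: ext_cube eE n.
  by apply: uniform_on_prob => //; have [c Cc _] := ext_lift eE Dd0; exists c.
move=> d d' Dd Dd'; have [c Cc cd] := ext_lift eE Dd; have [c' Cc' cd'] := ext_lift eE Dd'.
have pcd h : pi \o h = d -> forall v, pi (c v) = pi (h v).
  by move=> hd v; rewrite cd -hd.
have pcd' h : pi \o h = d' -> forall v, pi (c' v) = pi (h v).
  by move=> hd v; rewrite cd' -hd.
pose t (h : dcube n -> E) v := act (dif act (c' v) (h v)) (c v).
rewrite /image_prob [LHS](@reindex_fsbig _ _ _ _ _ t ((fun c0 : dcube n -> E => pi \o c0) @^-1` [set d'])).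
  apply: eq_fsbigr => h; rewrite inE /= => hd'; rewrite /uniform_on.
  have tC : C n (t h) <-> C n h.
    by rewrite /t (ext_act eE _ Cc) (cube_dif eE Cc' (pcd' _ hd')).
  by congr (if _ then _ else _); apply/idP/idP; rewrite !inE => /tC.
split.
- move=> h /= hd'; apply/funext => v; rewrite /= (ext_proj eE); exact: cd.
- move=> h h'; rewrite !inE /= => hd hd' tt; apply/funext => v.
  rewrite -(difK eE (pcd' _ hd v)) -(difK eE (pcd' _ hd' v)); congr (act _ _).
  exact: (ext_inj eE (congr1 (fun f => f v) tt)).
- move=> h /= hd; exists (fun v => act (dif act (c v) (h v)) (c' v)).
    by apply/funext => v; rewrite /= (ext_proj eE) cd'.
  apply/funext => v; rewrite /t (dif_act eE) (difK eE) //; exact: pcd.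
Qed.

Lemma ext_finite l (A : zmodType) (E Y : Type) (C : cube_family E)
    (D : cube_family Y) pi (act : A -> E -> E) :
  is_ext l C D pi act -> finite_set [set: E] -> finite_set [set: Y].
Proof.
move=> eE Efin; apply: (@sub_finite_set _ _ (pi @` [set: E])); last exact: finite_image.
by move=> y _; have [x <-] := ext_surj eE y; exists x.
Qed.

Lemma reduction_uniform p (E F : choiceType) (C : cube_family E) (D : cube_family F) q :
  reduction p C D q -> finite_set [set: E] ->
  [/\ finite_set [set: F], morphism C D q, (forall n, C n !=set0 -> D n !=set0) &
  forall n, C n !=set0 ->
  image_prob (fun c => q \o c) (uniform_on R (C n)) = uniform_on R (D n)].
Proof.
elim=> {E F C D q} [E C Efin|j B E Y Z C D F q act pr _ _ nD eE _ IH Efin].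
  split=> // n [c0 Cc0]; have Tfin := finite_cube_fun n Efin.
  apply/funext => c; rewrite /image_prob (_ : _ @^-1` _ = [set c]) ?fsbig_set1 //.
have Yfin := ext_finite eE Efin.
have [Zfin prm F0 IHu] := IH Yfin.
have D0 n : C n !=set0 -> D n !=set0.
  by case=> c Cc; exists (q \o c); apply: ext_cube eE _ _ Cc.
split=> //.
- by move=> n c Cc; apply: (prm n (q \o c)); apply: ext_cube eE _ _ Cc.
- by move=> n /D0/F0.
move=> n /D0 Dn.
rewrite -(IHu n Dn) -(image_uniform_ext Efin Yfin eE Dn).
by rewrite -image_prob_comp //; apply: finite_cube_fun.
Qed.

End Probability.

(** * Finiteness *)

(** On an infinite discrete space the cofinite filter has no cluster point. *)
Lemma compact_discrete_finite (T : topologicalType) :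
  compact [set: T] -> (forall x : T, open [set x]) -> finite_set [set: T].
Proof.
move=> Tco Tdisc; apply: contrapT => Tinf.
pose F : set_system T := [set S | finite_set (~` S)].
have FF : ProperFilter F.
  apply: Build_ProperFilter_ex => [S FS|].
    apply: contrapT => S0; apply: Tinf; move: FS; rewrite /F /=.
    by rewrite (_ : ~` S = setT) //; apply/seteqP; split=> // x _ Sx; apply: S0; exists x.
  split; first by rewrite /F /= setCT.
    by move=> P Q; rewrite /F /= setCI => fP fQ; rewrite finite_setU.
  by move=> P Q PQ; rewrite /F /= => fP; apply: sub_finite_set fP; apply: subsetC.
have [x [_ cx]] := Tco F FF filterT.
have Fx : F (~` [set x]) by rewrite /F /= setCK; apply: finite_set1.
by have [y []] := cx _ _ Fx (open_nbhs_nbhs (conj (Tdisc x) (erefl x))).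
Qed.

Section TorsionLie.
Context (R : realType) (A : topologicalZmodType).

Lemma mulrn_continuous j : continuous (fun a : A => a *+ j).
Proof.
elim: j => [|j IH] a.
  by rewrite (_ : (fun _ => _) = cst 0); [exact: cvg_cst|apply/funext => b; rewrite mulr0n].
rewrite (_ : (fun _ => _) = fun b : A => b + b *+ j); last by apply/funext => b; rewrite mulrS.
apply: (@continuous2_cvg _ _ _ _ _ _ id (fun b => b *+ j) (fun x y : A => x + y) a (a *+ j)).
- exact: (@tvs.add_continuous A (a, a *+ j)).
- exact: cvg_id.
- exact: IH.
Qed.

(* In a chart at 0, x |-> m x has derivative m at 0; if it vanishes
   identically, the dimension is 0. *)
Lemma torsion_chart_dim0 n (atlas : set (chart R n A)) m : (0 < m)%N ->
  lie_atlas atlas -> (forall a : A, a *+ m = 0) -> forall v : 'rV[R]_n, v = 0.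
Proof.
move=> m0 At Am v; have [h ah dh0] := atlas_cover At 0.
have [odom ocod mapK mapc invc] := atlas_chart At ah.
pose x0 := chart_map h 0.
have cx0 : chart_cod h x0 by exists 0.
have inv0 : chart_inv h x0 = 0 by apply: mapK.
pose f (x : 'rV[R]_n * 'rV[R]_n) := chart_map h (chart_inv h x.1 + chart_inv h x.2).
have df : differentiable f (x0, x0).
  have [+ _] := atlas_add At ah ah ah 1%N; apply.
  by split=> //=; rewrite inv0 addr0.
have fx0 : f (x0, x0) = x0 by rewrite /f /= inv0 addr0.
pose c (w : 'rV[R]_n) (t : R^o) : 'rV[R]_n := x0 + t *: w.
have c0 w : c w 0 = x0 by rewrite /c scale0r addr0.
have dc w : is_diff (0 : R^o) (c w) (fun t => t *: w).
  have -> : (fun t : R^o => t *: w) = 0 + ( *:%R^~ w) by apply/funext => t; rewrite add0r.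
  exact: is_diffD.
have c_cod w : \forall t \near (0 : R^o), chart_cod h (c w t).
  have cc : {for (0 : R^o), continuous (c w)} by apply: differentiable_continuous.
  by apply: cc; apply: open_nbhs_nbhs; split=> //; rewrite c0.
have codE x : chart_cod h x -> chart_map h (chart_inv h x) = x.
  by case=> a da <-; rewrite mapK.
pose L := 'd f (x0, x0).
have dcomp (p dp : R^o -> 'rV[R]_n * 'rV[R]_n) : p 0 = (x0, x0) ->
    is_diff (0 : R^o) p dp -> is_diff (0 : R^o) (f \o p) (L \o dp).
  move=> p0 dp0; apply: is_diff_comp; rewrite p0.
  exact: differentiableP.
have D1 (p dp : R^o -> 'rV[R]_n) : is_diff (0 : R^o) p dp -> 'D_1 p 0 = dp 1.
  by move=> dp0; rewrite deriveE // diff_val.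
(* As 0 is neutral, both partial derivatives of the group law f at (x0, x0) are the identity. *)
have Ll w : L (w, 0) = w.
  have d1 := dcomp (fun t => (c w t, x0)) (fun t => (t *: w, 0)).
  have {}d1 : is_diff (0 : R^o) (f \o (fun t => (c w t, x0))) (L \o (fun t => (t *: w, 0))).
    by apply: d1; rewrite /= ?c0.
  have := D1 _ _ d1; rewrite /= scale1r => <-.
  rewrite (@near_eq_derive _ _ _ _ (c w)) ?(D1 _ _ (dc w)) ?scale1r //.
  near=> t; rewrite /f /= inv0 addr0 codE //; near: t; exact: c_cod.
have Lr w : L (0, w) = w.
  have d1 := dcomp (fun t => (x0, c w t)) (fun t => (0, t *: w)).
  have {}d1 : is_diff (0 : R^o) (f \o (fun t => (x0, c w t))) (L \o (fun t => (0, t *: w))).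
    by apply: d1; rewrite /= ?c0.
  have := D1 _ _ d1; rewrite /= scale1r => <-.
  rewrite (@near_eq_derive _ _ _ _ (c w)) ?(D1 _ _ (dc w)) ?scale1r //.
  near=> t; rewrite /f /= inv0 add0r codE //; near: t; exact: c_cod.
(* [k j] is the j-fold multiple of the curve [c v], read in the chart. Being built by iterating f,
   it has derivative j v at 0 by the chain rule. *)
pose fix k j : R^o -> 'rV[R]_n :=
  if j is j'.+1 then fun t => f (c v t, k j' t) else fun=> x0.
have k0 j : k j 0 = x0 by elim: j => //= j ->; rewrite c0.
have dk j : is_diff (0 : R^o) (k j) (fun t => t *: (v *+ j)).
  elim: j => [|j IH] /=.
    have -> : (fun t : R^o => t *: (v *+ 0)) = 0 by apply/funext => t; rewrite mulr0n scaler0.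
    exact: is_diff_cst.
  have -> : (fun t : R^o => t *: (v *+ j.+1)) = L \o (fun t => (t *: v, t *: (v *+ j))).
    apply/funext => t /=; have -> : (t *: v, t *: (v *+ j)) = (t *: v, 0) + (0, t *: (v *+ j)).
      by congr (_, _); rewrite /= ?addr0 ?add0r.
    by rewrite linearD Ll Lr mulrS scalerDr.
  by apply: (dcomp (fun t => (c v t, k j t))); rewrite c0 k0.
have invc0 : {for (0 : R^o), continuous (chart_inv h \o c v)}.
  apply: continuous_comp; first exact: differentiable_continuous.
  by rewrite c0; apply: invc.
have domj j : \forall t \near (0 : R^o), chart_dom h (chart_inv h (c v t) *+ j).
  have cc : {for (0 : R^o), continuous ((fun a => a *+ j) \o (chart_inv h \o c v))}.
    by apply: continuous_comp => //; apply: mulrn_continuous.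
  apply: cc; apply: open_nbhs_nbhs; split=> //=.
  by rewrite c0 inv0 mul0rn.
have kE j : \forall t \near (0 : R^o), k j t = chart_map h (chart_inv h (c v t) *+ j).
  elim: j => [|j IH] /=; first by near=> t; rewrite mulr0n.
  near=> t; rewrite (near IH t) // /f /= mapK ?mulrS //.
  by near: t; apply: domj.
have : 'D_1 (k m) 0 = 0.
  rewrite (@near_eq_derive _ _ _ _ (cst x0)) ?derive_cst //.
  by near=> t; rewrite (near (kE m) t) // Am.
rewrite (D1 _ _ (dk m)) scale1r -scaler_nat => /eqP.
by rewrite scaler_eq0 pnatr_eq0 -leqn0 leqNgt m0 => /eqP.
Unshelve. all: by end_near. Qed.

(** In dimension 0 the domain of a chart at 0 is a single point, so A is discrete. *)
Lemma torsion_lie_finite m : (0 < m)%N -> compact_abelian_lie R A ->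
  (forall a : A, a *+ m = 0) -> finite_set [set: A].
Proof.
move=> m0 [Aco _ [n [atlas At]]] Am; have V0 := torsion_chart_dim0 m0 At Am.
have [h ah dh0] := atlas_cover At 0.
have [odom _ mapK _ _] := atlas_chart At ah.
have dom0 : chart_dom h = [set 0].
  apply/seteqP; split=> [a da|_ -> //] /=.
  by rewrite -(mapK a da) -(mapK 0 dh0) (V0 (chart_map h a)) (V0 (chart_map h 0)).
apply: compact_discrete_finite => // a.
have -> : [set a] = (fun x => x - a) @^-1` chart_dom h.
  rewrite dom0; apply/seteqP; split=> x /=; first by move->; rewrite subrr.
  by move/eqP; rewrite subr_eq0 => /eqP.
apply: open_comp => // x _.
apply: (@continuous2_cvg _ _ _ _ _ _ id (fun=> a) (fun x y : A => x - y) x a).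
- exact: (@tvs.sub_continuous A (x, a)).
- exact: cvg_id.
- exact: cvg_cst.
Qed.

End TorsionLie.

Lemma fin_zmod (A : zmodType) (s : seq A) : uniq s -> (forall x, x \in s) ->
  exists B : finZmodType, B = A :> zmodType.
Proof.
move=> us sA.
have ax : Finite.axiom (s : seq A) by move=> x; rewrite count_uniq_mem // sA.
have pk : pcancel (fun x : A => index x s) (fun n => ohead (drop n s)).
  by move=> x; rewrite (drop_nth 0) ?index_mem //= nth_index.
pose mc := isCountable.Build A pk.
pose mx := fintype.isFinite.Build A ax.
pose B : finZmodType := HB.pack A mc mx.
exists B; move: @mc @mx @B.
(* Once A is opened into its mixins, B and A agree by computation. *)
case: A s us sA ax pk => T [m0 m1 m2 m3 m4 m5 m6 m7 m8] s us sA ax pk mc mx B.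
reflexivity.
Qed.

(* act1 a translates by an element of A2 which could depend on x; comparing two
   opposite vertices of an edge shows that it does not. *)
Lemma structure_embed l (A1 A2 : zmodType) (E Y : Type) (C : cube_family E)
    (D : cube_family Y) (pi : E -> Y) (act1 : A1 -> E -> E) (act2 : A2 -> E -> E) :
  is_nilspace C -> is_ext l C D pi act1 -> is_ext l C D pi act2 ->
  exists g, forall a x, act1 a x = act2 (g a) x.
Proof.
move=> nC e1 e2; have [x0 _] := nilspace_nonempty nC.
have act1E a x : act1 a x = act2 (dif act2 x (act1 a x)) x.
  by rewrite (difK e2) // (ext_proj e1).
exists (fun a => dif act2 x0 (act1 a x0)) => a x; rewrite [LHS]act1E; congr (act2 _ x).
pose c (v : dcube l.+1) := if v ord0 then x0 else x.
pose f (v : dcube l.+1) := if drop_coord ord0 v == cube0 l then a else 0.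
have Cc : C l.+1 c.
  have C1 : C 1%N (fun v => if v ord0 then x0 else x) by rewrite nilspace_ergodic1.
  have tt : cube_morphism (fun v : dcube l.+1 => [ffun _ => v ord0] : dcube 1).
    by apply: (cube_morphismI (o := fun=> Some ord0) (b := fun=> false)) => v i; rewrite ffunE addbF.
  by move: (ext_compose e1 tt C1) => /eq_cube; apply=> v; rewrite /= ffunE.
have Df : Dcubes l A1 l.+1 f.
  apply: (@Dcubes_support _ _ _ (~: [set ord0])%SET); first by rewrite cardsC1 card_ord.
  move=> v w vw; rewrite /f (_ : drop_coord ord0 v = drop_coord ord0 w) //.
  by apply/ffunP => i; rewrite !ffunE vw // !inE eq_sym neq_lift.
have /(cube_alt e2 Cc) : C l.+1 (fun v => act1 (f v) (c v)) by apply/(ext_act e1).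
move=> /(_ (fun v => esym (ext_proj e1 _ _))); rewrite (alt_face ord0) => /eqP.
have alt1 y : alt (fun v : dcube l => dif act2 y (act1 (if v == cube0 l then a else 0) y)) =
    dif act2 y (act1 a y) *~ (-1) ^+ weight (cube0 l).
  rewrite -alt_delta; apply: eq_alt => v; case: eqP => // _.
  by rewrite (ext_act0 e1) -[X in dif _ _ X](ext_act0 e2) (dif_act e2).
rewrite (eq_alt (g := fun v => dif act2 x (act1 (if v == cube0 l then a else 0) x))) => [|v]; last first.
  by rewrite /= /f /c face_id drop_face.
rewrite alt1 (eq_alt (g := fun v => dif act2 x0 (act1 (if v == cube0 l then a else 0) x0))) => [|v]; last first.
  by rewrite /= /f /c face_id drop_face.
rewrite alt1 -mulrzBl mulrz_sign_eq0 subr_eq0 => /eqP; exact.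
Qed.

(** [finite_rank] and [torsion_nilspace] each provide a structure group of their own: torsion has to
    be carried over to the Lie group, and finiteness back. *)
Lemma structure_torsion l (A1 A2 : zmodType) (E Y : Type) (C : cube_family E)
    (D : cube_family Y) (pi : E -> Y) (act1 : A1 -> E -> E) (act2 : A2 -> E -> E) m :
  is_nilspace C -> is_ext l C D pi act1 -> is_ext l C D pi act2 ->
  (forall a : A2, a *+ m = 0) -> forall a : A1, a *+ m = 0.
Proof.
move=> nC e1 e2 A2m a; have [x0 _] := nilspace_nonempty nC.
have [g gE] := structure_embed nC e1 e2.
apply: (ext_free e1 (x := x0)).
have -> : act1 (a *+ m) x0 = act2 (g a *+ m) x0.
  elim: m {A2m} => [|m IH]; first by rewrite !mulr0n (ext_act0 e1) (ext_act0 e2).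
  by rewrite !mulrS (ext_actD e1) (ext_actD e2) IH gE.
by rewrite A2m (ext_act0 e2).
Qed.

Lemma structure_finite l (A1 A2 : zmodType) (E Y : Type) (C : cube_family E)
    (D : cube_family Y) (pi : E -> Y) (act1 : A1 -> E -> E) (act2 : A2 -> E -> E) :
  is_nilspace C -> is_ext l C D pi act1 -> is_ext l C D pi act2 ->
  finite_set [set: A2] -> finite_set [set: A1].
Proof.
move=> nC e1 e2 A2fin; have [x0 _] := nilspace_nonempty nC.
have [g gE] := structure_embed nC e1 e2; have [g' g'E] := structure_embed nC e2 e1.
apply: (@sub_finite_set _ _ (g' @` [set: A2])); last exact: finite_image.
move=> a _; exists (g a) => //.
by apply: (ext_inj e1 (x := x0)); rewrite -g'E -gE.
Qed.

Lemma ext_finite_total l (A : zmodType) (E Y : Type) (C : cube_family E)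
    (D : cube_family Y) pi (act : A -> E -> E) :
  is_ext l C D pi act -> finite_set [set: A] -> finite_set [set: Y] ->
  finite_set [set: E].
Proof.
move=> eE Afin Yfin; pose s y := projT1 (cid (ext_surj eE y)).
have sK y : pi (s y) = y by rewrite /s; case: cid.
apply: (@sub_finite_set _ _ ((fun z : A * Y => act z.1 (s z.2)) @` ([set: A] `*` [set: Y]))).
  move=> x _; have [a ax] := ext_trans eE (sK (pi x)).
  by exists (a, pi x).
exact/finite_image/finite_setX.
Qed.

Lemma finite_zmod (A : zmodType) : finite_set [set: A] ->
  exists B : finZmodType, B = A :> zmodType.
Proof.
move=> Afin; apply: (@fin_zmod A (fset_set [set: A])); first exact: fset_uniq.
by move=> x; rewrite in_fset_set // in_setT.
Qed.

Lemma torsion_nilspace_finite (R : realType) k m (X : compact_nilspace) :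
  (0 < m)%N -> cfr_nilspace R k X -> torsion_nilspace k m (cn_cubes X) ->
  finite_set [set: X] /\ tower (fin_torsion m) k (@factor_cubes X (cn_cubes X) k).
Proof.
move=> m0 [st fr] tor; have nX := cn_axioms X.
have sg i : (1 <= i <= k)%N -> exists (A : zmodType)
    (act : A -> Defs.factor (cn_cubes X) i -> Defs.factor (cn_cubes X) i),
    is_structure_group act /\ fin_torsion m A.
  case: i => // i ik; have [A [act [sgA _ lieA]]] := fr _ ik.
  have [B [actB [sgB Bm]]] := tor _ ik.
  have eA := structure_ext nX sgA; have eB := structure_ext nX sgB.
  exists B, actB; split=> //; split=> //; apply: finite_zmod.
  have nXi : is_nilspace (@factor_cubes X (cn_cubes X) i.+1).
    apply: (tower_nilspace (P := fun _ => True) (k := i.+1)).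
    apply: (factor_tower nX (k := i.+1)) => // j /andP[j1 ji].
    have [|A' [act' [sgA' _]]] := tor j; last by exists A', act'.
    by rewrite j1 (leq_trans ji (andP ik).2).
  apply: (structure_finite nXi eB eA).
  apply: (torsion_lie_finite m0 lieA); exact: structure_torsion nXi eA eB Bm.
have tw := factor_tower nX sg; split; last exact: tw.
have facfin i : (i <= k)%N -> finite_set [set: Defs.factor (cn_cubes X) i].
  elim: i => [_|i IH ik].
    have [x _] := nilspace_nonempty nX.
    apply: (@sub_finite_set _ _ [set factor_pi (cn_cubes X) 0 x]); last exact: finite_set1.
    by move=> u _; apply: factor0_eq.
  have [A [act [sgA [[B BA] _]]]] := sg i.+1 ik; subst A.
  apply: (ext_finite_total (structure_ext nX sgA)) (IH (ltnW ik)).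
  exact: finite_finset.
have eX := factor_pi_ext nX st.
apply: (ext_finite_total eX) (facfin k (leqnn k)); exact: finite_finset.
Qed.

(** * Finite nilspaces as compact nilspaces *)

Lemma discrete_basis (T : discreteTopologicalType) : finite_set [set: T] ->
  @second_countable T.
Proof.
move=> Tfin; exists (range (fun x : T => [set x])).
  by apply: finite_set_countable; apply: finite_image.
split=> [A _|x A]; first exact: discrete_open.
move=> /nbhs_singleton Ax; exists [set x]; first by split=> //; exists x.
by move=> y ->.
Qed.

Lemma discrete_cubes_closed (T : choiceType) n (S : set (dcube n -> T)) :
  finite_set [set: T] ->
  closed (S : set {ptws dcube n -> discrete_topology T}).
Proof.
move=> Tfin; have H : hausdorff_space {ptws dcube n -> discrete_topology T}.
  by apply: hausdorff_product => _; apply: discrete_hausdorff.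
apply: (accessible_finite_set_closed.1 (hausdorff_accessible H)).
by apply: sub_finite_set (finite_cube_fun n Tfin).
Qed.

Definition discrete_nilspace (T : choiceType) (C : cube_family T)
    (nC : is_nilspace C) (Tfin : finite_set [set: T]) : compact_nilspace :=
  @CompactNilspace (discrete_topology T) C nC
    (@finite_compact (discrete_topology T) setT Tfin)
    (@discrete_hausdorff (discrete_topology T))
    (@discrete_basis (discrete_topology T) Tfin)
    (fun n => @discrete_cubes_closed T n (C n) Tfin).

Definition discrete_group (A : zmodType) : Type := discrete_topology A.

HB.instance Definition _ (A : zmodType) := GRing.Zmodule.copy (discrete_group A) A.
HB.instance Definition _ (A : zmodType) :=
  DiscreteTopology.copy (discrete_group A) (discrete_topology A).

Lemma discrete_prod_continuous (T U V : topologicalType) (f : T * U -> V) :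
  (forall x : T, nbhs x [set x]) -> (forall y : U, nbhs y [set y]) -> continuous f.
Proof.
move=> Td Ud [x y] S fS; exists ([set x], [set y]); first by split.
by move=> [x' y'] /= [-> ->]; apply: nbhs_singleton.
Qed.

Lemma discrete_add_continuous (A : zmodType) :
  continuous (fun x : discrete_group A * discrete_group A => x.1 + x.2).
Proof. by apply: discrete_prod_continuous; apply: discrete_set1. Qed.

Lemma discrete_opp_continuous (A : zmodType) :
  continuous (-%R : discrete_group A -> discrete_group A).
Proof.
move=> x S xS; apply: (filterS _ (discrete_set1 x)) => y ->.
exact: nbhs_singleton xS.
Qed.

HB.instance Definition _ (A : zmodType) :=
  PreTopologicalNmodule_isTopologicalNmodule.Build (discrete_group A)
    (@discrete_add_continuous A).
HB.instance Definition _ (A : zmodType) :=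
  TopologicalNmodule_isTopologicalZmodule.Build (discrete_group A)
    (@discrete_opp_continuous A).

Lemma smooth_cst (R : realType) (V W : normedModType R) (U : set V) (w : W) :
  smooth_on U (fun=> w).
Proof.
move=> r; elim: r w => [|r IH] w; first by move=> x _; apply: cvg_cst.
split=> [x _|v]; first exact: differentiable_cst.
rewrite (_ : 'D_v _ = fun=> 0); first exact: IH.
by apply/funext => x; apply: derive_cst.
Qed.

Lemma discrete_lie (R : realType) (A : zmodType) : finite_set [set: A] ->
  compact_abelian_lie R (discrete_group A).
Proof.
move=> Afin; split; [exact: finite_compact|exact: discrete_hausdorff|].
pose h (a : discrete_group A) : chart R 0 (discrete_group A) :=
  Chart [set a] (fun=> 0) (fun=> a).
exists 0%N, (range h); split.
- move=> _ [a _ <-]; split=> /=.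
  + exact: discrete_open.
  + rewrite (_ : chart_cod _ = setT); first exact: openT.
    by apply/seteqP; split=> // x _; exists a => //; apply/rowP => -[].
  + by move=> b ->.
  + by move=> b _; apply: cvg_cst.
  + by move=> x _; exact: (@cst_continuous _ (discrete_group A) a x).
- by move=> a; exists (h a).
- by move=> _ _ [a _ <-] [b _ <-]; apply: smooth_cst.
- by move=> _ _ _ [a _ <-] [b _ <-] [c _ <-]; apply: smooth_cst.
- by move=> _ _ [a _ <-] [b _ <-]; apply: smooth_cst.
Qed.

Lemma discrete_cfr (R : realType) p k (T : choiceType) (C : cube_family T)
    (nC : is_nilspace C) (Tfin : finite_set [set: T]) : tower (fin_pgroup p) k C ->
  cfr_nilspace R k (discrete_nilspace nC Tfin) /\
  p_nilspace k p (cn_cubes (discrete_nilspace nC Tfin)).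
Proof.
move=> tC; split; [split|].
- exact: completion_unique_step (tower_unique tC).
- move=> i ik Xi; have [A [act [sg [[B BA] _]]]] := tower_structure tC ik; subst A.
  exists (discrete_group B), act; split=> //.
    apply: discrete_prod_continuous => [x|y]; first exact: discrete_set1.
    apply: open_nbhs_nbhs; split=> //.
    exact: (@discrete_open (discrete_topology T)).
  by apply: discrete_lie; apply: finite_finset.
move=> i ik; have [A [act [sg [_ [r Ar]]]]] := tower_structure tC ik.
by exists A, act; split=> // a; exists r.
Qed.

(** * Primary components, balance and correlation *)

Lemma Dcubes_additive (A B : zmodType) (g : {additive A -> B}) l n (c : dcube n -> A) :
  Dcubes l A n c -> Dcubes l B n (g \o c).
Proof.
move=> Dc t tt; rewrite -[RHS](raddf0 g) -(Dc t tt) raddf_sum.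
by apply: eq_bigr => v _; rewrite raddfMz.
Qed.

Lemma Dcubes_additive_inj (A B : zmodType) (g : {additive A -> B}) l n (c : dcube n -> A) :
  injective g -> Dcubes l B n (g \o c) -> Dcubes l A n c.
Proof.
move=> gI Dc t tt; apply: gI; rewrite raddf0 -[RHS](Dc t tt) raddf_sum.
by apply: eq_bigr => v _; rewrite raddfMz.
Qed.

Section Primary.
Context (Z : finZmodType) (comp : forall p : nat, Z -> primary Z p).
Hypothesis compP : primary_decomposition comp.

Lemma primary_torsion q (x : primary Z q) : exists j, val x *+ q ^ j = 0.
Proof. by case: x => z zq; have /asboolP := zq. Qed.

Lemma primary_cofactor p : (p ^ logn p #|Z| * partn #|Z| (negn p))%N = #|Z|.
Proof. by rewrite -p_part partnC //; apply/card_gt0P; exists 0. Qed.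

Lemma primary_cofactor_coprime p : prime p -> coprime (partn #|Z| (negn p)) p.
Proof. by move=> pp; rewrite coprime_sym prime_coprime // -p'natE // part_pnat. Qed.

(** For q <> p, the multiple of z_q by the p'-part of #|Z| is killed by a power of q and by the
    p-part of #|Z|, hence is 0. *)
Lemma comp_torsion p z : p \in primes #|Z| ->
  (z - val (comp p z)) *+ partn #|Z| (negn p) = 0.
Proof.
move=> pZ; have pp : prime p by move: pZ; rewrite mem_primes => /andP[].
have -> : z - val (comp p z) = \sum_(q <- primes #|Z| | q != p) val (comp q z).
  by rewrite {1}(compP z) (bigD1_seq p) ?primes_uniq //= addrAC subrr add0r.
rewrite -sumrMnl big_seq_cond big1 // => q /andP[qZ qp].
have qq : prime q by move: qZ; rewrite mem_primes => /andP[].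
have [j xj] := primary_torsion (comp q z).
apply: (@mulrn_coprime_eq0 _ (q ^ j) (p ^ logn p #|Z|)).
- by rewrite expn_gt0 prime_gt0.
- by rewrite coprimeXl // coprimeXr // prime_coprime // dvdn_prime2.
- by rewrite mulrnAC xj mul0rn.
by rewrite -mulrnA mulnC primary_cofactor mulrn_card.
Qed.

Lemma primary_eq0 p (x : primary Z p) : prime p ->
  val x *+ partn #|Z| (negn p) = 0 -> x = 0.
Proof.
move=> pp xN; apply: val_inj; rewrite raddf0; have [j xj] := primary_torsion x.
apply: (mulrn_coprime_eq0 (part_gt0 _ _) _ xN xj).
by rewrite coprimeXr // primary_cofactor_coprime.
Qed.

Lemma comp_val p (x : primary Z p) : p \in primes #|Z| -> comp p (val x) = x.
Proof.
move=> pZ; have pp : prime p by move: pZ; rewrite mem_primes => /andP[].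
apply/eqP; rewrite eq_sym -subr_eq0; apply/eqP/(primary_eq0 pp).
by rewrite raddfB comp_torsion.
Qed.

(** Additivity of [comp p] is not assumed. It follows, like the other axioms, because the p'-part of
    #|Z| kills z - z_p and acts injectively on Z_p. In the form of an extension, [comp p] preserves
    uniform measures on cubes. *)
Lemma primary_ext p : p \in primes #|Z| ->
  is_ext 1 (Dcubes 1 Z) (Dcubes 1 (primary Z p)) (comp p)
    (fun (a : torsion_part Z (partn #|Z| (negn p))) z => val a + z).
Proof.
move=> pZ; have pp : prime p by move: pZ; rewrite mem_primes => /andP[].
split.
- exact: Dcubes_compose.
- by move=> x; rewrite raddf0 add0r.
- by move=> a b x; rewrite raddfD addrA.
- move=> a x; apply/eqP; rewrite -subr_eq0; apply/eqP/(primary_eq0 pp).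
  rewrite raddfB.
  have -> : val (comp p (val a + x)) - val (comp p x) =
      val a + (x - val (comp p x)) - (val a + x - val (comp p (val a + x))).
    by rewrite addrA opprB [RHS]addrC subrKA.
  by rewrite mulrnBl mulrnDl torsion_valMn !comp_torsion // addr0 subr0.
- move=> x y xy; have h : y - x \in torsion_pred (partn #|Z| (negn p)).
    apply/eqP; have -> : y - x = (y - val (comp p y)) - (x - val (comp p x)).
      by rewrite xy opprB subrKA.
    by rewrite mulrnBl !comp_torsion // subr0.
  by exists (TorsionPart h); rewrite subrK.
- move=> a x ax; apply: val_inj; rewrite raddf0; apply: (addIr x).
  by rewrite add0r.
- by move=> y; exists (val y); rewrite comp_val.
- move=> n c Dc t tt; apply: (primary_eq0 pp).
  rewrite raddf_sum (eq_bigr (fun v => val (comp p (c (t v))) *~ (-1) ^+ weight v)) => [|v _]; last by rewrite raddfMz.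
  change (alt (fun v => val (comp p (c (t v)))) *+ partn #|Z| (negn p) = 0).
  rewrite (eq_alt (g := fun v => c (t v) - (c (t v) - val (comp p (c (t v)))))) => [|v]; last by rewrite subKr.
  rewrite altB mulrnBl [alt _](Dc t tt) mul0rn sub0r -altMn.
  rewrite (eq_alt (g := fun=> 0)) => [|v]; last exact: comp_torsion.
  by rewrite (@alt_indep _ _ ord0 (fun=> 0)) // oppr0.
- move=> n d Dd; exists (val \o d); first exact: (Dcubes_additive val).
  by move=> v; rewrite /= comp_val.
move=> n c f Dc; split=> [Dcf|Df].
  apply: (Dcubes_additive_inj (g := val)); first exact: val_inj.
  move: (DcubesB Dcf Dc) => /eq_cube; apply=> v.
  by rewrite /= addrK.
apply: DcubesD => //; exact: (Dcubes_additive val).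
Qed.

End Primary.

(** The one-point nilspace is k-step for every k, with trivial structure groups; it becomes X_p when
    p does not divide m. *)
Lemma pt_tower p k : tower (fin_pgroup p) k (fun n (c : dcube n -> unit) => True).
Proof.
elim: k => [|k IH]; first by apply: Tower0 => //; [exists tt|move=> [] []].
apply: (TowerS (A := 'I_1) (pi := id) (act := fun _ x => x) IH).
  by split; [exists 'I_1|exists 0%N => a; rewrite (ord1 (a *+ _)) (ord1 0)].
split=> //.
- by move=> [] [] _; exists 0.
- by move=> a x _; rewrite (ord1 a).
- by move=> y; exists y.
- by move=> n d _; exists d.
move=> n c f _; split=> // _.
by rewrite (_ : f = fun=> 0); [exact: Dcubes0|apply/funext => v; rewrite (ord1 (f v))].
Qed.

Definition pt_nilspace : compact_nilspace :=
  discrete_nilspace (tower_nilspace (pt_tower 0 0)) finite_finset.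

Section Balance.
Context (R : realType) (d : cube_metrics R).
Arguments d : clear implicits.
Hypothesis hd : balance_metrics d.

Lemma nilspace_cube_nonempty (X : nilspace) n : ns_cubes X n !=set0.
Proof.
by have [x _] := nilspace_nonempty (ns_axioms X); exists (fun=> x); exact: cst_cube (ns_axioms X) n x.
Qed.

(** Push-forward along q is continuous for pointwise convergence, which both metrics induce. *)
Lemma balance_modulus (X Y : nilspace) (q : X -> Y) n b :
  finite_set [set: X] -> finite_set [set: Y] -> morphism (ns_cubes X) (ns_cubes Y) q ->
  image_prob (fun c => q \o c) (uniform_on R (ns_cubes X n)) = uniform_on R (ns_cubes Y n) ->
  0 < b ->
  exists2 e, 0 < e & forall mu, is_prob (ns_cubes X n) mu ->
    d X n mu (uniform_on R (ns_cubes X n)) <= e ->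
    d Y n (image_prob (fun c => q \o c) mu) (uniform_on R (ns_cubes Y n)) <= b.
Proof.
move=> Xfin Yfin qm qu b0.
have Tfin := finite_cube_fun n Xfin; have Ufin := finite_cube_fun n Yfin.
have mX := balance_metric hd n Xfin; have mY := balance_metric hd n Yfin.
have uX := uniform_on_prob R Tfin (nilspace_cube_nonempty X n).
have uY := uniform_on_prob R Ufin (nilspace_cube_nonempty Y n).
have [e1 e10 H1] := prob_metric_weaker mY uY b0.
(* A mass of the image is a sum of fewer than K masses, so moving each of these by at most e1 / K
   moves it by less than e1. *)
pose K := (size (fset_set [set: dcube n -> X])).+1.
have e20 : 0 < e1 / K%:R by rewrite divr_gt0 // ltr0n.
have [e3 e30 H3] := prob_metric_finer mX uX e20.
(* Balance is a weak inequality, while [prob_metric_finer] needs a strict one. *)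
exists (e3 / 2); first by rewrite divr_gt0.
move=> mu pmu dmu.
have pmu' : is_prob (ns_cubes Y n) (image_prob (fun c => q \o c) mu).
  by apply: image_prob_is_prob pmu => // c; apply: qm.
rewrite (prob_metric_sym mY) //; apply/ltW/H1 => // y.
have H := H3 mu pmu; rewrite (prob_metric_sym mX) // in H.
have e3h : e3 / 2 < e3 by lra.
have {}H := H (le_lt_trans dmu e3h).
rewrite -qu /image_prob !fsum_finite // -sumrB.
apply: le_lt_trans (ler_norm_sum _ _ _) _.
apply: (@le_lt_trans _ _ (\sum_(x <- fset_set [set: dcube n -> X]) (e1 / K%:R))).
  apply: ler_sum => c _; case: ifP => _; last by rewrite subrr normr0 ltW.
  by rewrite distrC ltW // distrC.
rewrite big_const_seq count_predT iter_addr_0 -[_ *+ _]mulr_natr mulrAC.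
by rewrite ltr_pdivrMr ?ltr0n // ltr_pM2l // ltr_nat.
Qed.

Lemma balanced_pt (X : nilspace) n b mu : (forall x y : X, x = y) ->
  0 < b -> finite_set [set: X] -> is_prob (ns_cubes X n) mu ->
  d X n mu (uniform_on R (ns_cubes X n)) <= b.
Proof.
move=> Xeq b0 Xfin pmu; have Tfin := finite_cube_fun n Xfin.
have -> : mu = uniform_on R (ns_cubes X n).
  apply: prob_uniform => // c c' _ _; congr mu; apply/funext => v; exact: Xeq.
have pu := uniform_on_prob R Tfin (nilspace_cube_nonempty X n).
by rewrite ((prob_metric_eq0 (balance_metric hd n Xfin) pu pu).2 erefl) ltW.
Qed.

End Balance.

Lemma exists_lower_bound (R : realType) (T : eqType) (s : seq T) (F : T -> R) (b : R) :
  0 < b -> (forall x, x \in s -> 0 < F x) ->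
  exists e, [/\ 0 < e, e <= b & forall x, x \in s -> e <= F x].
Proof.
move=> b0; elim: s => [|x s IH] F0; first by exists b.
have [e [e0 eb eF]] := IH (fun y ys => F0 y (mem_behead (s := x :: s) ys)).
exists (Num.min e (F x)); split.
- by rewrite lt_min e0 F0 // mem_head.
- by rewrite ge_min eb.
move=> y; rewrite inE => /orP[/eqP->|ys]; first by rewrite ge_min lexx orbT.
by rewrite ge_min eF.
Qed.

(** Decompose F over the points of X. The successor in the denominator gives the contradiction: #|X|
    terms below delta / (#|X| + 1) cannot add up to delta. *)
Lemma average_pigeonhole (R : realType) (Z : finZmodType) (X : choiceType)
    (f : Z -> R[i]) (g : Z -> X) (F : X -> R[i]) (delta : R) :
  finite_set [set: X] -> 0 < delta -> (forall x, `|F x| <= 1) ->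
  (delta%:C)%C <= `|average (fun z => f z * F (g z))| ->
  exists x, ((delta / (size (fset_set [set: X])).+1%:R)%:C)%C <=
    `|average (fun z => f z * (g z == x)%:R)|.
Proof.
move=> Xfin d0 F1 dle; apply: contrapT => H.
set S := fset_set [set: X] in H; set e := delta / _ in H.
have small x : `|average (fun z => f z * (g z == x)%:R)| < (e%:C)%C.
  rewrite real_ltNge ?normr_real //; last by apply/complex_realP; exists e.
  by apply/negP => xe; apply: H; exists x.
have avE : average (fun z => f z * F (g z)) =
    \sum_(x <- S) F x * average (fun z => f z * (g z == x)%:R).
  rewrite /average; under [RHS]eq_bigr => x _ do rewrite mulrCA mulr_sumr.
  rewrite -mulr_sumr exchange_big /=; congr (_ * _); apply: eq_bigr => z _.
  rewrite (bigD1_seq (g z)) ?fset_uniq ?in_fset_set ?in_setT //= eqxx mulr1 mulrC.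
  by rewrite big1 ?addr0 // => x /negPf; rewrite eq_sym => ->; rewrite !mulr0.
have : (delta%:C)%C <= \sum_(x <- S) (e%:C)%C.
  apply: le_trans dle _; rewrite avE; apply: le_trans (ler_norm_sum _ _ _) _.
  apply: ler_sum => x _; rewrite normrM -[leRHS]mul1r; apply: ler_pM => //.
  exact: ltW.
rewrite big_const_seq count_predT iter_addr_0 -raddfMn lecR.
rewrite -mulr_natr /e mulrAC ler_pdivlMr ?ltr0n // ler_pM2l // ler_nat.
by rewrite ltnn.
Qed.

Lemma prod_indicator (R : pzSemiRingType) (T : Type) (s : seq T) (b : T -> bool) :
  \prod_(x <- s) (b x)%:R = (all b s)%:R :> R.
Proof.
elim: s => [|x s IH] /=; first by rewrite big_nil.
by rewrite big_cons IH -natrM mulnb.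
Qed.

(** Gives all one-point finite-rank nilspaces the same complexity. *)
Lemma single_point_isomorphic (X Y : compact_nilspace) :
  (forall x y : X, x = y) -> (forall x y : Y, x = y) -> cn_isomorphic X Y.
Proof.
move=> Xeq Yeq; have [x _] := nilspace_nonempty (cn_axioms X).
have [y _] := nilspace_nonempty (cn_axioms Y).
exists (fun=> y), (fun=> x); split=> //.
- by move=> n c _; apply: (cst_cube (cn_axioms Y) n y).
- by move=> n c _; apply: (cst_cube (cn_axioms X) n x).
by split=> z; apply: cvg_cst.
Qed.

(** As an extension by the trivial group, an isomorphism falls under the transport of uniform
    measures. *)
Lemma isomorphism_ext (X Y : nilspace) (f : X -> Y) : ns_isomorphism f ->
  is_ext 1 (ns_cubes X) (ns_cubes Y) f (fun (_ : 'I_1) x => x).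
Proof.
case=> fm [g [fK gK gm]]; split=> //.
- exact: (@nilspace_composition _ _ (ns_axioms X)).
- by move=> x y /(can_inj fK)->; exists 0.
- by move=> a x _; rewrite (ord1 a).
- by move=> y; exists (g y).
- by move=> n c Dc; exists (g \o c); [exact: gm|move=> v; rewrite /= gK].
move=> n c h Cc; split=> // _.
by rewrite (_ : h = fun=> 0); [exact: Dcubes0|apply/funext => v; rewrite (ord1 (h v))].
Qed.

(** * The p-factors of a torsion nilspace and the bounds for an isomorphism class *)

Record primary_factor (R : realType) (k p : nat) (X Y : compact_nilspace)
    (q : X -> Y) : Prop := PrimaryFactor {
  factor_cfr : cfr_nilspace R k Y;
  factor_p_nilspace : p_nilspace k p (cn_cubes Y);
  factor_finite : finite_set [set: Y];
  factor_morphism : morphism (cn_cubes X) (cn_cubes Y) q;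
  factor_uniform : forall n, image_prob (fun c => q \o c)
    (uniform_on R (cn_cubes X n)) = uniform_on R (cn_cubes Y n);
  factor_cst : forall (Z : zmodType) (N : nat) (g : Z -> Y), (0 < N)%N ->
    coprime N p -> morphism (Dcubes 1 Z) (cn_cubes Y) g ->
    forall x w, w *+ N = 0 -> g (x + w) = g x }.

Lemma primary_factors (R : realType) k m (X : compact_nilspace) : (0 < m)%N ->
  cfr_nilspace R k X -> torsion_nilspace k m (cn_cubes X) ->
  exists (Xp : nat -> compact_nilspace) (q : forall p, X -> Xp p),
    [/\ forall p, prime p -> primary_factor R k p (q p),
        forall p, p \notin primes m -> forall x y : Xp p, x = y &
        forall x y, (forall p, p \in primes m -> q p x = q p y) -> x = y].
Proof.
move=> m0 Xcfr Xtor; have nX := cn_axioms X; have st := Xcfr.1.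
have [Xfin tX] := torsion_nilspace_finite m0 Xcfr Xtor.
have eX := factor_pi_ext nX st.
have [Rel [RelI Relq]] := tower_split m0 tX.
have Xne n : cn_cubes X n !=set0.
  by have [x _] := nilspace_nonempty nX; exists (fun=> x); exact: cst_cube nX n x.
have Xpi : forall p, exists Xq : {Y : compact_nilspace & X -> Y},
    [/\ prime p -> primary_factor R k p (projT2 Xq),
        p \notin primes m -> forall x y : projT1 Xq, x = y &
        p \in primes m -> forall x y, projT2 Xq x = projT2 Xq y ->
          Rel p (factor_pi (cn_cubes X) k x) (factor_pi (cn_cubes X) k y)].
  move=> p; have [pm|pm] := boolP (p \in primes m); last first.
    exists (existT (fun Y : compact_nilspace => X -> Y) pt_nilspace (fun=> tt)); split=> // [pp /=|_ [] []//].
    have [cfr pnil] := discrete_cfr R (tower_nilspace (pt_tower 0 0)) finite_finset (pt_tower p k).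
    split=> //.
    + exact: finite_finset.
    + move=> n; apply: prob_uniform; first exact: (finite_cube_fun n finite_finset).
        apply: (image_prob_is_prob (S := cn_cubes X n)) => //.
        * exact: finite_cube_fun.
        * exact: (finite_cube_fun n finite_finset).
        * exact: uniform_on_prob (finite_cube_fun n Xfin) (Xne n).
      by move=> c c' _ _; congr (image_prob _ _ _); apply/funext => v; case: (c v); case: (c' v).
    by move=> Z N g _ _ _ x w _; case: (g _); case: (g x).
  have pp : prime p by move: pm; rewrite mem_primes => /andP[].
  have [E' [C' [q [tE rd qR]]]] := Relq p pp.
  have rdX := reduction_step (ltn0Sn 0) (_ : coprime #|'I_1| p) (tower_nilspace tX) eX rd.
  have {}rdX := rdX _; have [|Efin qm _ qu] := reduction_uniform R (rdX _) Xfin.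
    by rewrite card_ord coprime1n.
  have nE := tower_nilspace tE.
  exists (existT (fun Y : compact_nilspace => X -> Y) (discrete_nilspace nE Efin) (q \o factor_pi (cn_cubes X) k)).
  split=> //=; last by move=> _ x y; apply: qR.
  move=> _; have [cfr pnil] := discrete_cfr R nE Efin tE.
  split=> //; first by move=> n; apply: qu.
  by move=> Z N g N0 Np gm x w wN; apply: (tower_morphism_cst N0 Np tE gm).
have [Xq XqP] := choice Xpi.
exists (fun p => projT1 (Xq p)), (fun p => projT2 (Xq p)); split.
- by move=> p pp; have [+ _ _] := XqP p; apply.
- by move=> p pm; have [_ + _] := XqP p; apply.
move=> x y xy; have /(factor_piP nX)/(step_sim nX st) // :
  factor_pi (cn_cubes X) k x = factor_pi (cn_cubes X) k y.
by apply: RelI => p pm; have [_ _ +] := XqP p; apply=> //; apply: xy.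
Qed.

Section IsomorphismClass.
Context (R : realType) (k : nat) (num : compact_nilspace -> nat)
  (hnum : complexity_notion R k num) (d : cube_metrics R).
Arguments d : clear implicits.
Hypothesis hd : balance_metrics d.

(* The bounds are computed from one representative X0 of the class, and X is
   mapped to X0 by an isomorphism that respects the metrics of balance. *)
Lemma class_bounds (N : nat) : exists B : nat * nat * (R -> R),
  (forall b, 0 < b -> 0 < B.2 b) /\
  forall (m : nat) (delta : R) (Z : finZmodType)
      (comp : forall p : nat, Z -> primary Z p) (f : Z -> R[i])
      (X : compact_nilspace) (phi : Z -> X) (F : X -> R[i]),
      (0 < m)%N -> 0 < delta -> primary_decomposition comp ->
      cfr_nilspace R k X -> num X = N ->
      morphism (Dcubes 1 Z) (cn_cubes X) phi -> (forall x, `|F x| <= 1) ->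
      torsion_nilspace k m (cn_cubes X) ->
      (delta%:C)%C <= `|average (fun z => f z * F (phi z))| ->
      exists (Xp : nat -> compact_nilspace)
        (phip : forall p : nat, primary Z p -> Xp p)
        (Fp : forall p : nat, Xp p -> R[i]),
        [/\ forall p, p \in primes #|Z| ->
              nilspace_polynomial k num B.1.2 (phip p) (Fp p) /\
              p_nilspace k p (cn_cubes (Xp p)),
            ((delta / B.1.1.+1%:R)%:C)%C <=
              `|average (fun z =>
                  f z * \prod_(p <- primes #|Z|) Fp p (phip p (comp p z)))| &
            forall b : R, 0 < b ->
              balanced d (B.2 b) (phi : Z -> forget_topology X) ->
              forall p, p \in primes #|Z| ->
                balanced d b (phip p : _ -> forget_topology (Xp p))].
Proof.
have [[X0 [m0 [X0N X0cfr m00 X0tor]]]|noX0] :=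
  pselect (exists X0 m0, [/\ num X0 = N, cfr_nilspace R k X0, (0 < m0)%N &
     torsion_nilspace k m0 (cn_cubes X0)]); last first.
  (* No nilspace of this class is torsion, so any bounds will do. *)
  exists (0%N, 0%N, fun=> 1); split=> // m delta Z comp f X phi F m_0 _ _ Xcfr XN _ _ Xtor _.
  by case: noX0; exists X, m.
(* The factors are formed with the exponent m0 of the representative, so the bounds do not involve
   the m of the given polynomial. *)
have [Xp [q [qP qpt qinj]]] := primary_factors m00 X0cfr X0tor.
have [X0fin _] := torsion_nilspace_finite m00 X0cfr X0tor.
(* The triple (p, n, b) is packed for [choice]; outside prime p and positive b the value is 0. *)
have mod_ex : forall z : nat * nat * R, exists e : R, prime z.1.1 -> 0 < z.2 -> 0 < e /\
    forall mu, is_prob (cn_cubes X0 z.1.2) mu ->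
    d (forget_topology X0) z.1.2 mu (uniform_on R (cn_cubes X0 z.1.2)) <= e ->
    d (forget_topology (Xp z.1.1)) z.1.2 (image_prob (fun c => q z.1.1 \o c) mu)
      (uniform_on R (cn_cubes (Xp z.1.1) z.1.2)) <= z.2.
  move=> [[p n] b] /=; have [pp|?] := boolP (prime p); last by exists 0.
  have [b0|?] := boolP (0 < b); last by exists 0.
  have qp := qP p pp.
  have [e e0 eP] := @balance_modulus R d hd (forget_topology X0) (forget_topology (Xp p)) (q p) n b
    X0fin (factor_finite qp) (factor_morphism qp) (factor_uniform qp n) b0.
  by exists e.
have [ef efP] := choice mod_ex.
have bf_ex : forall b : R, exists e : R, 0 < b -> [/\ 0 < e, e <= b &
    forall p, p \in primes m0 -> forall n, n%:R <= b^-1 -> e <= ef (p, n, b)].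
  move=> b; have [b0|?] := boolP (0 < b); last by exists 0.
  (* Only finitely many primes and dimensions matter for a given b. The further bound e <= b makes
     every n <= 1/b one of the dimensions controlled by e-balance. *)
  pose s := [seq (p, n) | p <- primes m0, n <- iota 0 (Num.bound b^-1)].
  have [|e [e0 eb es]] := @exists_lower_bound R _ s (fun z => ef (z.1, z.2, b)) b b0.
    move=> [p n] /allpairsP[[p' n'] /= [pm _ [-> ->]]].
    have pp : prime p' by move: pm; rewrite mem_primes => /andP[].
    by have [] := efP (p', n', b) pp b0.
  exists e => _; split=> // p pm n nb; apply: (es (p, n)).
  apply/allpairsP; exists (p, n); split=> //; rewrite mem_iota add0n /=.
  rewrite -(ltr_nat R); apply: le_lt_trans nb _.
  by apply: archi_boundP; rewrite invr_ge0 ltW.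
have [bf bfP] := choice bf_ex.
pose K := size (fset_set [set: X0]).
(* The last summand is for the primes dividing #|Z| but not m0. *)
pose M' := (\sum_(p <- primes m0) num (Xp p) + num pt_nilspace)%N.
exists (K, M', bf); split=> [b b0|]; first by have [] := bfP b b0.
move=> m delta Z comp f X phi F m_0 delta0 compP Xcfr XN phim F1 Xtor deltale /=.
have [fi [gi [fiK giK fim gim _]]] := (complexity_iso hnum Xcfr X0cfr).1 (etrans XN (esym X0N)).
have Xfin : finite_set [set: X].
  apply: (@sub_finite_set _ _ (gi @` [set: X0])); last exact: finite_image.
  by move=> x _; exists (fi x).
(* The isomorphism provided by the complexity notion need not respect the metrics; it only shows
   that one that does, h, exists. *)
have [|h hiso hd'] := balance_transport hd (X := forget_topology X) (Y := forget_topology X0) Xfin X0fin.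
  by exists fi; split=> //; exists gi.
have [hm [hg [hK hgK hgm]]] := hiso.
pose phi0 z : X0 := h (phi z).
have phi0m : morphism (Dcubes 1 Z) (cn_cubes X0) phi0.
  by move=> n c Dc; apply: (hm n (phi \o c)); apply: phim.
have [|x xP] := @average_pigeonhole R Z X0 f phi0 (F \o hg) delta X0fin delta0 (fun x => F1 (hg x)).
  by move: deltale; rewrite /phi0 /=; under eq_fun do rewrite -[phi _]hK.
have primeZ p : p \in primes #|Z| -> prime p by rewrite mem_primes => /andP[].
pose phip p (z : primary Z p) : Xp p := q p (phi0 (val z)).
have Z0 : (0 < #|Z|)%N by apply/card_gt0P; exists 0.
have qphi p : prime p -> morphism (Dcubes 1 Z) (cn_cubes (Xp p)) (q p \o phi0).
  by move=> pp n c Dc; apply: (factor_morphism (qP p pp) (c := phi0 \o c)); apply: phi0m.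
have phipE p z : p \in primes #|Z| -> phip p (comp p z) = q p (phi0 z).
  move=> pZ; have pp := primeZ _ pZ.
  rewrite -{2}(subrKC (val (comp p z)) z); apply/esym.
  apply: (factor_cst (qP p pp) (N := partn #|Z| (negn p)) (part_gt0 _ _)
    (primary_cofactor_coprime Z pp) (qphi p pp)).
  exact: comp_torsion.
pose Fp p (y : Xp p) : R[i] := (y == q p x)%:R.
(* For p dividing m0 but not #|Z|, the product does not test the coordinate [q p x]. It is the
   constant value of [q p \o phi0] because x is attained; otherwise the correlation would be 0. *)
have [z0 z0x] : exists z0, phi0 z0 = x.
  apply: contrapT => nox; move: xP; rewrite /average big1 => [|z _].
    rewrite mulr0 normr0 lecR => /le_lt_trans/(_ (divr_gt0 delta0 (ltr0Sn R K))).
    by rewrite ltxx.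
  by case: eqP => [zx|]; [case: nox; exists z|rewrite mulr0].
exists Xp, phip, Fp; split.
- move=> p pZ; have pp := primeZ _ pZ; have qp := qP p pp; split; last exact: factor_p_nilspace qp.
  split.
  + exact: factor_cfr qp.
  + have [pm|pm] := boolP (p \in primes m0).
      by rewrite /M' (bigD1_seq p) ?primes_uniq //= -addnA leq_addr.
    rewrite (_ : num (Xp p) = num pt_nilspace) ?leq_addl //.
    apply/(complexity_iso hnum (factor_cfr qp)).
      by have [] := discrete_cfr R (tower_nilspace (pt_tower 0 0)) finite_finset (pt_tower 0 k).
    by apply: single_point_isomorphic (qpt p pm) _ => -[] [].
  + move=> n c Dc; apply: (factor_morphism qp (c := phi0 \o (fun v => val (c v)))).
    exact/phi0m/(Dcubes_additive val).
  + by move=> y; rewrite /Fp normr_nat; case: eqP; rewrite ?lexx ?ler01.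
- rewrite (_ : (fun z => f z * \prod_(p <- _) _) = (fun z => f z * (phi0 z == x)%:R)) //.
  apply/funext => z; rewrite prod_indicator; congr (_ * _%:R); congr nat_of_bool.
  apply/allP/eqP => [zx|<- p pZ]; last by rewrite phipE.
  apply: qinj => p pm; have pp : prime p by move: pm; rewrite mem_primes => /andP[].
  have [pZ|pZ] := boolP (p \in primes #|Z|).
    by have /eqP := zx p pZ; rewrite phipE.
  rewrite -z0x -{1}(subrKC z0 z).
  apply: (factor_cst (qP p pp) Z0 _ (qphi p pp)); last by rewrite mulrn_card.
  by rewrite coprime_sym prime_coprime //; apply: contra pZ; rewrite mem_primes pp Z0.
move=> b b0 [_ bal] p pZ; have pp := primeZ _ pZ; have qp := qP p pp.
have [bf0 bfb bfe] := bfP b b0.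
split=> [|n nb]; first exact: factor_finite qp.
have Zpfin n' : finite_set [set: dcube n' -> primary Z p] by apply: finite_cube_fun finite_finset.
have Zfin n' : finite_set [set: dcube n' -> Z] by apply: finite_cube_fun finite_finset.
have X0Fin := finite_cube_fun n X0fin; have XFin := finite_cube_fun n Xfin.
have Zne : Dcubes 1 Z n !=set0 by exists (fun=> 0); apply: Dcubes_cst.
have Zpne : Dcubes 1 (primary Z p) n !=set0 by exists (fun=> 0); apply: Dcubes_cst.
set mu := image_prob (fun c : dcube n -> Z => phi0 \o c) (uniform_on R (Dcubes 1 Z n)).
have pmu : is_prob (cn_cubes X0 n) mu.
  apply: (image_prob_is_prob (S := Dcubes 1 Z n) (Zfin n) X0Fin (@phi0m n)).
  exact: uniform_on_prob (Zfin n) Zne.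
have -> : image_prob (fun c => phip p \o c) (uniform_on R (Dcubes 1 (primary Z p) n)) =
    image_prob (fun c => q p \o c) mu.
  rewrite -(image_uniform_ext R (finite_finset) (finite_finset) (primary_ext compP pZ) Zpne).
  rewrite /mu -(image_prob_comp _ _ _ (Zfin n) (Zpfin n)) -(image_prob_comp _ _ _ (Zfin n) X0Fin).
  congr image_prob; apply/funext => c; apply/funext => v /=; exact: phipE.
have [pm|pm] := boolP (p \in primes m0); last first.
  apply: (@balanced_pt R d hd (forget_topology (Xp p)) n b _ (qpt p pm) b0 (factor_finite qp)).
  by apply: image_prob_is_prob pmu => //;
    [exact: finite_cube_fun (factor_finite qp)|exact: factor_morphism qp n].
have [_ /(_ mu pmu)] := efP (p, n, b) pp b0; apply.
apply: le_trans (bfe p pm n nb).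
have nbf : n%:R <= (bf b)^-1 by apply: le_trans nb _; rewrite lef_pV2.
apply: le_trans (bal n nbf); rewrite -hd'.
- rewrite (image_uniform_ext R Xfin X0fin (isomorphism_ext hiso)); last first.
    exact: nilspace_cube_nonempty (forget_topology X0) n.
  by rewrite -(image_prob_comp _ _ _ (Zfin n) XFin) lexx.
- apply: (image_prob_is_prob (S := Dcubes 1 Z n) (Zfin n) XFin (@phim n)).
  exact: uniform_on_prob (Zfin n) Zne.
- exact: uniform_on_prob XFin (nilspace_cube_nonempty (forget_topology X) n).
Qed.

End IsomorphismClass.

Theorem theorem3p14 (R : realType) (k : nat) (hk : (0 < k)%N)
    (num : compact_nilspace -> nat) (hnum : complexity_notion R k num)
    (d : cube_metrics R) (hd : balance_metrics d) :
  exists (eps : R -> nat -> R) (M' : nat -> nat) (b' : nat -> R -> R),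
    (forall delta M, 0 < delta -> 0 < eps delta M) /\
    (forall M b, 0 < b -> 0 < b' M b) /\
    forall (m : nat) (delta : R) (Z : finZmodType)
      (comp : forall p : nat, Z -> primary Z p) (f : Z -> R[i])
      (M : nat) (X : compact_nilspace) (phi : Z -> X) (F : X -> R[i]),
      (0 < m)%N -> 0 < delta ->
      is_torsion m Z ->
      primary_decomposition comp ->
      (forall z, `|f z| <= 1) ->
      nilspace_polynomial k num M phi F ->
      torsion_nilspace k m (cn_cubes X) ->
      (delta%:C)%C <= `|average (fun z => f z * F (phi z))| ->
      exists (Xp : nat -> compact_nilspace)
        (phip : forall p : nat, primary Z p -> Xp p)
        (Fp : forall p : nat, Xp p -> R[i]),
        [/\ forall p, p \in primes #|Z| ->
              nilspace_polynomial k num (M' M) (phip p) (Fp p) /\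
              p_nilspace k p (cn_cubes (Xp p)),
            ((eps delta M)%:C)%C <=
              `|average (fun z =>
                  f z * \prod_(p <- primes #|Z|) Fp p (phip p (comp p z)))| &
            forall b : R, 0 < b ->
              balanced d (b' M b) (phi : Z -> forget_topology X) ->
              forall p, p \in primes #|Z| ->
                balanced d b (phip p : _ -> forget_topology (Xp p))].
Proof.
have [B BP] := choice (class_bounds hnum hd).
(* Sums over the finitely many classes of number at most M serve as maxima; for the balance a
   minimum is taken. *)
pose KM M := (\sum_(N < M.+1) (B N).1.1)%N.
have bex : forall z : nat * R, exists e : R, 0 < z.2 -> 0 < e /\
    forall N, (N <= z.1)%N -> e <= (B N).2 z.2.
  move=> [M b] /=; have [b0|?] := boolP (0 < b); last by exists 0.
  have [|e [e0 _ eP]] := @exists_lower_bound R _ (iota 0 M.+1) (fun N => (B N).2 b) 1 ltr01.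
    by move=> N _; apply: (BP N).1.
  by exists e => _; split=> // N NM; apply: eP; rewrite mem_iota add0n ltnS.
have [bf bfP] := choice bex.
exists (fun delta M => delta / (KM M).+1%:R), (fun M => (\sum_(N < M.+1) (B N).1.2)%N),
  (fun M b => bf (M, b)).
split=> [delta M delta0|]; first by rewrite divr_gt0 // ltr0n.
split=> [M b b0|]; first by have [] := bfP (M, b) b0.
move=> m delta Z comp f M X phi F m0 delta0 _ compP _ [Xcfr XM phim F1] Xtor deltale.
have [Xp [phip [Fp [H1 H2 H3]]]] :=
  (BP (num X)).2 m delta Z comp f X phi F m0 delta0 compP Xcfr erefl phim F1 Xtor deltale.
exists Xp, phip, Fp; split.
- move=> p pZ; have [[h1 h2 h3 h4] h5] := H1 p pZ; split=> //; split=> //.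
  apply: leq_trans h2 _; have XM' : (num X < M.+1)%N by [].
  by rewrite (bigD1 (Ordinal XM')) //= leq_addr.
- apply: le_trans H2; rewrite lecR ler_pM2l // lef_pV2 ?posrE ?ltr0n //.
  rewrite ler_nat ltnS; have XM' : (num X < M.+1)%N by [].
  by rewrite /KM (bigD1 (Ordinal XM')) //= leq_addr.
move=> b b0 [Xfin bal] p pZ; apply: H3 => //; split=> // n nb.
have [bf0 /(_ _ XM) bfB] := bfP (M, b) b0.
apply: (le_trans (bal n _) bfB); apply: le_trans nb _.
by rewrite lef_pV2 ?posrE //; apply: lt_le_trans bf0 bfB.
Qed.
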